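(* Let $m,n$ be positive integers, let $1\le p\le\infty$, let $T\in\mathcal{L}(^m\ell_1;\ell_p)$ and let $A_k\in\mathcal{L}(^n\ell_\infty;\ell_1)$ for all $k=1,\ldots,m$. Then the composition $T(A_1,\ldots,A_m)$ is multiple $(t,u)$-summing in the following cases: (i) for $(p,u)\in[1,2]\times\left[\frac{2n}{n+1},2\right]$ and $t=\dfrac{2pu}{4p+2u-pu-4}$; (ii) for $(p,u)\in[2,\infty]\times\left[\frac{2n}{n+1},2\right]$ and $t=\dfrac{2pu}{pu-2u+4}$; (iii) for $(p,u)\in[1,2]\times\left[1,\frac{2n}{n+1}\right]$ and $t=\dfrac{2np}{2p+np-2}$; (iv) for $(p,u)\in[2,\infty]\times\left[1,\frac{2n}{n+1}\right]$ and $t=\dfrac{2np}{np+2}$. For $p=\infty$ the values of $t$ in (ii) and (iv) are read as the limits when $p\to\infty$, i.e. $t=2$.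
   Context: All Banach spaces are over $\mathbb{K}=\mathbb{R}$ or $\mathbb{C}$. $\mathcal{L}(^mE;F)$ is the space of all bounded $m$-linear operators $E\times\cdots\times E\to F$. The composition $T(A_1,\ldots,A_m)$ is the $mn$-linear operator $\ell_\infty\times\cdots\times\ell_\infty\to\ell_p$ given by $(x^{(1)},\ldots,x^{(mn)})\mapsto T\big(A_1(x^{(1)},\ldots,x^{(n)}),\ldots,A_m(x^{((m-1)n+1)},\ldots,x^{(mn)})\big)$. For a Banach space $E$ with closed dual unit ball $B_{E^*}$ and $1\le s<\infty$, $\ell_s^w(E)$ is the space of sequences $(x_j)_{j=1}^\infty$ in $E$ with $\|(x_j)_{j=1}^\infty\|_{w,s}:=\sup_{\varphi\in B_{E^*}}\left(\sum_{j=1}^\infty|\varphi(x_j)|^s\right)^{1/s}<\infty$. For $1\le s\le r<\infty$, a bounded $N$-linear operator $S:E_1\times\cdots\times E_N\to F$ is multiple $(r,s)$-summing if there is a constant $C>0$ such that $\left(\sum_{j_1,\ldots,j_N=1}^\infty\|S(x^{(1)}_{j_1},\ldots,x^{(N)}_{j_N})\|_F^r\right)^{1/r}\le C\prod_{k=1}^N\|(x^{(k)}_{j})_{j=1}^\infty\|_{w,s}$ for all $(x_j^{(k)})_{j=1}^\infty\in\ell_s^w(E_k)$, $k=1,\ldots,N$. *)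

(* Defs.v *)
From HB Require Import structures.
From mathcomp Require Import all_boot all_order all_algebra.
From mathcomp Require Import finmap complex.
From mathcomp Require Import all_classical all_reals all_analysis.

Set Implicit Arguments.
Unset Strict Implicit.
Unset Printing Implicit Defensive.

Import Order.TTheory GRing.Theory Num.Theory.
Import numFieldNormedType.Exports.

Local Open Scope classical_set_scope.
Local Open Scope ring_scope.

Inductive base_field := RealField | ComplexField.

Definition scalars (R : realType) (b : base_field) : numFieldType :=
  match b with RealField => R | ComplexField => R[i] end.

(* In a normed module over K, the norm is K-valued.  Its values are real: [toR]
   reads them in R (it is the real part when K = R[i]) and [ofR] is the
   embedding of R into K. *)
Definition toR (R : realType) (b : base_field) : scalars R b -> R :=
  match b with RealField => fun x => x | ComplexField => fun z => complex.Re z end.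

Definition ofR (R : realType) (b : base_field) : R -> scalars R b :=
  match b with RealField => fun x => x | ComplexField => fun x => x%:C%C end.

Arguments toR {R b} _.

Section scalars_theory.
Context {R : realType} {b : base_field}.
Local Notation K := (scalars R b).
Implicit Types (x y : R) (z : K).

Lemma ofRK x : toR (ofR b x) = x. Proof. by case: b. Qed.

Lemma ofRD x y : ofR b (x + y) = ofR b x + ofR b y.
Proof. by case: b => //=; rewrite rmorphD. Qed.

Lemma ofRM x y : ofR b (x * y) = ofR b x * ofR b y.
Proof. by case: b => //=; rewrite rmorphM. Qed.

Lemma ofR_le x y : (ofR b x <= ofR b y) = (x <= y).
Proof. by case: b => //=; rewrite lecR. Qed.

Lemma ofR0 : ofR b (0 : R) = 0. Proof. by case: b. Qed.

Lemma toR_normK z : ofR b (toR `|z|) = `|z|.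
Proof. by case: b z => //= z; rewrite normc_def. Qed.

Lemma toR_norm_ge0 z : 0 <= toR `|z|.
Proof. by rewrite -ofR_le toR_normK ofR0. Qed.

Lemma toR_normM z z' : toR `|z * z'| = toR `|z| * toR `|z'|.
Proof. by rewrite -[RHS]ofRK ofRM !toR_normK normrM. Qed.

Lemma ler_toR_normD z z' : toR `|z + z'| <= toR `|z| + toR `|z'|.
Proof. by rewrite -ofR_le ofRD !toR_normK ler_normD. Qed.

Lemma toR_norm0 : toR (`|0 : K|) = 0.
Proof. by rewrite normr0 -ofR0 ofRK. Qed.

Lemma toR_norm_eq0 z : toR `|z| = 0 -> z = 0.
Proof. by move=> z0; apply/normr0_eq0; rewrite -toR_normK z0 ofR0. Qed.

End scalars_theory.

Lemma counting_eq0 (R : realType) (N : set nat) :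
  (@counting nat R) N = 0%E -> N = set0.
Proof.
rewrite /counting; case: asboolP => // finN [].
move=> /eqP; rewrite pnatr_eq0 cardfs_eq0 => /eqP N0.
by rewrite -(fset_setK finN) N0 set_fset0.
Qed.

Section ell.
Context {R : realType} (b : base_field) (p : \bar R).
Local Notation K := (scalars R b).
Implicit Types x y : nat -> K.

Definition ell_norm x : \bar R :=
  ('N[counting]_p[EFin \o (fun k => toR `|x k|)])%E.

Definition ell_mem : {pred nat -> K} := mem [set x | (ell_norm x < +oo)%E].

Let absx x : nat -> R := fun k => toR `|x k|.

Let measn (h : nat -> R) : measurable_fun setT h.
Proof. by []. Qed.

Let le_Lnorm (h k : nat -> R) : (1 <= p)%E -> (forall i, 0 <= h i <= k i) ->
  ('N[counting]_p[EFin \o h] <= 'N[counting]_p[EFin \o k])%E.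
Proof.
move=> p1 hk; have hk' i : (`|(h i)%:E| <= `|(k i)%:E|)%E.
  have /andP[h0 hki] := hk i.
  by rewrite /= lee_fin !ger0_norm// (le_trans h0).
rewrite unlock; case: p p1 => [r r1||//].
  have r0 : 0 <= r by rewrite (le_trans ler01)// -lee_fin.
  apply: gt0_ler_poweR => //; rewrite ?invr_ge0// ?in_itv/= ?leey ?andbT.
  - by apply: integral_ge0 => i _; rewrite lee_fin powR_ge0.
  - by apply: integral_ge0 => i _; rewrite lee_fin powR_ge0.
  apply: ge0_le_integral => // i _; rewrite lee_fin ?powR_ge0//.
  by apply: ge0_ler_powR; rewrite ?nnegrE//; exact: hk'.
by move=> _; case: ifPn => // _; apply: ess_sup_inf.le_ess_sup; exact: nearW.
Qed.

Context (p1 : (1 <= p)%E).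

Lemma ell_norm0 : ell_norm 0 = 0%E.
Proof.
rewrite /ell_norm -[RHS](@Lnorm0 _ _ _ (@counting nat R) p).
  by apply: eq_Lnorm => i /=; rewrite toR_norm0.
by rewrite gt_eqF// (lt_le_trans _ p1).
Qed.

Lemma ell_normD x y : (ell_norm (x + y)%R <= ell_norm x + ell_norm y)%E.
Proof.
have mink : ('N[counting]_p[EFin \o (absx x \+ absx y)%R] <=
             ell_norm x + ell_norm y)%E by exact: eminkowski.
apply: le_trans mink; apply: le_Lnorm => // i.
by rewrite toR_norm_ge0 ler_toR_normD.
Qed.

Lemma ell_normZ (a : K) x : x \in ell_mem ->
  ell_norm (a *: x) = ((toR `|a|)%:E * ell_norm x)%E.
Proof.
rewrite inE /= => xfin.
have xL : absx x \in Lfun counting p.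
  by apply/andP; split; rewrite inE//=.
have := LnormZ (Lfun_Sub p1 xL) (toR `|a|).
rewrite (ger0_norm (toR_norm_ge0 a)) => NZ.
transitivity ('N[counting]_p[EFin \o (toR `|a| \*: Lfun_Sub p1 xL)%R])%E.
  by apply: eq_Lnorm => i /=; rewrite toR_normM.
exact: NZ.
Qed.

Lemma ell_norm_eq0 x : ell_norm x = 0%E -> x = 0.
Proof.
move=> x0; apply/funext => i.
have p0 : (0 < p)%E by rewrite (lt_le_trans _ p1).
have [N [_ N0 sub]] : {ae @counting nat R, forall k, (absx x k)%:E = 0%E}.
  have := @Lnorm_eq0_eq0 _ _ _ (@counting nat R) (EFin \o absx x) p _ p0 x0.
  by move=> /(_ ltac:(by [])); apply: filterS => k /= /(_ I).
have [xi0|xi0] := pselect (x i = 0); first by [].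
have : N i by apply: sub => /= -[] /toR_norm_eq0.
by rewrite (@counting_eq0 _ _ N0).
Qed.

Lemma ell_submod_closed : submod_closed ell_mem.
Proof.
split=> [|a x y xf yf]; first by rewrite inE /= ell_norm0.
rewrite inE /= (le_lt_trans (ell_normD _ _))// lte_add_pinfty//.
  rewrite ell_normZ// lte_mul_pinfty ?lee_fin ?toR_norm_ge0//.
  by move: xf; rewrite inE.
by move: yf; rewrite inE.
Qed.

HB.instance Definition _ :=
  GRing.isSubmodClosed.Build _ _ ell_mem ell_submod_closed.

(* The proof q1 is a phantom parameter: l_p is normed only if 1 <= p, so
   the instances below need it. *)
Record ell (q1 : (1 <= p)%E) : Type :=
  Ell { ell_seq :> nat -> K ; _ : ell_seq \in ell_mem }.

HB.instance Definition _ := [isSub of ell p1 for @ell_seq p1].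
HB.instance Definition _ := [Choice of ell p1 by <:].
HB.instance Definition _ := [SubChoice_isSubLmodule of ell p1 by <:].

Definition ell_normK (x : ell p1) : K := ofR b (fine (ell_norm x)).

Lemma ell_norm_fineK (x : ell p1) : (fine (ell_norm x))%:E = ell_norm x.
Proof.
rewrite fineK// ge0_fin_numE ?Lnorm_ge0//.
by have := valP x; rewrite inE.
Qed.

Lemma ell_normK_D (x y : ell p1) : ell_normK (x + y) <= ell_normK x + ell_normK y.
Proof.
by rewrite -ofRD ofR_le -lee_fin EFinD !ell_norm_fineK ell_normD.
Qed.

Lemma ell_normK_Z (a : K) (x : ell p1) : ell_normK (a *: x) = `|a| * ell_normK x.
Proof.
rewrite -toR_normK -ofRM; congr ofR; apply: EFin_inj.
by rewrite EFinM !ell_norm_fineK ell_normZ ?(valP x).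
Qed.

Lemma ell_normK_eq0 (x : ell p1) : ell_normK x = 0 -> x = 0.
Proof.
move=> x0; apply: val_inj => /=; apply: ell_norm_eq0.
rewrite -ell_norm_fineK -[fine _](@ofRK R b); congr EFin.
by rewrite -[RHS](@ofRK R b) -/(ell_normK x) x0 ofR0.
Qed.

HB.instance Definition _ := Lmodule_isNormed.Build K (ell p1)
  ell_normK_D ell_normK_Z ell_normK_eq0.

Lemma toR_ell_norm (x : ell p1) : (toR `|x|)%:E = ell_norm x.
Proof. by rewrite -ell_norm_fineK /Num.norm /= /ell_normK ofRK. Qed.

End ell.

Lemma ell_norm_finE (R : realType) (b : base_field) (r : R)
    (x : nat -> scalars R b) : 0 < r ->
  ell_norm r%:E x = ((\sum_(k <oo) ((toR `|x k|) `^ r)%:E) `^ r^-1)%E.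
Proof.
move=> r0; rewrite /ell_norm Lnorm_counting//; congr (_ `^ _)%E.
by apply: eq_eseriesr => k _ /=; rewrite ger0_norm ?toR_norm_ge0.
Qed.

Lemma ell_norm_inftyE (R : realType) (b : base_field) (x : nat -> scalars R b) :
  ell_norm +oo x = ereal_sup (range (fun k => (toR `|x k|)%:E)).
Proof.
have abse_id k : (`|(toR `|x k|)%:E| = (toR `|x k|)%:E)%E.
  by rewrite /= ger0_norm ?toR_norm_ge0.
rewrite /ell_norm unlock ifT; last first.
  rewrite lt0e measure_ge0 andbT; apply/eqP => /counting_eq0.
  by move=> /seteqP[/(_ 0%N I)].
apply/eqP; rewrite eq_le; apply/andP; split.
  apply: ereal_inf_lbound => /=; apply: nearW => k.
  by rewrite -[leLHS]/(`|(toR `|x k|)%:E|)%E abse_id; apply: ereal_sup_ubound;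
     exists k.
apply: ge_ereal_sup => _ [k _ <-]; apply: le_ereal_inf_tmp => y [N [_ N0 sub]].
rewrite leNgt; apply/negP => yk.
suff : N k by rewrite (@counting_eq0 _ _ N0).
apply: sub => /= /le_lt_trans /(_ yk).
by rewrite ger0_norm ?toR_norm_ge0// ltxx.
Qed.

Arguments ell {R} b {p} q1.

Notation ell1 R b := (@ell R b 1%E (lexx _)).
Notation ell_infty R b := (@ell R b +oo%E (leey _)).

Section multilinear.
Context {R : realType} {b : base_field}.
Local Notation K := (scalars R b).

Definition bounded_multilinear (N : nat) (E F : normedModType K)
    (S : ('I_N -> E) -> F) : Prop :=
  (forall (i : 'I_N) (x : 'I_N -> E) (a : K) (y z : E),
     S [eta x with i |-> a *: y + z] =
     a *: S [eta x with i |-> y] + S [eta x with i |-> z]) /\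
  exists C : R, forall x : 'I_N -> E,
    toR `|S x| <= C * \prod_(i < N) toR `|x i|.

Lemma block_index_subproof (m n : nat) (k : 'I_m) (i : 'I_n) :
  (k * n + i < m * n)%N.
Proof.
rewrite (@leq_trans (k * n + n))%N// ?ltn_add2l//.
by rewrite -mulSnr leq_mul2r ltn_ord orbT.
Qed.

Definition block_index (m n : nat) (k : 'I_m) (i : 'I_n) : 'I_(m * n) :=
  Ordinal (block_index_subproof k i).

Definition multicomp (m n : nat) (E F G : Type)
    (T : ('I_m -> F) -> G) (A : 'I_m -> ('I_n -> E) -> F) :
    ('I_(m * n) -> E) -> G :=
  fun x => T (fun k => A k (fun i => x (block_index k i))).

(* The bound on the unit ball both makes phi continuous and says that its
   operator norm is at most 1. *)
Definition dual_ball (E : normedModType K) : set {scalar E} :=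
  [set phi | forall y : E, `|y| <= 1 -> `|phi y| <= 1].
Arguments dual_ball : clear implicits.

Definition weak_norm (E : normedModType K) (s : R) (x : nat -> E) : \bar R :=
  ereal_sup [set ((\sum_(j <oo) ((toR `|phi (x j)|) `^ s)%:E) `^ s^-1)%E
            | phi in dual_ball E].

(* For j = (j_1, ..., j_N), the sum runs over all of nat^N. *)
Definition multiple_summing (N : nat) (E F : normedModType K) (r s : R)
    (S : ('I_N -> E) -> F) : Prop :=
  [/\ 1 <= s, s <= r, bounded_multilinear S &
   exists2 C : R, 0 < C & forall x : 'I_N -> nat -> E,
     (forall k, weak_norm s (x k) < +oo)%E ->
     ((\esum_(j in [set: {ffun 'I_N -> nat}])
         ((toR `|S (fun k => x k (j k))|) `^ r)%:E) `^ r^-1 <=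
      (C * \prod_(k < N) fine (weak_norm s (x k)))%:E)%E].

End multilinear.

(* Main.v *)
From HB Require Import structures.
Require Import Defs.
From mathcomp Require Import all_boot all_order all_algebra.
From mathcomp Require Import cyclic separable cyclotomic.
From mathcomp Require Import finmap complex.
From mathcomp Require Import all_classical all_reals all_analysis.
From mathcomp Require Import ring lra.

Set Implicit Arguments.
Unset Strict Implicit.
Unset Printing Implicit Defensive.

Import Order.TTheory GRing.Theory Num.Theory.
Import numFieldNormedType.Exports.

Local Open Scope classical_set_scope.
Local Open Scope ring_scope.

(** The theorem is a real inequality for finite families once the functions in
    [l_oo] are replaced by functions that are constant on the atoms of a finite
    partition of the index set, the scalars by their real and imaginary parts,
    and the values in [l_1] and [l_p] by their first coordinates
    ([real_summing], [finite_family_summing]).  Testing a weakly [u]-summable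
    sequence on the coordinates of [l_oo] gives
    [\sum_j `|x_j(d)| `^ u <= w `^ u] for every atom [d] ([weak_norm_coord]).
    If [y_k(j, r)] is the coordinate [r] of the value of [A_k] at the functions
    of indices [j], and [tau(rho)] the value of [T] at the basis vectors of
    indices [rho], the quantity to be summed is
    [S(j, c) = \sum_rho (\prod_k y_k(j_k, rho_k)) * tau(rho, c)].

    There are two endpoint estimates.  If all the functions are in [l_oo(l_2)],
    Grothendieck's theorem shows that the values of the [A_k] are in [l_2(l_1)]
    ([unit_form_l2]), so that any norm of [tau(rho)] that is bounded in [rho]
    gives an estimate of [S] in [l_2] ([endpoint_l2]).  If moreover the
    functions of one index [i0] are in [l_oo(l_1)], and [tau] takes its values
    in [l_2], then [S] is in [l_1(l_2)], the exponent 1 being on the indices in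
    position [i0] ([endpoint_l1]).  Indeed [g |-> \sum_r y(j, r) * g(r)] is
    then, again by Grothendieck's theorem, a 2-summing operator from [l_oo] to
    [l_1(l_2)] ([unit_form_l1]); by Pietsch's theorem it factors through a space
    [L_2(nu)] ([Pietsch]); and tensor products of operators from [L_2(nu)] to
    [l_1(l_2)] are bounded by Khinchine's inequality ([tensor_l1l2]).

    The [n] choices of [i0] and the first estimate are combined by an
    interpolation inequality for multilinear forms ([interpolation]).  Let
    [1 / u = (1 + ka) / 2], with [u] between 2 and 1, and let [p] be between 2
    and 1, or between 2 and [+oo], with parameter [th].  The weights are
    [th * ka] on each of the [n] estimates of the second kind,
    [th * (1 - n * ka)] on the first one with [tau] in [l_2], and [1 - th] on
    the first one with [tau] in [l_1] or [l_oo]; they exist because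
    [n * ka <= 1], which is the condition [2 * n / (n + 1) <= u].  Each position
    carries the exponent 1 with weight [th * ka] and 2 otherwise, so the mean
    exponent is [1 / t = (1 + th * ka) / 2].  By duality the interpolation has
    to be done on the coefficients of a functional, which are to be written as
    geometric means of coefficients that are admissible at the endpoints; the
    chain rule for conditional probabilities provides such a factorization
    ([chain_rule], [functional_bound]).  Smaller values of [u] follow from
    [u = 2 * n / (n + 1)], a bound on the sums of [u]-th powers being stronger
    than one on sums of larger powers. *)

Lemma le_of_eq (R : realType) (x y : R) : x = y -> x <= y.
Proof. by move=> ->. Qed.

(** * Euclidean norms of finite families *)

Section Euclidean.
Context {R : realType}.
Implicit Types (I K : finType).

Definition nrm2 I (P : pred I) (f : I -> R) : R :=
  Num.sqrt (\sum_(i | P i) f i ^+ 2).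

Lemma nrm2_ge0 I (P : pred I) f : 0 <= nrm2 P f.
Proof. exact: sqrtr_ge0. Qed.

Lemma nrm2_sqr I (P : pred I) f : nrm2 P f ^+ 2 = \sum_(i | P i) f i ^+ 2.
Proof. by rewrite sqr_sqrtr// sumr_ge0// => i _; exact: sqr_ge0. Qed.

Lemma eq_nrm2 I (P : pred I) f g : (forall i, P i -> f i = g i) ->
  nrm2 P f = nrm2 P g.
Proof. by move=> fg; congr Num.sqrt; apply: eq_bigr => i /fg ->. Qed.

Lemma nrm2_le I (P : pred I) f g : (forall i, P i -> `|f i| <= g i) ->
  nrm2 P f <= nrm2 P g.
Proof.
move=> fg; rewrite ler_sqrt ?sumr_ge0// => [|i _]; last exact: sqr_ge0.
apply: ler_sum => i Pi; rewrite -(real_normK (num_real (f i))) ler_sqr ?nnegrE//.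
  exact: fg.
exact: le_trans (fg i Pi).
Qed.

Lemma nrm2_abs I (P : pred I) f : nrm2 P (fun i => `|f i|) = nrm2 P f.
Proof. by congr Num.sqrt; apply: eq_bigr => i _; rewrite real_normK ?num_real. Qed.

Lemma nrm2_leP I (P : pred I) f C : 0 <= C ->
  (nrm2 P f <= C) = (\sum_(i | P i) f i ^+ 2 <= C ^+ 2).
Proof.
by move=> C0; rewrite -nrm2_sqr ler_sqr ?nnegrE// nrm2_ge0.
Qed.

Lemma nrm2Z I (P : pred I) f c : nrm2 P (fun i => c * f i) = `|c| * nrm2 P f.
Proof.
rewrite /nrm2 -sqrtr_sqr -sqrtrM ?sqr_ge0// mulr_sumr.
by congr Num.sqrt; apply: eq_bigr => i _; rewrite exprMn.
Qed.

Lemma CauchySchwarz I (P : pred I) (f g : I -> R) :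
  \sum_(i | P i) f i * g i <= nrm2 P f * nrm2 P g.
Proof.
set A := nrm2 P f; set B := nrm2 P g.
have A0 : 0 <= A := nrm2_ge0 _ _; have B0 : 0 <= B := nrm2_ge0 _ _.
have key (s t : R) : 0 <= s ^+ 2 * A ^+ 2 + t ^+ 2 * B ^+ 2
    - 2 * s * t * (\sum_(i | P i) f i * g i).
  rewrite !nrm2_sqr !mulr_sumr -big_split/= -sumrB sumr_ge0// => i _.
  rewrite [X in 0 <= X](_ : _ = (s * f i - t * g i) ^+ 2) ?sqr_ge0//; ring.
have [AB|AB] := ltP 0 (A * B).
  have := key B A.
  rewrite [X in 0 <= X](_ : _ = 2 * (A * B) * (A * B - \sum_(i | P i) f i * g i));
    last ring.
  by rewrite pmulr_rge0 ?subr_ge0// mulr_gt0.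
have : A * B == 0 by rewrite eq_le AB mulr_ge0.
rewrite mulf_eq0 => /orP[]/eqP z.
  rewrite z mul0r big1// => i Pi.
  have /eqP := nrm2_sqr P f; rewrite -/A z expr0n/= eq_sym psumr_eq0 => [|j _];
    last exact: sqr_ge0.
  by move=> /allP/(_ i); rewrite mem_index_enum Pi sqrf_eq0 => /(_ isT)/eqP ->; rewrite mul0r.
rewrite z mulr0 big1// => i Pi.
have /eqP := nrm2_sqr P g; rewrite -/B z expr0n/= eq_sym psumr_eq0 => [|j _];
  last exact: sqr_ge0.
by move=> /allP/(_ i); rewrite mem_index_enum Pi sqrf_eq0 => /(_ isT)/eqP ->; rewrite mulr0.
Qed.

Lemma nrm2D I (P : pred I) f g :
  nrm2 P (fun i => f i + g i) <= nrm2 P f + nrm2 P g.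
Proof.
rewrite nrm2_leP ?addr_ge0 ?nrm2_ge0// sqrrD !nrm2_sqr.
have := CauchySchwarz P f g.
under [X in _ -> X <= _]eq_bigr do rewrite sqrrD.
rewrite 2!big_split/= => h.
by rewrite lerD2r lerD2l sumrMnl lerMn2r h orbT.
Qed.

Lemma nrm2_sum I (P : pred I) (T : Type) (r : seq T) (F : T -> I -> R) :
  nrm2 P (fun i => \sum_(t <- r) F t i) <= \sum_(t <- r) nrm2 P (F t).
Proof.
elim: r => [|t r IH].
  rewrite big_nil (eq_nrm2 (g := fun=> 0)) => [|i _]; last by rewrite big_nil.
  by rewrite /nrm2 big1 ?sqrtr0// => i _; rewrite expr0n.
rewrite big_cons (eq_nrm2 (g := fun i => F t i + \sum_(t <- r) F t i)).
  by apply: le_trans (nrm2D _ _ _) _; rewrite lerD2l.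
by move=> i _; rewrite big_cons.
Qed.

Lemma nrm2_nrm2 I K (P : pred I) (Q : pred K) (F : I -> K -> R) :
  nrm2 P (fun i => nrm2 Q (F i)) = nrm2 Q (fun k => nrm2 P (F^~ k)).
Proof.
congr Num.sqrt; under eq_bigr do rewrite nrm2_sqr.
by rewrite exchange_big/=; under [RHS]eq_bigr do rewrite nrm2_sqr.
Qed.

End Euclidean.

(** * Khinchine's inequality *)

Section Khinchine.
Context {R : realType}.

Definition avg (X : finType) (g : X -> R) : R := #|X|%:R^-1 * \sum_x g x.

Lemma avgD (X : finType) (g h : X -> R) :
  avg (fun x => g x + h x) = avg g + avg h.
Proof. by rewrite /avg big_split mulrDr. Qed.

Lemma avgZ (X : finType) c (g : X -> R) : avg (fun x => c * g x) = c * avg g.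
Proof. by rewrite /avg -mulr_sumr mulrCA. Qed.

Lemma ler_avg (X : finType) (g h : X -> R) : (forall x, g x <= h x) ->
  avg g <= avg h.
Proof. by move=> gh; rewrite ler_wpM2l ?invr_ge0// ler_sum. Qed.

Lemma avg_cst (X : finType) (c : R) : (0 < #|X|)%N -> avg (fun _ : X => c) = c.
Proof.
move=> X0; rewrite /avg sumr_const -[c *+ _]mulr_natl mulrA mulVf ?mul1r//.
by rewrite pnatr_eq0 -lt0n.
Qed.

Lemma avg_ge0 (X : finType) (g : X -> R) : (forall x, 0 <= g x) -> 0 <= avg g.
Proof. by move=> g0; rewrite mulr_ge0 ?invr_ge0// sumr_ge0. Qed.

Variable J : finType.
Local Notation signs := {ffun J -> bool}.

Definition sgn (b : bool) : R := (-1) ^+ b.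

Lemma card_signs : (0 < #|signs|)%N.
Proof. by apply/card_gt0P; exists [ffun=> true]. Qed.

Lemma avg_signs_cst c : avg (fun _ : signs => c) = c.
Proof. exact: avg_cst card_signs. Qed.

Definition flip (j : J) (e : signs) : signs :=
  [ffun i => if i == j then ~~ e i else e i].

Lemma flipK j : involutive (flip j).
Proof. by move=> e; apply/ffunP => i; rewrite !ffunE; case: eqP => // _; rewrite negbK. Qed.

(** Changing one sign preserves the mean over all signs; in the expansions of
    the moments of a Rademacher sum, this removes the odd powers of a sign. *)
Lemma avg_odd j (h : signs -> R) : (forall e, h (flip j e) = - h e) -> avg h = 0.
Proof.
move=> odd_h; suff : \sum_e h e = 0 by rewrite /avg => ->; rewrite mulr0.
have : \sum_e h e = - \sum_e h e.
  rewrite -[RHS]sumrN (reindex_inj (inv_inj (flipK j)))/=.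
  by apply: eq_bigr => e _; exact: odd_h.
by lra.
Qed.

Definition rad (r : seq J) (a : J -> R) (e : signs) : R :=
  \sum_(j <- r) sgn (e j) * a j.

Lemma rad_flip r a j e : j \notin r -> rad r a (flip j e) = rad r a e.
Proof.
move=> jr; apply: eq_big_seq => i ir; rewrite ffunE; case: eqP => // ij.
by rewrite -ij ir in jr.
Qed.

Lemma sgn_flip j (e : signs) : sgn (flip j e j) = - sgn (e j).
Proof. by rewrite ffunE eqxx /sgn; case: (e j); rewrite ?expr1 ?expr0 ?opprK. Qed.

Lemma sgn_sqr b : sgn b ^+ 2 = 1.
Proof. by case: b; rewrite /sgn ?expr1 ?expr0 ?sqrrN ?expr1n. Qed.

Lemma avg_rad2 (r : seq J) a : uniq r ->
  avg (fun e : signs => rad r a e ^+ 2) = \sum_(j <- r) a j ^+ 2.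
Proof.
elim: r => [_|j r IH /= /andP[jr ur]].
  by under eq_fun do rewrite /rad big_nil expr0n/=; rewrite avg_signs_cst big_nil.
rewrite big_cons -IH// -(avg_signs_cst (a j ^+ 2)).
transitivity (avg (fun e => (a j ^+ 2 + rad r a e ^+ 2)
                + (2 * a j) * (sgn (e j) * rad r a e))).
  congr avg; apply/funext => e; rewrite /rad big_cons.
  have := sgn_sqr (e j); set s := sgn _; set S := \sum_(_ <- _) _ => s2.
  transitivity (s ^+ 2 * a j ^+ 2 + S ^+ 2 + 2 * a j * (s * S)); first by ring.
  by rewrite s2 mul1r.
rewrite 2!avgD avgZ.
have -> : avg (fun e : signs => sgn (e j) * rad r a e) = 0.
  by apply: (@avg_odd j) => e; rewrite sgn_flip rad_flip// mulNr.
by rewrite mulr0 addr0.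
Qed.

Lemma avg_rad4 (r : seq J) a : uniq r ->
  avg (fun e : signs => rad r a e ^+ 4) <= 3 * (\sum_(j <- r) a j ^+ 2) ^+ 2.
Proof.
elim: r => [_|j r IH /= /andP[jr ur]].
  under eq_fun do rewrite /rad big_nil expr0n/=.
  by rewrite avg_signs_cst big_nil expr0n mulr0.
have -> : avg (fun e : signs => rad (j :: r) a e ^+ 4) =
    avg (fun e => ((rad r a e ^+ 4 + (6 * a j ^+ 2) * rad r a e ^+ 2) + a j ^+ 4)
      + ((4 * a j) * (sgn (e j) * rad r a e ^+ 3)
         + (4 * a j ^+ 3) * (sgn (e j) * rad r a e))).
  congr avg; apply/funext => e; rewrite /rad big_cons.
  have := sgn_sqr (e j); set s := sgn _; set S := \sum_(_ <- _) _ => s2.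
  have s3 : s ^+ 3 = s by rewrite exprS s2 mulr1.
  have s4 : s ^+ 4 = 1 by rewrite -[4%N]/(2 * 2)%N exprM s2 expr1n.
  transitivity (S ^+ 4 + 6 * a j ^+ 2 * (s ^+ 2 * S ^+ 2) + s ^+ 4 * a j ^+ 4
     + (4 * a j * (s * S ^+ 3) + 4 * a j ^+ 3 * (s ^+ 3 * S))); first by ring.
  by rewrite s2 s3 s4 !mul1r.
rewrite 4!avgD !avgZ avg_rad2// avg_signs_cst.
have -> : avg (fun e : signs => sgn (e j) * rad r a e) = 0.
  by apply: (@avg_odd j) => e; rewrite sgn_flip rad_flip// mulNr.
have -> : avg (fun e : signs => sgn (e j) * rad r a e ^+ 3) = 0.
  by apply: (@avg_odd j) => e; rewrite sgn_flip rad_flip// mulNr.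
rewrite !mulr0 !addr0 big_cons.
move: (IH ur); set Q := \sum_(_ <- _) _; set X := avg _ => h.
have Q0 : 0 <= Q by apply: sumr_ge0 => i _; exact: sqr_ge0.
suff : 0 <= 3 * (a j ^+ 2 + Q) ^+ 2 - (3 * Q ^+ 2 + 6 * a j ^+ 2 * Q + a j ^+ 4).
  by lra.
rewrite [X in 0 <= X](_ : _ = 2 * (a j ^+ 2) ^+ 2); last by ring.
by rewrite mulr_ge0// sqr_ge0.
Qed.

(** If the variance is [sigma ^ 2], then
    [x * sigma ^ 3 >= x ^ 2 * sigma ^ 2 - (4 / 27) * x ^ 4] for [0 <= x], with
    equality at [0] and [3 / 2 * sigma]; since the fourth moment is at most
    [3 * sigma ^ 4], the mean of this inequality bounds the first moment from
    below by [5 / 9 * sigma]. *)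
Lemma Khinchine (a : J -> R) :
  nrm2 predT a <= 2 * avg (fun e : signs => `|\sum_j sgn (e j) * a j|).
Proof.
set s := nrm2 _ _; have s0 : 0 <= s := nrm2_ge0 _ _.
pose S (e : signs) := rad (index_enum J) a e.
have E2 : avg (fun e => S e ^+ 2) = s ^+ 2.
  by rewrite avg_rad2 ?index_enum_uniq// nrm2_sqr.
have E4 : avg (fun e => S e ^+ 4) <= 3 * s ^+ 4.
  by rewrite -[4%N]/(2 * 2)%N [s ^+ _]exprM nrm2_sqr avg_rad4// index_enum_uniq.
have pt e : s ^+ 2 * S e ^+ 2 + - (4 / 27) * S e ^+ 4 <= s ^+ 3 * `|S e|.
  rewrite -(real_normK (num_real (S e))).
  rewrite (_ : S e ^+ 4 = `|S e| ^+ 4); last first.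
    by rewrite -[4%N]/(2 * 2)%N !exprM (real_normK (num_real (S e))).
  set x := `|S e|; have x0 : 0 <= x by exact: normr_ge0.
  rewrite -subr_ge0 [X in 0 <= X](_ : _ = (4 / 27) * x * (x - 3 / 2 * s) ^+ 2
     * (x + 3 * s)); last by field.
  by apply: mulr_ge0; [apply: mulr_ge0; [lra|exact: sqr_ge0]|lra].
have := ler_avg pt; rewrite avgD !avgZ E2 => h.
have h2 : s ^+ 4 * (5 / 9) <= s ^+ 3 * avg (fun e => `|S e|).
  apply: le_trans h; have -> : s ^+ 2 * s ^+ 2 = s ^+ 4 by rewrite -exprD.
  move: E4; set X := avg _; set Y := s ^+ 4. lra.
change (s <= 2 * avg (fun e => `|S e|)).
have [->|sN0] := eqVneq s 0; first by rewrite mulr_ge0// avg_ge0.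
have sp : 0 < s by rewrite lt_neqAle eq_sym sN0.
have : s * (5 / 9) <= avg (fun e => `|S e|).
  by move: h2; rewrite exprSr -mulrA ler_pM2l// exprn_gt0.
by lra.
Qed.

Lemma rad_sqr (a : J -> R) :
  avg (fun e : signs => (\sum_j sgn (e j) * a j) ^+ 2) = \sum_j a j ^+ 2.
Proof. exact: avg_rad2 (index_enum_uniq J). Qed.

Lemma rad_4 (a : J -> R) :
  avg (fun e : signs => (\sum_j sgn (e j) * a j) ^+ 4) <= 3 * (\sum_j a j ^+ 2) ^+ 2.
Proof. exact: avg_rad4 (index_enum_uniq J). Qed.

End Khinchine.

(** * Grothendieck's theorem *)

Section Grothendieck.
Context {R : realType}.

(** A discrete form of the inequality [q c <= K * \int `|psi c| d mu], [mu] a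
    probability measure on the functionals that are bounded by 1 on the
    coordinates. *)
Definition l1_dominated (K : R) (D : finType) (q : (D -> R) -> R) : Prop :=
  exists (I : finType) (w : I -> R) (psi : I -> D -> R),
    [/\ forall i, 0 <= w i, forall i d, `|psi i d| <= 1, \sum_i w i <= K &
        forall c, q c <= \sum_i w i * `|\sum_d c d * psi i d|].

Lemma l1_dominatedW K K' (D : finType) (q : (D -> R) -> R) : K <= K' ->
  l1_dominated K q -> l1_dominated K' q.
Proof.
move=> KK' [I [w [psi [w0 psi1 wK qle]]]]; exists I, w, psi; split=> //.
exact: le_trans KK'.
Qed.

(** [c |-> \sum_d c d * xi d] is the general operator of norm at most 1 from
    [l_1(D)] to a Hilbert space. *)
Definition hilbert_dominated (K : R) (D : finType) : Prop :=
  forall (J : finType) (xi : D -> J -> R), (forall d, nrm2 predT (xi d) <= 1) ->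
  l1_dominated K (fun c => nrm2 predT (fun j => \sum_d c d * xi d j)).

(** The triangle inequality: the coordinate functionals dominate.  The bound
    depends on [D], but [hilbert_dominated_step] improves it until it does not. *)
Lemma hilbert_dominated_card (D : finType) : hilbert_dominated #|D|%:R D.
Proof.
move=> J xi xi1; exists D, (fun=> 1), (fun i d => (d == i)%:R); split=> //.
- by move=> i d; case: eqP => _; rewrite ?normr1 ?normr0.
- by rewrite sumr_const.
move=> c; apply: le_trans (nrm2_sum _ _ _) _; apply: ler_sum => d _.
rewrite nrm2Z mul1r (bigD1 d)//= eqxx mulr1 big1 ?addr0 => [|i /negPf ->].
  by rewrite -[leRHS]mulr1 ler_wpM2l.
by rewrite mulr0.
Qed.

Definition clamp (u : R) : R := Num.max (-2) (Num.min 2 u).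

Lemma norm_clamp u : `|clamp u| <= 2.
Proof.
by rewrite /clamp; case: (leP 2 u) => h1; [case: (leP (-2) 2)|case: (leP (-2) u)];
  move=> h2; rewrite ler_norml; apply/andP; split; lra.
Qed.

(** The constant comes from [`|u| - 2 <= u ^ 2 / 8], with equality at
    [`|u| = 4]. *)
Lemma clamp_rest u : (u - clamp u) ^+ 2 <= u ^+ 4 / 64.
Proof.
suff : `|u - clamp u| <= u ^+ 2 / 8.
  have u2 : 0 <= u ^+ 2 / 8 by rewrite divr_ge0// sqr_ge0.
  rewrite -(real_normK (num_real (u - clamp u))) => h.
  rewrite [leRHS](_ : _ = (u ^+ 2 / 8) ^+ 2); last by field.
  by rewrite ler_sqr ?nnegrE.
have e1 : 0 <= (u - 4) ^+ 2 by exact: sqr_ge0.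
have e2 : 0 <= (u + 4) ^+ 2 by exact: sqr_ge0.
have e3 : 0 <= u ^+ 2 by exact: sqr_ge0.
move: e1 e2; rewrite sqrrB sqrrD => e1 e2.
by rewrite /clamp; case: (leP 2 u) => h1; [case: (leP (-2) 2)|case: (leP (-2) u)];
  move=> h2; rewrite ler_norml; apply/andP; split; lra.
Qed.

Lemma avg_abs_le (X : finType) (h : X -> R) : (0 < #|X|)%N ->
  avg (fun x => `|h x|) <= Num.sqrt (#|X|%:R^-1) * nrm2 predT h.
Proof.
move=> X0; have := CauchySchwarz predT (fun=> 1) (fun x => `|h x|).
rewrite nrm2_abs {1}/nrm2; under eq_bigr do rewrite mul1r.
under [X in Num.sqrt X]eq_bigr do rewrite expr1n.
rewrite sumr_const => hle.
have c0 : 0 < (#|X|%:R : R) by rewrite ltr0n.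
rewrite /avg; apply: le_trans (ler_wpM2l _ hle) _; first by rewrite invr_ge0 ltW.
rewrite mulrA ler_wpM2r ?nrm2_ge0// sqrtrV ?(ltW c0)//.
have y0 : 0 < Num.sqrt (#|X|%:R : R) by rewrite sqrtr_gt0.
rewrite -[X in X^-1 * _](sqr_sqrtr (ltW c0)) expr2 invfM -mulrA mulVf ?mulr1//.
by rewrite gt_eqF.
Qed.

(** The Rademacher sums [U d] that represent the vectors [xi d] have norm 1 in
    [L_2] but are unbounded.  Their truncations are bounded, and contribute the
    weight 4; what is left has norm at most 1/4 in [L_2], so the bound that is
    to be improved applies to it. *)
Lemma hilbert_dominated_step K (D : finType) : hilbert_dominated K D ->
  hilbert_dominated (4 + K / 2) D.
Proof.
move=> domK J xi xi1.
pose E := {ffun J -> bool}.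
have E0 : (0 < #|E|)%N := card_signs J.
pose U d (e : E) := \sum_j sgn (e j) * xi d j.
pose s : R := Num.sqrt (#|E|%:R^-1).
have s2 : s ^+ 2 = #|E|%:R^-1 by rewrite sqr_sqrtr ?invr_ge0.
have [|I [w [psi [w0 psi1 wK qle]]]] :=
    domK E (fun d e => 4 * (s * (U d e - clamp (U d e)))).
  move=> d; rewrite nrm2_leP// expr1n.
  apply: (@le_trans _ _ (16 / 64 * avg (fun e : E => U d e ^+ 4))).
    rewrite -avgZ /avg mulr_sumr; apply: ler_sum => e _.
    rewrite exprMn exprMn s2 mulrCA ler_wpM2l ?invr_ge0//.
    by have := clamp_rest (U d e); set X := (_ - _) ^+ 2; lra.
  have := rad_4 (xi d); rewrite -/(U d) => h4.
  have x1 : \sum_j xi d j ^+ 2 <= 1 by rewrite -[leRHS](expr1n _ 2) -nrm2_leP.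
  have x0 : 0 <= \sum_j xi d j ^+ 2 by rewrite sumr_ge0// => j _; exact: sqr_ge0.
  have : (\sum_j xi d j ^+ 2) ^+ 2 <= 1 by rewrite expr_le1.
  by move: h4; set X := avg _; set Y := _ ^+ 2; lra.
exists (E + I)%type,
  (fun i => match i with inl _ => 4 / #|E|%:R | inr i => w i / 2 end),
  (fun i d => match i with inl e => clamp (U d e) / 2 | inr i => psi i d end).
split.
- by case=> [e|i]; rewrite divr_ge0.
- case=> [e|i] d //; have := norm_clamp (U d e).
  by rewrite normrM normfV (ger0_norm (_ : 0 <= 2))//; lra.
- rewrite big_sumType/= sumr_const -mulr_suml.
  have -> : (4 / #|E|%:R) *+ #|E| = 4 :> R.
    by rewrite -mulr_natr -mulrA mulVf ?mulr1// pnatr_eq0 -lt0n.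
  by move: wK; set X := \sum_(_ | _) _; lra.
move=> c; apply: le_trans (Khinchine _) _.
have split_U (e : E) : \sum_j sgn (e j) * (\sum_d c d * xi d j) =
    \sum_d c d * clamp (U d e) + \sum_d c d * (U d e - clamp (U d e)).
  rewrite -big_split/=; under eq_bigr do rewrite mulr_sumr.
  rewrite exchange_big/=; apply: eq_bigr => d _.
  by rewrite -mulrDr addrC subrK mulr_sumr; apply: eq_bigr => j _; rewrite mulrCA.
apply: (@le_trans _ _ (2 * (avg (fun e : E => `|\sum_d c d * clamp (U d e)|) +
     avg (fun e : E => `|\sum_d c d * (U d e - clamp (U d e))|)))).
  rewrite ler_wpM2l// -avgD; apply: ler_avg => e.
  by rewrite split_U ler_normD.
rewrite big_sumType/= mulrDr; apply: lerD.
  rewrite -avgZ /avg mulr_sumr; apply: ler_sum => e _.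
  rewrite [X in _ <= _ * `|X|](_ : _ = (\sum_d c d * clamp (U d e)) / 2); last first.
    by rewrite mulr_suml; apply: eq_bigr => d _; rewrite mulrA.
  rewrite normrM normfV (ger0_norm (_ : 0 <= 2))//.
  by set X := `|_|; set y := _^-1; lra.
have := qle c; rewrite (eq_nrm2 (g := fun e => (4 * s) * (\sum_d c d * (U d e - clamp (U d e))))).
  rewrite nrm2Z ger0_norm ?mulr_ge0 ?sqrtr_ge0// => h.
  have := avg_abs_le (fun e => \sum_d c d * (U d e - clamp (U d e))) E0.
  rewrite -/s => h'.
  under [leRHS]eq_bigr do rewrite mulrAC.
  rewrite -mulr_suml; move: h h'; rewrite -mulrA.
  by set X := avg _; set Y := s * _; set Z := \sum_(_ | _) _; lra.
by move=> e _; rewrite mulr_sumr; apply: eq_bigr => d _; ring.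
Qed.

(** Grothendieck's theorem: an operator from [l_1] to a Hilbert space is
    1-summing, in the form of Pietsch's domination theorem.  The map
    [K |-> 4 + K / 2] of [hilbert_dominated_step] contracts to 8. *)
Theorem Grothendieck (D : finType) : hilbert_dominated 9 D.
Proof.
have dom n : hilbert_dominated (8 + #|D|%:R / 2 ^+ n) D.
  elim: n => [|n IH] J xi xi1.
    by apply: l1_dominatedW (hilbert_dominated_card xi1); rewrite expr0 divr1; lra.
  apply: l1_dominatedW (hilbert_dominated_step IH xi1).
  by rewrite exprS invfM mulrCA; set X := _ / _; lra.
move=> J xi xi1; apply: l1_dominatedW (dom #|D| J xi xi1).
suff : (#|D|%:R / 2 ^+ #|D| : R) <= 1 by lra.
by rewrite ler_pdivrMr ?exprn_gt0// mul1r -natrX ler_nat ltnW// ltn_expl.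
Qed.

End Grothendieck.

(** * Multilinear forms *)

Section Insertion.
Context {R : realType}.

Definition ins n (X : Type) (i0 : 'I_n.+1) (x : X) (g : 'I_n -> X) (i : 'I_n.+1) : X :=
  if unlift i0 i is Some j then g j else x.

Lemma ins_eq n (X : Type) (i0 : 'I_n.+1) (x : X) g : ins i0 x g i0 = x.
Proof. by rewrite /ins unlift_none. Qed.

Lemma ins_lift n (X : Type) (i0 : 'I_n.+1) (x : X) g j : ins i0 x g (lift i0 j) = g j.
Proof. by rewrite /ins liftK. Qed.

Definition finins n (X : finType) (i0 : 'I_n.+1) (x : X) (g : {ffun 'I_n -> X}) :
  {ffun 'I_n.+1 -> X} := finfun (ins i0 x g).

Lemma finins_eq n (X : finType) (i0 : 'I_n.+1) (x : X) g : finins i0 x g i0 = x.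
Proof. by rewrite ffunE ins_eq. Qed.

Lemma finins_lift n (X : finType) (i0 : 'I_n.+1) (x : X) g j :
  finins i0 x g (lift i0 j) = g j.
Proof. by rewrite ffunE ins_lift. Qed.

Lemma sum_finins (U : nmodType) n (X : finType) (i0 : 'I_n.+1)
    (F : {ffun 'I_n.+1 -> X} -> U) :
  \sum_f F f = \sum_x \sum_(g : {ffun 'I_n -> X}) F (finins i0 x g).
Proof.
rewrite pair_bigA/= (reindex (fun p : X * {ffun 'I_n -> X} => finins i0 p.1 p.2))//=.
exists (fun f => (f i0, [ffun j => f (lift i0 j)])) => [[x g] _|f _] /=.
  by rewrite finins_eq; congr pair; apply/ffunP => j; rewrite !ffunE ins_lift.
apply/ffunP => i; rewrite ffunE /ins.
by case: unliftP => [j|] ->; rewrite ?ffunE.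
Qed.

Lemma prod_ins n (i0 : 'I_n.+1) (F : 'I_n.+1 -> R) :
  \prod_i F i = F i0 * \prod_j F (lift i0 j).
Proof. exact: bigD1_ord. Qed.

Lemma nrm2_finins n (X : finType) (i0 : 'I_n.+1) (F : {ffun 'I_n.+1 -> X} -> R) :
  nrm2 predT F = nrm2 predT (fun x => nrm2 predT (fun g => F (finins i0 x g))).
Proof.
congr Num.sqrt; rewrite (sum_finins i0).
by apply: eq_bigr => x _; rewrite nrm2_sqr.
Qed.

Lemma nrm2_fix n (X : finType) (i0 : 'I_n.+1) x (F : {ffun 'I_n.+1 -> X} -> R) :
  nrm2 (fun f : {ffun 'I_n.+1 -> X} => f i0 == x) F = nrm2 predT (fun g => F (finins i0 x g)).
Proof.
congr Num.sqrt; rewrite big_mkcond (sum_finins i0) (bigD1 x)//= [X in _ + X]big1.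
  by rewrite addr0; apply: eq_bigr => g _; rewrite finins_eq eqxx.
by move=> z zx; rewrite big1// => g _; rewrite finins_eq (negPf zx).
Qed.

End Insertion.

Section Forms.
Context {R : realType}.

Lemma nrm2_wsum (X I : finType) (w : I -> R) (F : I -> X -> R) :
  (forall i, 0 <= w i) ->
  nrm2 predT (fun x => \sum_i w i * `|F i x|) <= \sum_i w i * nrm2 predT (F i).
Proof.
move=> w0; apply: le_trans (nrm2_sum _ _ _) _; apply: ler_sum => i _.
by rewrite nrm2Z nrm2_abs ger0_norm.
Qed.

(** Grothendieck domination is applied to the factors one by one, each time for
    fixed values of the indices of the other factors; hence the functionals that
    dominate the tensor product are elementary tensors. *)
Lemma Grothendieck_tensor n (D J : finType) (xi : 'I_n -> D -> J -> R) :
  (forall i d, nrm2 predT (xi i d) <= 1) ->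
  exists (I : finType) (w : I -> R) (psi : I -> 'I_n -> D -> R),
    [/\ forall b, 0 <= w b, forall b i d, `|psi b i d| <= 1, \sum_b w b <= 9 ^+ n &
      forall c : {ffun 'I_n -> D} -> R,
        nrm2 predT (fun j : {ffun 'I_n -> J} =>
                      \sum_t c t * \prod_i xi i (t i) (j i)) <=
        \sum_b w b * `|\sum_t c t * \prod_i psi b i (t i)|].
Proof.
elim: n => [|n IH] in xi *.
  move=> _; exists unit, (fun=> 1), (fun _ _ _ => 0); split=> //.
  - by move=> *; rewrite normr0.
  - by rewrite sumr_const card_unit expr0.
  move=> c; rewrite [leRHS](_ : _ = `|\sum_t c t|); last first.
    rewrite (big_pred1 tt) ?mul1r => [|[]//].
    by congr (`|_|); apply: eq_bigr => t _; rewrite big_ord0 mulr1.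
  rewrite nrm2_leP// (big_pred1 [ffun i : 'I_0 => False_rect J (notF (ltn_ord i))]).
  rewrite real_normK ?num_real//; apply/le_of_eq; congr (_ ^+ 2).
    by apply: eq_bigr => t _; rewrite big_ord0 mulr1.
  by move=> f; apply/esym/eqP; apply/ffunP => -[].
move=> xi1.
have [I0 [w0 [psi0 [w00 psi01 w0K dom0]]]] := Grothendieck (xi1 ord0).
have [I [w [psi [wge0 psi1 wK dom]]]] := IH (fun i => xi (lift ord0 i)) (fun i => xi1 _).
exists (I0 * I)%type, (fun b => w0 b.1 * w b.2),
  (fun b => ins ord0 (psi0 b.1) (psi b.2)); split=> //.
- by move=> b; rewrite mulr_ge0.
- by move=> b i d; rewrite /ins; case: unlift.
- rewrite -(pair_bigA _ (fun x y => w0 x * w y))/= exprS.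
  under eq_bigr do rewrite -mulr_sumr.
  by rewrite -mulr_suml ler_pM// sumr_ge0.
move=> c; rewrite (nrm2_finins ord0) nrm2_nrm2.
pose G d (j : {ffun 'I_n -> J}) := \sum_(t : {ffun 'I_n -> D})
  c (finins ord0 d t) * \prod_i xi (lift ord0 i) (t i) (j i).
pose c' b (t : {ffun 'I_n -> D}) := \sum_d c (finins ord0 d t) * psi0 b d.
have GE b j : \sum_d G d j * psi0 b d =
    \sum_t c' b t * \prod_i xi (lift ord0 i) (t i) (j i).
  under eq_bigr do rewrite mulr_suml.
  rewrite exchange_big/=; apply: eq_bigr => t _; rewrite mulr_suml.
  by apply: eq_bigr => d _; rewrite mulrAC.
apply: (@le_trans _ _ (nrm2 predT (fun j => \sum_b w0 b * `|\sum_d G d j * psi0 b d|))).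
  apply: nrm2_le => j _; rewrite ger0_norm ?nrm2_ge0//; apply: le_trans (dom0 _).
  apply/le_of_eq/eq_nrm2 => x _; rewrite (sum_finins ord0); apply: eq_bigr => d _.
  rewrite mulr_suml; apply: eq_bigr => t _.
  rewrite (prod_ins ord0) !finins_eq; under eq_bigr do rewrite !finins_lift.
  by ring.
apply: le_trans (nrm2_wsum _ w00) _.
rewrite -(pair_bigA _ (fun x y => w0 x * w y *
   `|\sum_t c t * \prod_i ins ord0 (psi0 x) (psi y) i (t i)|))/=.
apply: ler_sum => b _; under [leRHS]eq_bigr do rewrite -mulrA.
rewrite -mulr_sumr ler_wpM2l//.
rewrite (eq_nrm2 (g := fun j : {ffun 'I_n -> J} => \sum_t c' b t * \prod_i xi (lift ord0 i) (t i) (j i))).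
  apply: le_trans (dom _) _; apply/le_of_eq/eq_bigr => b' _; congr (_ * `|_|).
  rewrite (sum_finins ord0) exchange_big/=; apply: eq_bigr => t _; rewrite mulr_suml.
  apply: eq_bigr => d _; rewrite (prod_ins ord0) ins_eq finins_eq mulrA; congr (_ * _).
  by apply: eq_bigr => i _; rewrite ins_lift finins_lift.
by move=> j _; rewrite GE.
Qed.

(** [a] is the tensor of an [n]-linear operator of norm at most 1 from
    [l_oo(D)] to [l_1(S)]. *)
Definition unit_form n (D S : finType) (a : {ffun 'I_n -> D} -> S -> R) : Prop :=
  forall psi : 'I_n -> D -> R, (forall i d, `|psi i d| <= 1) ->
  \sum_r `|\sum_t a t r * \prod_i psi i (t i)| <= 1.

(** The coordinate [r] of the value of the operator at the functions
    [x i (j i)]. *)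
Definition form_val n (D S J : finType) (a : {ffun 'I_n -> D} -> S -> R)
    (x : 'I_n -> J -> D -> R) (j : {ffun 'I_n -> J}) (r : S) : R :=
  \sum_t a t r * \prod_i x i (j i) (t i).

Variables (n : nat) (D S J : finType).

(** The domination replaces the functions with values in [l_2(J)] by scalar
    functions bounded by 1, for which the hypothesis on [a] is made. *)
Lemma unit_form_l2 (a : {ffun 'I_n -> D} -> S -> R) (x : 'I_n -> J -> D -> R) :
  unit_form a -> (forall i d, nrm2 predT (fun j => x i j d) <= 1) ->
  nrm2 predT (fun j => \sum_r `|form_val a x j r|) <= 9 ^+ n.
Proof.
move=> a1 x1.
have [I [w [psi [w0 psi1 wK dom]]]] := @Grothendieck_tensor n D J (fun i d j => x i j d) x1.
apply: le_trans (nrm2_sum _ _ _) _.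
apply: (@le_trans _ _ (\sum_r \sum_b w b * `|\sum_t a t r * \prod_i psi b i (t i)|)).
  by apply: ler_sum => r _; rewrite nrm2_abs; exact: dom.
rewrite exchange_big/=; apply: le_trans wK; apply: ler_sum => b _.
by rewrite -mulr_sumr ler_piMr// a1.
Qed.

End Forms.

(** The Hilbert space valued function [g] and the functions of indices other
    than [i0] are replaced by scalar functions bounded by 1, by Grothendieck
    domination.  Those of index [i0] are combined into one such function with
    the signs of the remaining sums over [k], which is possible because they are
    in [l_1(J)]. *)
Lemma unit_form_l1 (R : realType) (n : nat) (D S J H : finType) (i0 : 'I_n.+1)
    (a : {ffun 'I_n.+1 -> D} -> S -> R) (x : 'I_n.+1 -> J -> D -> R) (g : S -> H -> R) :
  unit_form a -> (forall i d, nrm2 predT (fun j => x i j d) <= 1) ->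
  (forall d, \sum_j `|x i0 j d| <= 1) -> (forall r, nrm2 predT (g r) <= 1) ->
  \sum_k nrm2 (fun j : {ffun 'I_n.+1 -> J} => j i0 == k)
     (fun j => nrm2 predT (fun h => \sum_r form_val a x j r * g r h)) <= 9 ^+ n.+1.
Proof.
move=> a1 x1 x01 g1.
have [I0 [v [gam [v0 gam1 vK domg]]]] := Grothendieck g1.
have [I [w [psi [w0 psi1 wK dom]]]] :=
  @Grothendieck_tensor R n D J (fun i d j => x (lift i0 i) j d) (fun i => x1 _).
pose Z b c k := \sum_d x i0 k d * \sum_(t : {ffun 'I_n -> D})
  (\sum_r gam b r * a (finins i0 d t) r) * \prod_i psi c i (t i).
have step k : nrm2 (fun j : {ffun 'I_n.+1 -> J} => j i0 == k)
     (fun j => nrm2 predT (fun h => \sum_r form_val a x j r * g r h)) <=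
     \sum_b v b * \sum_c w c * `|Z b c k|.
  rewrite nrm2_fix.
  apply: le_trans (nrm2_le (g := fun j =>
      \sum_b v b * `|\sum_r form_val a x (finins i0 k j) r * gam b r|) _) _.
    by move=> j _; rewrite ger0_norm ?nrm2_ge0//; exact: domg.
  apply: le_trans (nrm2_wsum _ v0) _.
  apply: ler_sum => b _; rewrite ler_wpM2l//.
  have := dom (fun t => \sum_d x i0 k d * \sum_r gam b r * a (finins i0 d t) r).
  set L := nrm2 _ _; set L' := nrm2 _ _; have -> : L = L'.
    apply: eq_nrm2 => j _; apply/esym; under eq_bigr do rewrite mulr_suml.
    rewrite exchange_big (sum_finins i0) exchange_big/=; apply: eq_bigr => t _.
    rewrite mulr_suml; apply: eq_bigr => d _.
    rewrite -mulrA mulr_suml mulr_sumr; apply: eq_bigr => r _.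
    rewrite (prod_ins i0) !finins_eq.
    under eq_bigr do rewrite !finins_lift.
    by ring.
  move=> /le_trans; apply; apply: ler_sum => c _; rewrite ler_wpM2l//.
  apply/le_of_eq; congr (`|_|); rewrite /Z; under [RHS]eq_bigr do rewrite mulr_sumr.
  rewrite exchange_big/=; apply: eq_bigr => t _; rewrite mulr_suml.
  by apply: eq_bigr => d _; rewrite mulrA.
apply: (@le_trans _ _ (\sum_k \sum_b v b * \sum_c w c * `|Z b c k|)).
  by apply: ler_sum => k _; exact: step.
rewrite exchange_big/= exprS.
apply: (@le_trans _ _ (\sum_b v b * 9 ^+ n)); last first.
  by rewrite -mulr_suml ler_wpM2r// exprn_ge0.
apply: ler_sum => b _; rewrite -mulr_sumr ler_wpM2l// exchange_big/=.
apply: le_trans wK; apply: ler_sum => c _; rewrite -mulr_sumr ler_piMr//.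
(* The signs of the [Z b c k] combine the functions [x i0 k] into one function
   that is bounded by 1. *)
pose f d := \sum_k Num.sg (Z b c k) * x i0 k d.
have f1 d : `|f d| <= 1.
  apply: le_trans (x01 d); apply: le_trans (ler_norm_sum _ _ _) _.
  apply: ler_sum => k _; rewrite normrM normr_sg.
  by case: eqP => _; rewrite ?mul1r// mul0r.
have f01 i d : `|ins i0 f (psi c) i d| <= 1 by rewrite /ins; case: unlift.
apply: le_trans (a1 _ f01).
rewrite [leLHS](_ : _ = \sum_r gam b r *
    \sum_t a t r * \prod_i ins i0 f (psi c) i (t i)); last first.
  under eq_bigr do rewrite normrEsg.
  transitivity (\sum_d f d * \sum_(t : {ffun 'I_n -> D})
      (\sum_r gam b r * a (finins i0 d t) r) * \prod_i psi c i (t i)).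
    under [in LHS]eq_bigr do rewrite mulr_sumr; rewrite exchange_big/=.
    by apply: eq_bigr => d _; rewrite mulr_suml; apply: eq_bigr => k _; rewrite mulrA.
  under [RHS]eq_bigr do rewrite mulr_sumr.
  rewrite [RHS]exchange_big (sum_finins i0)/=; apply: eq_bigr => d _.
  rewrite mulr_sumr; apply: eq_bigr => t _.
  rewrite [X in f d * X]mulr_suml mulr_sumr; apply: eq_bigr => r _.
  rewrite (prod_ins i0) ins_eq finins_eq.
  under [in RHS]eq_bigr do rewrite ins_lift finins_lift.
  by ring.
apply: ler_sum => r _; apply: le_trans (ler_norm _) _.
by rewrite normrM ler_piMl.
Qed.

(** * Pietsch's domination theorem *)

Section Pietsch.
Context {R : realType} (S : finType).

(** The Hahn-Banach theorem on [R ^ S] for the sublinear functional whose value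
    at [F] is the infimum of the [y] such that [U F y]. *)
Lemma HahnBanach (U : (S -> R) -> R -> Prop) :
  (forall F G y z, U F y -> U G z -> U (fun r => F r + G r) (y + z)) ->
  (forall F y c, 0 < c -> U F y -> U (fun r => c * F r) (c * y)) ->
  (forall F, exists y, U F y) ->
  (forall y, U (fun=> 0) y -> 0 <= y) ->
  exists l : S -> R, forall F y, U F y -> \sum_r l r * F r <= y.
Proof.
move=> UD UZ Uex U0.
have UE F G y : (forall r, F r = G r) -> U F y -> U G y by move=> /funext ->.
suff /(_ (enum S))[l lP] : forall s : seq S, exists l : S -> R, forall F y,
    (forall r, r \notin s -> F r = 0) -> U F y -> \sum_r l r * F r <= y.
  by exists l => F y; apply: lP => r; rewrite mem_enum.
elim=> [|v s [l lP]].
  exists (fun=> 0) => F y F0; rewrite big1 => [|r _]; last by rewrite mul0r.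
  by have -> : F = (fun=> 0) by [apply/funext => r; exact: F0]; exact: U0.
have [vs|vs] := boolP (v \in s).
  exists l => F y F0; apply: lP => r rs; apply: F0.
  by rewrite inE negb_or rs andbT; apply: contraNneq rs => ->.
pose e r : R := (r == v)%:R.
pose supp (F : S -> R) := forall r, r \notin s -> F r = 0.
have sep F G y z : supp F -> supp G -> U (fun r => F r - e r) y ->
    U (fun r => G r + e r) z -> \sum_r l r * F r - y <= z - \sum_r l r * G r.
  move=> F0 G0 Uy Uz.
  have : \sum_r l r * (F r + G r) <= y + z.
    apply: lP => [r rs|]; first by rewrite F0// G0// addr0.
    by apply: UE (UD _ _ _ _ Uy Uz) => r; ring.
  under eq_bigr do rewrite mulrDr.
  by rewrite big_split/=; lra.
pose A := [set x | exists F y, [/\ supp F, U (fun r => F r - e r) y &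
                                  x = \sum_r l r * F r - y]].
have [y0 Uy0] := Uex (fun r => 0 - e r).
have [z0 Uz0] := Uex (fun r => 0 + e r).
have supA : has_sup A.
  split; first by exists (\sum_r l r * 0 - y0), (fun=> 0), y0.
  exists (z0 - \sum_r l r * 0) => _ [F [y [F0 Uy ->]]].
  by apply: sep F0 _ Uy Uz0.
pose al := sup A.
have al_lo F y : supp F -> U (fun r => F r - e r) y -> \sum_r l r * F r - y <= al.
  by move=> F0 Uy; apply: ub_le_sup; [case: supA|exists F, y].
have al_hi G z : supp G -> U (fun r => G r + e r) z -> al <= z - \sum_r l r * G r.
  move=> G0 Uz; apply: ge_sup; first by case: supA.
  by move=> _ [F [y [F0 Uy ->]]]; exact: sep Uz.
exists (fun r => if r == v then al else l r) => F y F0 Uy.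
pose G r := if r == v then 0 else F r.
have G0 : supp G.
  by move=> r rs; rewrite /G; case: eqP => // /eqP rv; rewrite F0// inE negb_or rv.
have FE r : F r = G r + F v * e r.
  by rewrite /G /e; case: eqP => [->|_];
    rewrite ?mulr1 ?add0r// mulr0 addr0.
have -> : \sum_r (if r == v then al else l r) * F r = \sum_r l r * G r + al * F v.
  rewrite (bigD1 v)//= eqxx [in RHS](bigD1 v)//= /G eqxx mulr0 add0r addrC.
  by congr (_ + _); apply: eq_bigr => r /negPf ->.
have [Fv|Fv|Fv] := ltgtP (F v) 0.
- have c0 : 0 < (- F v)^-1 by rewrite invr_gt0 oppr_gt0.
  have U' : U (fun r => (- F v)^-1 * G r - e r) ((- F v)^-1 * y).
    by apply: UE (UZ _ _ _ c0 Uy) => r; rewrite (FE r) mulrDr mulrA invrN !mulNr mulVf ?lt_eqF// mul1r.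
  have h1 : (- F v)^-1 * (\sum_r l r * G r) - (- F v)^-1 * y <= al.
    have := al_lo (fun r => (- F v)^-1 * G r) _ _ U'.
    under eq_bigr do rewrite mulrCA.
    by rewrite -mulr_sumr; apply => r rs; rewrite G0// mulr0.
  have : (- F v) * ((- F v)^-1 * (\sum_r l r * G r) - (- F v)^-1 * y) <= (- F v) * al.
    by rewrite ler_pM2l// oppr_gt0.
  rewrite mulrBr !mulrA divff ?mul1r ?oppr_eq0 ?lt_eqF//.
  by lra.
- have c0 : 0 < (F v)^-1 by rewrite invr_gt0.
  have U' : U (fun r => (F v)^-1 * G r + e r) ((F v)^-1 * y).
    by apply: UE (UZ _ _ _ c0 Uy) => r; rewrite (FE r) mulrDr mulrA mulVf ?mul1r// gt_eqF.
  have h1 : al <= (F v)^-1 * y - (F v)^-1 * \sum_r l r * G r.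
    have := al_hi (fun r => (F v)^-1 * G r) _ _ U'.
    under eq_bigr do rewrite mulrCA.
    by rewrite -mulr_sumr; apply => r rs; rewrite G0// mulr0.
  have : F v * al <= F v * ((F v)^-1 * y - (F v)^-1 * \sum_r l r * G r).
    by rewrite ler_pM2l.
  rewrite mulrBr !mulrA divff ?mul1r ?gt_eqF//.
  by lra.
- rewrite Fv mulr0 addr0; apply: lP => //.
  by apply: UE Uy => r; rewrite (FE r) Fv mul0r addr0.
Qed.

(** The functional
    [F |-> inf (C ^ 2 * sup (F + \sum_g g ^ 2) - \sum_g N g ^ 2)], where the
    infimum is over the finite families of functions [g] (and [m] in the proof
    stands for an upper bound of the supremum), is sublinear, and the hypothesis
    says that it is nonnegative at 0.  A linear functional below it is the
    measure [nu]: this is seen at the functions [- e_r], 1 and [- g ^ 2]. *)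
Lemma Pietsch (N : (S -> R) -> R) (C : R) : 0 <= C ->
  (forall c g, N (fun r => c * g r) = `|c| * N g) ->
  (forall (H : finType) (g : S -> H -> R), (forall r, nrm2 predT (g r) <= 1) ->
     nrm2 predT (fun h => N (g^~ h)) <= C) ->
  exists nu : S -> R, [/\ forall r, 0 <= nu r, \sum_r nu r <= C ^+ 2 &
    forall g, N g ^+ 2 <= \sum_r nu r * g r ^+ 2].
Proof.
move=> C0 NZ Nsum.
pose U (F : S -> R) y := exists (l : seq (S -> R)) (m : R),
  [/\ 0 <= m, forall r, F r + \sum_(g <- l) g r ^+ 2 <= m &
      y = C ^+ 2 * m - \sum_(g <- l) N g ^+ 2].
have [] := @HahnBanach U.
- move=> F G y z [l1 [m1 [m10 h1 ->]]] [l2 [m2 [m20 h2 ->]]].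
  exists (l1 ++ l2), (m1 + m2); split; first exact: addr_ge0.
    by move=> r; rewrite big_cat/= addrACA lerD.
  by rewrite big_cat/=; ring.
- move=> F y c c0 [l [m [m0 h ->]]].
  have sc : Num.sqrt c ^+ 2 = c by rewrite sqr_sqrtr// ltW.
  exists [seq (fun r => Num.sqrt c * g r) | g <- l], (c * m); split.
  + by rewrite mulr_ge0// ltW.
  + move=> r; rewrite big_map; under eq_bigr do rewrite exprMn sc.
    by rewrite -mulr_sumr -mulrDr ler_pM2l.
  + rewrite big_map; under eq_bigr do rewrite NZ exprMn real_normK ?num_real// sc.
    by rewrite -mulr_sumr; ring.
- move=> F; exists (C ^+ 2 * (\sum_r `|F r|) - \sum_(g <- [::]) N g ^+ 2), [::], (\sum_r `|F r|).
  split=> //; first exact: sumr_ge0.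
  move=> r; rewrite big_nil addr0 (bigD1 r)//=.
  by rewrite (le_trans (ler_norm _))// lerDl sumr_ge0.
- move=> _ [l [m [m0 h ->]]]; rewrite subr_ge0.
  suff N_le m' : m <= m' -> 0 < m' -> \sum_(g <- l) N g ^+ 2 <= C ^+ 2 * m'.
    have [mp|mn] := ltP 0 m; first exact: N_le.
    have -> : m = 0 by apply/eqP; rewrite eq_le mn.
    rewrite mulr0; apply/ler_addgt0Pr => e e0; rewrite add0r.
    have C1 : 0 < C ^+ 2 + 1 by rewrite ltr_wpDl// sqr_ge0.
    apply: (le_trans (N_le (e / (C ^+ 2 + 1)) _ _)); rewrite ?divr_gt0//.
      by rewrite (le_trans mn)// ltW// divr_gt0.
    by rewrite mulrCA ger_pMr// ler_pdivrMr// mul1r lerDl.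
  move=> mm' m'0.
  pose s := Num.sqrt m'; have s0 : 0 < s by rewrite sqrtr_gt0.
  have s2 : s ^+ 2 = m' by rewrite sqr_sqrtr// ltW.
  have := Nsum 'I_(size l) (fun r i => s^-1 * tnth (in_tuple l) i r).
  rewrite nrm2_leP// => Nsum'.
  have {}Nsum' : \sum_(g <- l) (s^-1 * N g) ^+ 2 <= C ^+ 2.
    rewrite big_tnth; apply: le_trans (Nsum' _); last first.
      move=> r; rewrite nrm2_leP// expr1n.
      under eq_bigr do rewrite exprMn; rewrite -mulr_sumr.
      rewrite -(big_tnth _ _ l xpredT (fun g => g r ^+ 2)) exprVn s2.
      rewrite ler_pdivrMl// mulr1; apply: le_trans mm'.
      by have := h r; rewrite add0r.
    apply: ler_sum => i _; rewrite NZ.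
    by rewrite ger0_norm// invr_ge0 ltW.
  move: Nsum'; under eq_bigr do rewrite exprMn.
  by rewrite -mulr_sumr exprVn s2 ler_pdivrMl// mulrC.
move=> nu nuP; exists nu; split.
- move=> r; have := nuP (fun r' => - (r' == r)%:R) 0.
  rewrite (bigD1 r)//= eqxx big1 => [|r' /negPf ->]; last by rewrite oppr0 mulr0.
  rewrite mulrN1 addr0 oppr_le0; apply; exists [::], 0; split=> //.
    by move=> r'; rewrite big_nil addr0 oppr_le0.
  by rewrite big_nil mulr0 subr0.
- have := nuP (fun=> 1) (C ^+ 2); under eq_bigr do rewrite mulr1.
  apply; exists [::], 1; split=> //; first by move=> r; rewrite big_nil addr0.
  by rewrite big_nil mulr1 subr0.
- move=> g; rewrite -lerN2 -sumrN; under [leLHS]eq_bigr do rewrite -mulrN.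
  apply: nuP; exists [:: g], 0; split=> //.
    by move=> r; rewrite big_seq1 addNr.
  by rewrite big_seq1 mulr0 sub0r.
Qed.

End Pietsch.

(** * Tensor products of operators into [l_1(l_2)] *)

Section TensorProduct.
Context {R : realType}.

Lemma nrm2_pair (I K : finType) (P : pred I) (Q : pred K) (F : I -> K -> R) :
  nrm2 P (fun i => nrm2 Q (F i)) =
  nrm2 (fun p => P p.1 && Q p.2) (fun p => F p.1 p.2).
Proof.
congr Num.sqrt; under eq_bigr do rewrite nrm2_sqr.
by rewrite pair_big.
Qed.

Lemma avg_sqrt_le (X : finType) (h : X -> R) : (0 < #|X|)%N ->
  (forall x, 0 <= h x) -> avg (fun x => Num.sqrt (h x)) <= Num.sqrt (avg h).
Proof.
move=> X0 h0; have := avg_abs_le (fun x => Num.sqrt (h x)) X0.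
under [X in avg X]eq_fun do rewrite ger0_norm ?sqrtr_ge0//.
move=> /le_trans; apply; rewrite /nrm2 -sqrtrM ?invr_ge0//.
by apply/le_of_eq; congr Num.sqrt; congr (_ * _); apply: eq_bigr => x _; rewrite sqr_sqrtr.
Qed.

(** By Khinchine's inequality, the norm of a vector in the range is comparable
    to the mean of the absolute values of its random scalar combinations, to
    which the scalar inequality applies; the mean of the right-hand sides is
    bounded by Jensen's inequality and the orthogonality of the signs. *)
Lemma hilbert_valued (A B S H : finType) (pi : B -> A) (y : B -> S -> R) (nu : S -> R) (Q : pred H) :
  (forall r, 0 <= nu r) ->
  (forall g : S -> R, \sum_a nrm2 (fun b => pi b == a) (fun b => \sum_r y b r * g r) <=
     Num.sqrt (\sum_r nu r * g r ^+ 2)) ->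
  forall G : S -> H -> R,
  \sum_a nrm2 (fun b => pi b == a) (fun b => nrm2 Q (fun h => \sum_r y b r * G r h)) <=
  2 * Num.sqrt (\sum_r nu r * \sum_(h | Q h) G r h ^+ 2).
Proof.
move=> nu0 yN G.
pose G' r h := if Q h then G r h else 0.
pose E := {ffun H -> bool}.
pose g (e : E) r := \sum_h sgn (e h) * G' r h.
apply: (@le_trans _ _ (\sum_a (2 * avg (fun e : E =>
    nrm2 (fun b => pi b == a) (fun b => \sum_r y b r * g e r))))).
  apply: ler_sum => a _.
  apply: (@le_trans _ _ (nrm2 (fun b => pi b == a) (fun b =>
      2 * (#|E|%:R^-1 * \sum_e `|\sum_r y b r * g e r|)))).
    apply: nrm2_le => b _; rewrite ger0_norm ?nrm2_ge0//.
    apply: (@le_trans _ _ (nrm2 predT (fun h => \sum_r y b r * G' r h))).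
      rewrite /nrm2 big_mkcond; apply/le_of_eq; congr Num.sqrt; apply: eq_bigr => h _.
      rewrite /G'; case: ifP => // _.
      by rewrite big1 ?expr0n// => r _; rewrite mulr0.
    apply: le_trans (Khinchine _) _; rewrite ler_wpM2l//.
    rewrite /avg ler_wpM2l ?invr_ge0//; apply: ler_sum => e _.
    apply/le_of_eq; congr (`|_|); under eq_bigr do rewrite mulr_sumr.
    rewrite exchange_big/=; apply: eq_bigr => r _; rewrite mulr_sumr.
    by apply: eq_bigr => h _; rewrite mulrCA.
  rewrite 2!nrm2Z !ger0_norm ?invr_ge0// ler_wpM2l// ler_wpM2l ?invr_ge0//.
  apply: le_trans (nrm2_sum _ _ _) _; apply: ler_sum => e _.
  by rewrite nrm2_abs.
rewrite -mulr_sumr ler_wpM2l// /avg -mulr_sumr exchange_big/=.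
apply: (@le_trans _ _ (avg (fun e : E => Num.sqrt (\sum_r nu r * g e r ^+ 2)))).
  by rewrite ler_wpM2l ?invr_ge0//; apply: ler_sum => e _; exact: yN.
apply: le_trans (avg_sqrt_le _ _) _; first exact: card_signs.
  by move=> e; apply: sumr_ge0 => r _; rewrite mulr_ge0// sqr_ge0.
apply/le_of_eq; congr Num.sqrt; rewrite /avg exchange_big/= mulr_sumr.
apply: eq_bigr => r _; rewrite -mulr_sumr mulrCA; congr (_ * _).
have := rad_sqr (G' r); rewrite /avg => ->.
by rewrite [RHS]big_mkcond; apply: eq_bigr => h _; rewrite /G'; case: ifP; rewrite ?expr0n.
Qed.

Lemma nrm2_finins_map m (A B : finType) (pi : B -> A) (a : A) (al : {ffun 'I_m -> A})
    (F : {ffun 'I_m.+1 -> B} -> R) :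
  nrm2 (fun be : {ffun 'I_m.+1 -> B} => [ffun k => pi (be k)] == finins ord0 a al) F =
  nrm2 (fun b => pi b == a) (fun b => nrm2 (fun be : {ffun 'I_m -> B} => [ffun k => pi (be k)] == al)
     (fun be => F (finins ord0 b be))).
Proof.
congr Num.sqrt; rewrite big_mkcond (sum_finins ord0) [RHS]big_mkcond/=.
apply: eq_bigr => b _.
have E (be : {ffun 'I_m -> B}) :
    ([ffun k => pi (finins ord0 b be k)] == finins ord0 a al) =
    (pi b == a) && ([ffun k => pi (be k)] == al).
  apply/eqP/andP => [/ffunP e|[/eqP <- /eqP <-]].
    split; first by have := e ord0; rewrite ffunE !finins_eq => ->.
    apply/eqP/ffunP => k; have := e (lift ord0 k).
    by rewrite !ffunE !ins_lift.
  by apply/ffunP => k; rewrite !ffunE /ins; case: unlift => [j|]//; rewrite ffunE.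
under eq_bigr do rewrite E.
case: eqP => _ /=; last by rewrite big1.
by rewrite nrm2_sqr [RHS]big_mkcond.
Qed.

(** Induction on [m].  For fixed values [al] of the other indices, the operator
    of index 0 is applied to a function with values in the Hilbert space of the
    families indexed by [be] and [h], by [hilbert_valued].  The weight [nu] of
    this index is then absorbed into the vector valued function to which the
    other operators are applied. *)
Lemma tensor_l1l2 m (A B S H : finType) (pi : B -> A) (y : 'I_m -> B -> S -> R)
    (nu : 'I_m -> S -> R) :
  (forall k r, 0 <= nu k r) ->
  (forall k (g : S -> R),
     \sum_a nrm2 (fun b => pi b == a) (fun b => \sum_r y k b r * g r) <=
     Num.sqrt (\sum_r nu k r * g r ^+ 2)) ->
  forall G : {ffun 'I_m -> S} -> H -> R,
  \sum_(al : {ffun 'I_m -> A}) nrm2 (fun be : {ffun 'I_m -> B} => [ffun k => pi (be k)] == al)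
    (fun be => nrm2 predT (fun h => \sum_(rho : {ffun 'I_m -> S})
      (\prod_k y k (be k) (rho k)) * G rho h)) <=
  2 ^+ m * Num.sqrt (\sum_(rho : {ffun 'I_m -> S}) (\prod_k nu k (rho k)) * \sum_h G rho h ^+ 2).
Proof.
move=> nu0 yN; elim: m => [|m IH] in y nu nu0 yN H * => G.
  pose f0 X := [ffun i : 'I_0 => False_rect X (notF (ltn_ord i))].
  have f0E X (f : {ffun 'I_0 -> X}) : f = f0 X by apply/ffunP => -[].
  have eqT (X : finType) (f g : {ffun 'I_0 -> X}) : (f == g) = true.
    by apply/eqP; rewrite (f0E _ f) (f0E _ g).
  rewrite (big_pred1 (f0 A)) => [|f]; last by rewrite /= eqT.
  rewrite expr0 mul1r (big_pred1 (f0 S)) => [|f]; last by rewrite /= eqT.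
  rewrite big_ord0 mul1r {1}/nrm2 ler_sqrt ?sumr_ge0// => [|h _]; last exact: sqr_ge0.
  rewrite (big_pred1 (f0 B)) => [|f]; last by rewrite /= !eqT.
  rewrite nrm2_sqr; apply: ler_sum => h _.
  by rewrite (big_pred1 (f0 S)) ?big_ord0 ?mul1r// => f; rewrite /= eqT.
rewrite (sum_finins ord0) exchange_big/=.
pose Z (al : {ffun 'I_m -> A}) := nrm2 (fun be : {ffun 'I_m -> B} => [ffun k => pi (be k)] == al)
  (fun be : {ffun 'I_m -> B} => nrm2 predT (fun p : S * H =>
     \sum_(rho : {ffun 'I_m -> S}) (\prod_k y (lift ord0 k) (be k) (rho k)) *
       (Num.sqrt (nu ord0 p.1) * G (finins ord0 p.1 rho) p.2))).
apply: (@le_trans _ _ (\sum_al 2 * Z al)).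
  apply: ler_sum => al _; under eq_bigr do rewrite nrm2_finins_map.
  pose G' r (p : {ffun 'I_m -> B} * H) := \sum_(rho : {ffun 'I_m -> S})
    (\prod_k y (lift ord0 k) (p.1 k) (rho k)) * G (finins ord0 r rho) p.2.
  pose Q (p : {ffun 'I_m -> B} * H) := ([ffun k => pi (p.1 k)] == al) && true.
  apply: (@le_trans _ _ (\sum_a nrm2 (fun b => pi b == a) (fun b =>
      nrm2 Q (fun p => \sum_r y ord0 b r * G' r p)))).
    apply: ler_sum => a _; apply/le_of_eq/eq_nrm2 => b _.
    rewrite nrm2_pair; apply: eq_nrm2 => -[be h] _ /=.
    rewrite (sum_finins ord0); apply: eq_bigr => r _; rewrite mulr_sumr.
    apply: eq_bigr => rho _; rewrite (prod_ins ord0) !finins_eq mulrA; congr (_ * _ * _).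
    by apply: eq_bigr => k _; rewrite !finins_lift.
  apply: le_trans (hilbert_valued _ (nu0 ord0) (yN ord0) _) _; rewrite ler_wpM2l// /Z.
  apply/le_of_eq; congr Num.sqrt; under eq_bigr do rewrite mulr_sumr.
  rewrite exchange_big/= -(pair_big (fun be : {ffun 'I_m -> B} => [ffun k => pi (be k)] == al) xpredT
    (fun be h => \sum_r nu ord0 r * G' r (be, h) ^+ 2))/=.
  apply: eq_bigr => be _; rewrite nrm2_sqr.
  rewrite -(pair_big xpredT xpredT (fun r h => (\sum_(rho : {ffun 'I_m -> S})
    (\prod_k y (lift ord0 k) (be k) (rho k)) *
       (Num.sqrt (nu ord0 r) * G (finins ord0 r rho) h)) ^+ 2))/= exchange_big/=.
  apply: eq_bigr => h _; apply: eq_bigr => r _.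
  under [in RHS]eq_bigr do rewrite mulrCA.
  by rewrite -mulr_sumr exprMn sqr_sqrtr.
rewrite -mulr_sumr exprS -mulrA ler_wpM2l//.
apply: le_trans (IH (fun k => y (lift ord0 k)) (fun k => nu (lift ord0 k)) _ _ _ _) _.
- by move=> k r; exact: nu0.
- by move=> k g; exact: yN.
rewrite ler_wpM2l ?exprn_ge0//; apply/le_of_eq; congr Num.sqrt.
rewrite [RHS](sum_finins ord0) exchange_big/=; apply: eq_bigr => rho _.
rewrite -(pair_big xpredT xpredT (fun r h =>
  (Num.sqrt (nu ord0 r) * G (finins ord0 r rho) h) ^+ 2))/= mulr_sumr.
apply: eq_bigr => r _; rewrite (prod_ins ord0) finins_eq.
under [in RHS]eq_bigr do rewrite finins_lift.
under [X in _ * X]eq_bigr do rewrite exprMn sqr_sqrtr//.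
by rewrite -mulr_sumr mulrCA mulrA.
Qed.

End TensorProduct.

(** * The composition at the endpoints *)

Section Endpoints.
Context {R : realType}.

(** The coordinate [c] of the value of the composition; [tau rho] is the value
    of the outer operator at the basis vectors of indices [rho]. *)
Definition comp_val m n (D S J C : finType) (a : 'I_m -> {ffun 'I_n -> D} -> S -> R)
    (x : 'I_m -> 'I_n -> J -> D -> R) (tau : {ffun 'I_m -> S} -> C -> R)
    (j : {ffun 'I_m -> {ffun 'I_n -> J}}) (c : C) : R :=
  \sum_(rho : {ffun 'I_m -> S}) (\prod_k form_val (a k) (x k) (j k) (rho k)) * tau rho c.

Lemma nrm2_prod m (X : finType) (F : 'I_m -> X -> R) :
  nrm2 predT (fun f : {ffun 'I_m -> X} => \prod_k F k (f k)) =
  \prod_k nrm2 predT (F k).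
Proof.
rewrite /nrm2/=; under eq_bigr do rewrite -prodrXl.
rewrite -(bigA_distr_bigA (fun k x => F k x ^+ 2)).
elim/big_rec2: _ => [|k y z _ <-]; first by rewrite sqrtr1.
by rewrite sqrtrM// sumr_ge0// => i _; exact: sqr_ge0.
Qed.

(** The outer operator enters only through a bound [B] of a functional on its
    values that is uniform in [rho]; the rest is the product of the [l_1] norms
    of the values of the inner operators, to which [unit_form_l2] applies. *)
Lemma endpoint_l2 m n (D S J C : finType) (a : 'I_m -> {ffun 'I_n -> D} -> S -> R)
    (x : 'I_m -> 'I_n -> J -> D -> R) (tau : {ffun 'I_m -> S} -> C -> R)
    (b : {ffun 'I_m -> {ffun 'I_n -> J}} -> C -> R) B :
  (forall k, unit_form (a k)) ->
  (forall k i d, nrm2 predT (fun j => x k i j d) <= 1) ->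
  (forall rho j, `|\sum_c b j c * tau rho c| <= B j) -> nrm2 predT B <= 1 ->
  `|\sum_j \sum_c b j c * comp_val a x tau j c| <= (9 ^+ n) ^+ m.
Proof.
move=> a1 x1 bB B1.
pose Y k (j : {ffun 'I_n -> J}) := \sum_r `|form_val (a k) (x k) j r|.
have Yn k : nrm2 predT (Y k) <= 9 ^+ n by exact: unit_form_l2.
apply: (@le_trans _ _ (\sum_j B j * \prod_k Y k (j k))).
  apply: le_trans (ler_norm_sum _ _ _) _; apply: ler_sum => j _.
  rewrite [X in `|X|](_ : _ = \sum_(rho : {ffun 'I_m -> S}) (\prod_k form_val (a k) (x k) (j k) (rho k)) *
      \sum_c b j c * tau rho c); last first.
    under eq_bigr do rewrite mulr_sumr.
    rewrite exchange_big/=; apply: eq_bigr => rho _.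
    by rewrite mulr_sumr; apply: eq_bigr => c _; rewrite mulrCA.
  rewrite /Y (bigA_distr_bigA (fun k r => `|form_val (a k) (x k) (j k) r|))/= mulr_sumr.
  apply: le_trans (ler_norm_sum _ _ _) _; apply: ler_sum => rho _.
  by rewrite normrM normr_prod mulrC ler_wpM2r// prodr_ge0.
apply: le_trans (CauchySchwarz _ _ _) _; rewrite nrm2_prod.
rewrite -[leRHS]mul1r ler_pM ?nrm2_ge0 ?prodr_ge0// => [k _|]; first exact: nrm2_ge0.
rewrite -[in leRHS](card_ord m) -prodr_const; apply: ler_prod => k _.
by rewrite nrm2_ge0 Yn.
Qed.

(** By [unit_form_l1], each operator
    [g |-> \sum_r form_val (a k) (x k) j r * g r] satisfies the hypothesis of
    [Pietsch], and hence that of [tensor_l1l2]; the function to which their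
    tensor product is applied is [tau].  The condition on [b] is the bound of
    its norm in the dual [l_oo(l_2)] of [l_1(l_2)]. *)
Lemma endpoint_l1 m n (D S J C : finType) (i0 : 'I_n)
    (a : 'I_m -> {ffun 'I_n -> D} -> S -> R)
    (x : 'I_m -> 'I_n -> J -> D -> R) (tau : {ffun 'I_m -> S} -> C -> R)
    (b : {ffun 'I_m -> {ffun 'I_n -> J}} -> C -> R) :
  (forall k, unit_form (a k)) ->
  (forall k i d, nrm2 predT (fun j => x k i j d) <= 1) ->
  (forall k d, \sum_j `|x k i0 j d| <= 1) ->
  (forall rho, nrm2 predT (tau rho) <= 1) ->
  (forall al : {ffun 'I_m -> J},
     nrm2 (fun j : {ffun 'I_m -> {ffun 'I_n -> J}} => [ffun k => j k i0] == al) (fun j => nrm2 predT (b j)) <= 1) ->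
  `|\sum_j \sum_c b j c * comp_val a x tau j c| <= (2 * 9 ^+ n) ^+ m.
Proof.
case: n i0 a x b => [[]//|n] i0 a x b a1 x1 x01 tau1 b1.
pose N k (g : S -> R) := \sum_kk nrm2 (fun j : {ffun 'I_n.+1 -> J} => j i0 == kk)
  (fun j => \sum_r form_val (a k) (x k) j r * g r).
have N0 k g : 0 <= N k g by apply: sumr_ge0 => kk _; exact: nrm2_ge0.
have /choice[nu nuP] : forall k, exists nu : S -> R,
    [/\ forall r, 0 <= nu r, \sum_r nu r <= (9 ^+ n.+1) ^+ 2 &
        forall g, N k g ^+ 2 <= \sum_r nu r * g r ^+ 2].
  move=> k; apply: Pietsch => [|c g|H g g1]; first exact: exprn_ge0.
    rewrite /N mulr_sumr; apply: eq_bigr => kk _.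
    rewrite -nrm2Z; apply: eq_nrm2 => j _; rewrite mulr_sumr.
    by apply: eq_bigr => r _; rewrite mulrCA.
  apply: le_trans (nrm2_sum _ _ _) _.
  by under eq_bigr do rewrite nrm2_nrm2; exact: unit_form_l1.
have nu0 k r : 0 <= nu k r by have [] := nuP k.
have NS k g : N k g <= Num.sqrt (\sum_r nu k r * g r ^+ 2).
  have [_ _ h] := nuP k.
  by rewrite -[leLHS](ger0_norm (N0 k g)) -sqrtr_sqr ler_wsqrtr.
have key := @tensor_l1l2 R m J _ S C (fun j : {ffun 'I_n.+1 -> J} => j i0)
  (fun k => form_val (a k) (x k)) nu nu0 NS tau.
have {}key : \sum_(al : {ffun 'I_m -> J}) nrm2 (fun j : {ffun 'I_m -> {ffun 'I_n.+1 -> J}} => [ffun k => j k i0] == al)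
    (fun j => nrm2 predT (comp_val a x tau j)) <= (2 * 9 ^+ n.+1) ^+ m.
  apply: le_trans key _; rewrite exprMn ler_wpM2l ?exprn_ge0//.
  rewrite -[leRHS]ger0_norm ?exprn_ge0// -sqrtr_sqr ler_wsqrtr//.
  apply: (@le_trans _ _ (\sum_(rho : {ffun 'I_m -> S}) \prod_k nu k (rho k))).
    apply: ler_sum => rho _; rewrite ler_piMr ?prodr_ge0//.
    by rewrite -[leRHS](expr1n _ 2) -nrm2_leP.
  rewrite -bigA_distr_bigA/= -exprM mulnC exprM -[X in _ ^+ X](card_ord m) -prodr_const.
  apply: ler_prod => k _; rewrite sumr_ge0//=.
  by have [] := nuP k.
apply: (@le_trans _ _ (\sum_(al : {ffun 'I_m -> J})
   \sum_(j : {ffun 'I_m -> {ffun 'I_n.+1 -> J}} | [ffun k => j k i0] == al)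
     nrm2 predT (b j) * nrm2 predT (comp_val a x tau j))).
  apply: le_trans (ler_norm_sum _ _ _) _.
  rewrite (partition_big (fun j : {ffun 'I_m -> {ffun 'I_n.+1 -> J}} => [ffun k => j k i0] : {ffun 'I_m -> J}) xpredT)//=.
  apply: ler_sum => al _; apply: ler_sum => j _.
  apply: le_trans (ler_norm_sum _ _ _) _; under eq_bigr do rewrite normrM.
  by apply: le_trans (CauchySchwarz _ _ _) _; rewrite !nrm2_abs.
apply: le_trans key; apply: ler_sum => al _.
apply: le_trans (CauchySchwarz _ _ _) _.
by rewrite ler_piMl ?nrm2_ge0.
Qed.

End Endpoints.

(** * Factorization of a probability *)

(** The [Q i] are the conditional probabilities of the chain rule: [Q i f] is
    the probability of [f i] given the values of [f] before [i].  For the last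
    inequality, the sums over the values of [f] are done from the last one to
    the first, each of them being at most 1, and the value at [i] is skipped. *)
Lemma chain_rule (R : realType) n (X : finType) (P : {ffun 'I_n -> X} -> R) :
  (forall f, 0 <= P f) -> \sum_f P f <= 1 ->
  exists Q : 'I_n -> {ffun 'I_n -> X} -> R,
    [/\ forall i f, 0 <= Q i f, forall f, (0 < n)%N -> \prod_i Q i f = P f &
        forall i x, \sum_(f : {ffun 'I_n -> X} | f i == x) \prod_(i' | i' != i) Q i' f <= 1].
Proof.
elim: n => [|n IH] in P *; first by move=> *; exists (fun _ _ => 0); split=> // -[].
move=> P0 P1.
pose M x := \sum_(g : {ffun 'I_n -> X}) P (finins ord0 x g).
have M0 x : 0 <= M x by exact: sumr_ge0.
have /choice[Q QP] : forall x, exists Q : 'I_n -> {ffun 'I_n -> X} -> R,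
    [/\ forall i f, 0 <= Q i f,
        forall f, (0 < n)%N -> \prod_i Q i f = P (finins ord0 x f) / M x &
        forall i y, \sum_(f : {ffun 'I_n -> X} | f i == y) \prod_(i' | i' != i) Q i' f <= 1].
  move=> x; apply: IH => [f|]; first by rewrite divr_ge0.
  rewrite -mulr_suml -/(M x); have [->|Mx] := eqVneq (M x) 0; first by rewrite mul0r.
  by rewrite divff.
have QM x g : M x * \prod_i Q x i g = P (finins ord0 x g).
  have [n0|n0] := posnP n.
    have no (k : 'I_n) : False by case: k => k; rewrite n0.
    rewrite big1 => [|k]; last by case: (no k).
    rewrite mulr1 /M (big_pred1 g)// => h; apply/esym/eqP.
    by apply/ffunP => k; case: (no k).
  have [_ -> // _] := QP x.
  have [Mx|Mx] := eqVneq (M x) 0; last by rewrite mulrC divfK.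
  rewrite Mx mul0r; move/eqP: Mx; rewrite psumr_eq0 => [/allP/(_ g)|//].
  by rewrite mem_index_enum => /(_ isT)/eqP ->.
pose tl (f : {ffun 'I_n.+1 -> X}) : {ffun 'I_n -> X} := [ffun i => f (lift ord0 i)].
have tlK x g : tl (finins ord0 x g) = g by apply/ffunP => i; rewrite !ffunE ins_lift.
exists (fun (i : 'I_n.+1) (f : {ffun 'I_n.+1 -> X}) => ins ord0 (M (f ord0)) (fun i' => Q (f ord0) i' (tl f)) i); split.
- by move=> i f; rewrite /ins; case: unlift => [j|]//; have [] := QP (f ord0).
- move=> f _; rewrite (prod_ins ord0) ins_eq; under eq_bigr do rewrite ins_lift.
  have [x [g ->]] : exists x g, f = finins ord0 x g.
    exists (f ord0), (tl f); apply/ffunP => i; rewrite ffunE /ins.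
    by case: unliftP => [j|] ->; rewrite ?ffunE.
  by rewrite tlK finins_eq QM.
- move=> i y; rewrite big_mkcond (sum_finins ord0)/=.
  case: (unliftP ord0 i) => [j|] ->.
    apply: le_trans P1; rewrite (sum_finins ord0); apply: ler_sum => x _.
    rewrite -/(M x) -big_mkcond/=.
    under eq_bigl do rewrite finins_lift.
    have [_ _ /(_ j y) h] := QP x.
    rewrite (eq_bigr (fun g => M x * \prod_(i' | i' != j) Q x i' g)).
      by rewrite -mulr_sumr ler_piMr.
    move=> g _; rewrite tlK finins_eq big_mkcond (prod_ins ord0)/= ins_eq; congr (_ * _).
    rewrite [RHS]big_mkcond; apply: eq_bigr => i' _.
    by rewrite (inj_eq lift_inj) ins_lift.
  rewrite (bigD1 y)//= [X in _ + X]big1 ?addr0; last first.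
    by move=> x xy; rewrite big1// => g _; rewrite finins_eq (negPf xy).
  under eq_bigr do rewrite finins_eq eqxx tlK.
  rewrite (eq_bigr (fun g => \prod_i Q y i g)) => [|g _]; last first.
    rewrite big_mkcond (prod_ins ord0)/= mul1r; apply: eq_bigr => i' _.
    by rewrite ins_lift.
  have [n0|n0] := posnP n.
    have no (k : 'I_n) : False by case: k => k; rewrite n0.
    rewrite (eq_bigr (fun=> 1)) => [|g _]; last by rewrite big1// => k; case: (no k).
    rewrite sumr_const card_ffun [#|'I_n|]card_ord n0 expn0.
    by [].
  rewrite (eq_bigr (fun g => P (finins ord0 y g) / M y)) => [|g _].
    rewrite -mulr_suml -/(M y); have [->|Mx] := eqVneq (M y) 0; first by rewrite mul0r.
    by rewrite divff.
  by have [_ -> //] := QP y.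
Qed.

(** * Multilinear interpolation *)

Section CauchyEstimate.
Context {R : realType}.
Local Notation C := R[i].

(** A factor with polynomial growth disappears in the [k]-th root.  Only the
    exponents [k] that are multiples of [q + 1] are used: for them Bernoulli's
    inequality gives a lower bound of degree [q + 1] in [k]. *)
Lemma le_of_powers (x y : R) (L q : nat) : 0 <= x -> 0 <= y ->
  (forall k, x ^+ k <= (k * L).+1%:R ^+ q * y ^+ k) -> x <= y.
Proof.
move=> x0 y0 xy; rewrite leNgt; apply/negP => yx.
have [y_0|y_n0] := eqVneq y 0.
  by have := xy 1%N; rewrite !expr1 y_0 mulr0 leNgt -y_0 yx.
have yp : 0 < y by rewrite lt_neqAle eq_sym y_n0.
pose d := x / y - 1; have d0 : 0 < d by rewrite subr_gt0 ltr_pdivlMr// mul1r.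
have bern j : 1 + j%:R * d <= (1 + d) ^+ j.
  elim: j => [|j IH]; first by rewrite mul0r addr0 expr0.
  rewrite exprS; apply: le_trans (ler_wpM2l _ IH); last by rewrite addr_ge0// ltW.
  rewrite -subr_ge0 -natr1 [X in 0 <= X](_ : _ = j%:R * d ^+ 2); last by ring.
  by rewrite mulr_ge0// sqr_ge0.
have xy' k : (1 + d) ^+ k <= (k * L).+1%:R ^+ q.
  rewrite /d addrC subrK expr_div_n ler_pdivrMr ?exprn_gt0//; exact: xy.
have d1 : 0 <= 1 + d by rewrite addr_ge0// ltW.
pose A := 1 + (q.+1 * L)%:R / d.
have A1 : 1 <= A by rewrite lerDl divr_ge0// ltW.
have bnd j : 1 + j%:R * d <= A ^+ q.
  have j0 : 0 < 1 + j%:R * d by rewrite ltr_pwDl// mulr_ge0// ltW.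
  have h : (1 + j%:R * d) ^+ q.+1 <= (A * (1 + j%:R * d)) ^+ q.
    apply: (@le_trans _ _ ((1 + d) ^+ (j * q.+1))).
      by rewrite exprM; apply: lerXn2r; rewrite ?nnegrE ?exprn_ge0 ?(ltW j0).
    apply: le_trans (xy' _) _.
    have [->|q0] := posnP q; first by rewrite !expr0.
    apply: lerXn2r; rewrite ?nnegrE//; first by rewrite mulr_ge0 ?(ltW j0)// (le_trans _ A1).
    rewrite -natr1 -mulnA natrM /A.
    rewrite -subr_ge0 [X in 0 <= X](_ : _ = j%:R * d + (q.+1 * L)%:R / d); last first.
      by field; rewrite gt_eqF.
    by rewrite addr_ge0// ?mulr_ge0// ?invr_ge0 ltW.
  move: h; rewrite exprMn exprS mulrC -[leRHS]mulrC ler_pM2l// exprn_gt0//.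
have := bnd (Num.truncn (A ^+ q / d)).+1.
rewrite leNgt => /negP; apply.
have : A ^+ q / d < (Num.truncn (A ^+ q / d)).+1%:R by exact: truncnS_gt.
by rewrite ltr_pdivrMr// => h; rewrite (lt_le_trans h)// lerDr.
Qed.

Lemma prim_root_exists n : (0 < n)%N -> exists z : C, n.-primitive_root z.
Proof.
pose p : {poly C} := 'X^n - 1; have [r Dp] := closed_field_poly_normal p.
move=> n_gt0; rewrite (monicP _) ?monicXnsubC // scale1r in Dp.
have rn1: all n.-unity_root r by apply/allP=> z; rewrite -root_prod_XsubC -Dp.
have sz_r: (n < (size r).+1)%N.
  by rewrite -(size_prod_XsubC r id) -Dp size_XnsubC.
have [|z] := hasP (has_prim_root n_gt0 rn1 _ sz_r); last by exists z.
by rewrite -separable_prod_XsubC -Dp separable_Xn_sub_1 // pnatr_eq0 -lt0n.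
Qed.

Lemma sum_prim_root N (z : C) (i j : 'I_N) : N.-primitive_root z ->
  \sum_(s < N) (z ^+ i / z ^+ j) ^+ s = N%:R *+ (i == j).
Proof.
move=> pz; have N0 := prim_order_gt0 pz.
have z0 : z != 0 by rewrite (prim_root_eq0 pz) -lt0n.
have [->|ij] := eqVneq i j.
  under eq_bigr do rewrite divff ?expf_neq0// expr1n.
  by rewrite sumr_const card_ord.
set w := _ / _; have w1 : w != 1.
  rewrite -subr_eq0 /w -(divff (expf_neq0 j z0)) -mulrBl mulf_eq0 negb_or.
  rewrite invr_eq0 expf_neq0// andbT subr_eq0 (eq_prim_root_expr pz).
  by rewrite !modn_small.
have : (w - 1) * \sum_(s < N) w ^+ s = 0.
  rewrite -subrX1 /w expr_div_n -!exprM mulnC exprM (prim_expr_order pz) expr1n.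
  by rewrite mulnC exprM (prim_expr_order pz) expr1n divr1 subrr.
by move/eqP; rewrite mulf_eq0 subr_eq0 (negPf w1) => /eqP.
Qed.

(** Cauchy's estimate for the coefficients of a polynomial on a polydisc, the
    mean over the torus being replaced by the mean over roots of unity whose
    order exceeds the degrees. *)
Lemma Cauchy_estimate (V H : finType) N (z : C) (mm : H -> {ffun V -> 'I_N})
    (K : H -> C) (rho : V -> C) (B : C) (m : {ffun V -> 'I_N}) :
  N.-primitive_root z ->
  (forall s : {ffun V -> 'I_N},
     `|\sum_h K h * \prod_v (z ^+ s v * rho v) ^+ mm h v| <= B) ->
  `|(\sum_(h | mm h == m) K h) * \prod_v rho v ^+ m v| <= B.
Proof.
move=> pz QB; have N0 := prim_order_gt0 pz.
have nz : `|z| = 1.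
  apply/eqP; rewrite -(pexpr_eq1 N0)// -normrX (prim_expr_order pz) normr1//.
pose c := \sum_(s : {ffun V -> 'I_N}) (\prod_v (z ^+ m v) ^- s v) *
  \sum_h K h * \prod_v (z ^+ s v * rho v) ^+ mm h v.
have cE : c = (#|{ffun V -> 'I_N}|%:R) *
    ((\sum_(h | mm h == m) K h) * \prod_v rho v ^+ m v).
  rewrite /c (eq_bigr _ (fun s _ => mulr_sumr _ _ _ _)).
  rewrite exchange_big/= [X in _ = _ * X]mulr_suml [RHS]mulr_sumr [RHS]big_mkcond/=.
  apply: eq_bigr => h _.
  transitivity (K h * \prod_v rho v ^+ mm h v *
      \sum_(s : {ffun V -> 'I_N}) \prod_v (z ^+ mm h v / z ^+ m v) ^+ s v).
    rewrite mulr_sumr; apply: eq_bigr => s _.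
    rewrite mulrCA -!mulrA; congr (_ * _); rewrite -!big_split/=; apply: eq_bigr => v _.
    by rewrite !exprMn exprVn mulrC mulrAC mulrC (exprAC z (s v) (mm h v)).
  rewrite -(bigA_distr_bigA (fun v (k : 'I_N) => (z ^+ mm h v / z ^+ m v) ^+ k))/=.
  under [X in _ * X]eq_bigr do rewrite sum_prim_root//.
  case: eqP => [<-|/eqP hm].
    under [X in _ * X]eq_bigr do rewrite eqxx mulr1n.
    by rewrite prodr_const card_ffun card_ord natrX mulrC.
  have [v hv] : exists v, mm h v != m v.
    by apply/existsP; rewrite -negb_forall; apply: contra hm => /forallP e;
      apply/eqP/ffunP => v; apply/eqP.
  by rewrite [X in _ * X](bigD1 v)//= (negPf hv) mulr0n mul0r mulr0.
have cn : `|c| <= #|{ffun V -> 'I_N}|%:R * B.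
  rewrite mulr_natl -sumr_const /c.
  apply: le_trans (ler_norm_sum _ _ _) _; apply: ler_sum => s _.
  rewrite normrM normr_prod big1 ?mul1r// => v _.
  by rewrite normfV !normrX nz !expr1n invr1.
have card0 : (0 : C) < #|{ffun V -> 'I_N}|%:R.
  by rewrite ltr0n card_ffun expn_gt0 card_ord N0.
by move: cn; rewrite cE normrM ger0_norm ?(ltW card0)// ler_pM2l.
Qed.

End CauchyEstimate.

Section InterpolationInequality.
Context {R : realType}.
Local Notation C := R[i].

Definition cpart (s : bool) (z : C) : R := if s then complex.Im z else complex.Re z.
Definition cbasis (s : bool) : C := if s then 'i%C else 1.

Lemma cpart_decomp z : \sum_s cbasis s * (cpart s z)%:C%C = z.
Proof.
rewrite big_bool/= mul1r mulrC addrC; case: z => x y.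
by apply/eqP; rewrite eq_complex /=; apply/andP; split; apply/eqP; ring.
Qed.

Lemma norm_cbasis s : `|cbasis s| = 1.
Proof.
case: s => /=; last exact: normr1.
by rewrite normc_def/= expr0n/= add0r expr1n sqrtr1.
Qed.

Lemma norm_real (x : R) : `|x%:C%C| = `|x|%:C%C.
Proof. by rewrite normc_def/= expr0n/= addr0 sqrtr_sqr. Qed.

Lemma norm_cpart s z : `|cpart s z|%:C%C <= `|z|.
Proof.
case: s => /=; last exact: normc_ge_Re.
rewrite normc_def lecR -sqrtr_sqr ler_wsqrtr// lerDr; exact: sqr_ge0.
Qed.

Variables (V I L : finType) (kap : I -> R) (pk : I -> L -> V).

(** Each complex argument is the sum of its real part and [i] times its
    imaginary part, so the form splits into [2 ^ #|L|] real ones. *)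
Lemma complexify (rho : V -> R) (M : R) :
  (forall g : L -> V -> R, (forall l v, `|g l v| <= rho v) ->
     `|\sum_i kap i * \prod_l g l (pk i l)| <= M) ->
  forall z : V -> C, (forall v, `|z v| <= (rho v)%:C%C) ->
  `|\sum_i (kap i)%:C%C * \prod_l z (pk i l)| <= (2 ^+ #|L| * M)%:C%C.
Proof.
move=> gM z zrho.
have -> : \sum_i (kap i)%:C%C * \prod_l z (pk i l) =
    \sum_(s : {ffun L -> bool}) (\prod_l cbasis (s l)) *
      (\sum_i kap i * \prod_l cpart (s l) (z (pk i l)))%:C%C.
  under [RHS]eq_bigr do rewrite rmorph_sum mulr_sumr/=.
  rewrite [RHS]exchange_big/=; apply: eq_bigr => i _.
  under [in LHS]eq_bigr do rewrite -[z _]cpart_decomp.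
  rewrite (bigA_distr_bigA (fun l s => cbasis s * (cpart s (z (pk i l)))%:C%C)) mulr_sumr.
  apply: eq_bigr => s _; rewrite rmorphM rmorph_prod/= big_split/=.
  by rewrite mulrCA.
apply: le_trans (ler_norm_sum _ _ _) _.
have -> : (2 ^+ #|L| * M)%:C%C = \sum_(s : {ffun L -> bool}) (M)%:C%C :> C.
  rewrite sumr_const card_ffun card_bool -[RHS]mulr_natl natrX.
  by rewrite rmorphM rmorphXn/= rmorph_nat.
apply: ler_sum => s _; rewrite normrM normr_prod big1 ?mul1r => [|l _]; last first.
  exact: norm_cbasis.
rewrite norm_real lecR; apply: (gM (fun l v => cpart (s l) (z v))) => l v.
by rewrite -lecR (le_trans (norm_cpart _ _))// zrho.
Qed.

Lemma prod_powR (W : finType) (F : W -> R) a : (forall v, 0 <= F v) ->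
  \prod_v (F v `^ a) = (\prod_v F v) `^ a.
Proof.
move=> F0; suff [] : 0 <= \prod_v F v /\ \prod_v (F v `^ a) = (\prod_v F v) `^ a by [].
elim/big_rec2: _ => [|v x y _ [x0 ->]]; first by rewrite powR1.
by rewrite mulr_ge0// powRM.
Qed.

Lemma powR_sum (W : finType) (x : R) (lam : W -> R) : 0 < x ->
  \prod_e x `^ lam e = x `^ \sum_e lam e.
Proof.
move=> x0; elim/big_rec2: _ => [|e a b _ ->]; first by rewrite powRr0.
by rewrite powRD ?(gt_eqF x0) ?implybT.
Qed.

(** With all arguments equal, the [k]-th power of the form is a polynomial with
    at most [(k * #|L|).+1 ^ #|V|] coefficients [c m].  Cauchy's estimates on
    the boxes with sides [rho e] bound the coefficients, the geometric mean of
    these bounds is the bound of each monomial at [f], and the number of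
    coefficients disappears in the [k]-th root.  The factor [2 ^ #|L|] is the
    price of complex arguments, for which Cauchy's estimates are made. *)
Lemma interpolation (E : finType) (lam : E -> R) (rho : E -> V -> R) (M : R) (f : V -> R) :
  0 < M -> (forall e, 0 <= lam e) -> \sum_e lam e = 1 ->
  (forall e v, 0 <= rho e v) ->
  (forall e (g : L -> V -> R), (forall l v, `|g l v| <= rho e v) ->
     `|\sum_i kap i * \prod_l g l (pk i l)| <= M) ->
  (forall v, `|f v| <= \prod_e rho e v `^ lam e) ->
  `|\sum_i kap i * \prod_l f (pk i l)| <= 2 ^+ #|L| * M.
Proof.
move=> M0 lam0 lam1 rho0 hM hf.
set B := 2 ^+ #|L| * M; have Bp : 0 < B by rewrite mulr_gt0// exprn_gt0.
have B0 := ltW Bp; apply: (@le_of_powers _ _ _ #|L| #|V|) => // k.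
pose N := (k * #|L|).+1.
pose expo (h : {ffun 'I_k -> I}) v : nat := #|[pred p : ('I_k * L)%type | pk (h p.1) p.2 == v]|.
have expoN h v : (expo h v < N)%N.
  by rewrite ltnS (leq_trans (max_card _))// card_prod card_ord.
pose mm (h : {ffun 'I_k -> I}) : {ffun V -> 'I_N} := [ffun v => Ordinal (expoN h v)].
have monom (A : comNzRingType) (z : V -> A) (h : {ffun 'I_k -> I}) :
    \prod_s \prod_l z (pk (h s) l) = \prod_v z v ^+ mm h v.
  rewrite pair_bigA/= (partition_big (fun p => pk (h p.1) p.2) xpredT)//=.
  apply: eq_bigr => v _; rewrite ffunE/= -prodr_const.
  by apply: eq_big => [p|p /eqP ->]; rewrite ?inE.
have power (A : comNzRingType) (K : I -> A) (z : V -> A) :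
    (\sum_i K i * \prod_l z (pk i l)) ^+ k =
    \sum_(h : {ffun 'I_k -> I}) (\prod_s K (h s)) * \prod_v z v ^+ mm h v.
  rewrite -[in LHS](card_ord k) -prodr_const.
  rewrite (bigA_distr_bigA (fun _ i => K i * \prod_l z (pk i l))).
  by apply: eq_bigr => h _; rewrite big_split/= monom.
pose c (m : {ffun V -> 'I_N}) : R := \sum_(h | mm h == m) \prod_s kap (h s).
have [z pz] := @prim_root_exists R N isT.
have nz : `|z| = 1.
  by apply/eqP; rewrite -(@pexpr_eq1 _ _ N)// -normrX (prim_expr_order pz) normr1.
have cbnd e m : `|c m| * \prod_v rho e v ^+ m v <= B ^+ k.
  have := @Cauchy_estimate R V _ N z mm (fun h => (\prod_s kap (h s))%:C%C)
    (fun v => (rho e v)%:C%C) ((B ^+ k)%:C%C) m pz.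
  rewrite -rmorph_sum/= -/(c m); under [X in _ * X]eq_bigr do rewrite -rmorphXn.
  rewrite -rmorph_prod -rmorphM/= norm_real lecR normrM [X in _ * X]ger0_norm; last first.
    by rewrite prodr_ge0// => v _; rewrite exprn_ge0.
  apply=> s; rewrite (_ : \sum_h _ = (\sum_i (kap i)%:C%C *
      \prod_l (fun v => z ^+ s v * (rho e v)%:C%C) (pk i l)) ^+ k); last first.
    apply/esym; apply: etrans (power C (fun i => (kap i)%:C%C)
      (fun v => z ^+ s v * (rho e v)%:C%C)) _.
    by apply: eq_bigr => h _; rewrite rmorph_prod.
  rewrite normrX rmorphXn/=; apply: lerXn2r; rewrite ?nnegrE//.
    by rewrite (_ : 0 = 0%:C%C)// lecR.
  have := @complexify (rho e) M (hM e) (fun v => z ^+ s v * (rho e v)%:C%C).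
  apply => v.
  by rewrite normrM normrX nz expr1n mul1r norm_real lecR ger0_norm.
have cf m : `|c m| * \prod_v `|f v| ^+ m v <= B ^+ k.
  apply: (@le_trans _ _ (`|c m| * \prod_v (\prod_e rho e v `^ lam e) ^+ m v)).
    rewrite ler_wpM2l//; apply: ler_prod => v _; rewrite exprn_ge0//=.
    by apply: lerXn2r; rewrite ?nnegrE// prodr_ge0// => e _; exact: powR_ge0.
  have [cm|cm] := eqVneq `|c m| 0; first by rewrite cm mul0r exprn_ge0.
  have mean (x : R) : 0 < x -> \prod_e x `^ lam e = x.
    by move=> x0; rewrite powR_sum// lam1 powRr1// ltW.
  rewrite -[X in X * _]mean ?lt_neqAle 1?eq_sym ?cm ?normr_ge0//.
  under [X in _ * X]eq_bigr do rewrite -prodrXl.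
  rewrite exchange_big/= -big_split/= -[leRHS]mean ?exprn_gt0//.
  apply: ler_prod => e _.
  have pr0 : 0 <= \prod_v rho e v ^+ m v.
    by rewrite prodr_ge0// => v _; rewrite exprn_ge0.
  rewrite (_ : \prod_v _ = (\prod_v rho e v ^+ m v) `^ lam e); last first.
    rewrite -prod_powR => [|v]; last exact: exprn_ge0.
    by apply: eq_bigr => v _; rewrite -!powR_mulrn ?powR_ge0// powRAC.
  rewrite mulr_ge0 ?powR_ge0//= -powRM//.
  by apply: ge0_ler_powR; rewrite ?nnegrE ?mulr_ge0 ?exprn_ge0//; exact: cbnd.
rewrite -normrX (power R) (partition_big mm xpredT)//=.
apply: le_trans (ler_norm_sum _ _ _) _.
apply: (@le_trans _ _ (\sum_(m : {ffun V -> 'I_N}) B ^+ k)); last first.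
  by rewrite sumr_const card_ffun card_ord -[leLHS]mulr_natl natrX.
apply: ler_sum => m _; apply: le_trans (cf m).
rewrite (eq_bigr (fun h : {ffun 'I_k -> I} => (\prod_s kap (h s)) * \prod_v f v ^+ m v)).
  rewrite -mulr_suml normrM normr_prod -/(c m) ler_wpM2l//.
  by apply/le_of_eq/eq_bigr => v _; rewrite normrX.
by move=> h /eqP ->.
Qed.

End InterpolationInequality.

(** * The finite inequality *)

Section PowerLemmas.
Context {R : realType}.

Lemma powR_split (y r : R) : 0 <= y -> r != 0 -> y `^ (1 - r) * y `^ r = y.
Proof.
move=> y0 r0; have [->|yn] := eqVneq y 0; first by rewrite (powR0 r0) mulr0.
by rewrite -powRD ?yn ?implybT// subrK powRr1.
Qed.

Lemma mean_powR (E : finType) (al lam : E -> R) (y : R) : 0 <= y ->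
  \sum_e al e * lam e = 1 -> y <= \prod_e (y `^ al e) `^ lam e.
Proof.
rewrite le_eqVlt => /orP[/eqP <- _|y0 s1].
  by rewrite prodr_ge0// => e _; exact: powR_ge0.
under eq_bigr do rewrite -powRrM.
by rewrite powR_sum// s1 powRr1// ltW.
Qed.

Lemma sqr_powR_half (y r : R) : 0 <= y -> (y `^ (r / 2)) ^+ 2 = y `^ r.
Proof. by move=> y0; rewrite -powR_mulrn ?powR_ge0// -powRrM divfK. Qed.

Lemma powR_le1 (y r : R) : 0 < r -> 0 <= y -> y `^ r <= 1 -> y <= 1.
Proof.
move=> r0 y0; rewrite leNgt => yr; rewrite leNgt; apply: contra yr => y1.
have <- : 1 `^ r = 1 :> R by rewrite powR1.
by apply: gt0_ltr_powR; rewrite ?nnegrE.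
Qed.

Lemma powR_half_sqr (y : R) : 0 <= y -> (y `^ (2^-1)) ^+ 2 = y.
Proof. by move=> y0; rewrite powR12_sqrt// sqr_sqrtr. Qed.

End PowerLemmas.

Section FiniteInequality.
Context {R : realType}.
Variables (m n : nat) (D S J C : finType).
Local Notation Jm := {ffun 'I_m -> {ffun 'I_n -> J}}.
Local Notation Sm := {ffun 'I_m -> S}.
Local Notation Tm := {ffun 'I_m -> {ffun 'I_n -> D}}.

(** The chain rule along the positions [i]: the values of [j] at position [i]
    are the family of the [j k i], for all [k] together. *)
Lemma chain_rule_transpose (P : Jm -> R) : (0 < n)%N ->
  (forall j, 0 <= P j) -> \sum_j P j <= 1 ->
  exists Q : 'I_n -> Jm -> R,
    [/\ forall i j, 0 <= Q i j, forall j, \prod_i Q i j = P j &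
        forall i (al : {ffun 'I_m -> J}),
          \sum_(j : Jm | [ffun k => j k i] == al) \prod_(i' | i' != i) Q i' j <= 1].
Proof.
move=> n0 P0 P1.
pose tr (f : {ffun 'I_n -> {ffun 'I_m -> J}}) : Jm := [ffun k => [ffun i => f i k]].
pose tr' (j : Jm) : {ffun 'I_n -> {ffun 'I_m -> J}} := [ffun i => [ffun k => j k i]].
have trK : cancel tr tr'.
  by move=> f; apply/ffunP => i; apply/ffunP => k; rewrite !ffunE.
have trK' : cancel tr' tr.
  by move=> j; apply/ffunP => k; apply/ffunP => i; rewrite !ffunE.
have tr_bij : {on predT, bijective tr} by exists tr' => j _; [exact: trK|exact: trK'].
have [|Q [Q0 QP Q1]] := @chain_rule R n {ffun 'I_m -> J} (P \o tr) (fun _ => P0 _).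
  by rewrite -(reindex _ tr_bij).
exists (fun i j => Q i (tr' j)); split=> //.
  by move=> j; rewrite QP//= trK'.
move=> i al; apply: le_trans (Q1 i al); rewrite (reindex tr)/=; last first.
  by exists tr' => j _; [exact: trK|exact: trK'].
apply/le_of_eq/eq_big => [f|f _]; last by rewrite trK.
by congr (_ == _); apply/ffunP => k; rewrite !ffunE.
Qed.

(* The variables of the multilinear form to be interpolated: the coefficients
   of the functional, those of the tensor, and the values of the functions. *)
Let V := ((Jm * C) + (Sm * C) + ('I_m * 'I_n * J * D))%type.
Let W := (bool + 'I_m * 'I_n)%type.
Let I := (Jm * C * Sm * Tm)%type.

Let pk (i : I) (w : W) : V := match w with
  | inl true => inl (inl (i.1.1.1, i.1.1.2))
  | inl false => inl (inr (i.1.2, i.1.1.2))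
  | inr kl => inr (kl, i.1.1.1 kl.1 kl.2, i.2 kl.1 kl.2)
  end.

Lemma comp_val_expand (a : 'I_m -> {ffun 'I_n -> D} -> S -> R) (g : W -> V -> R) :
  \sum_(i : I) (\prod_k a k (i.2 k) (i.1.2 k)) * \prod_w g w (pk i w) =
  \sum_j \sum_c g (inl true) (inl (inl (j, c))) *
    comp_val a (fun k l j' d => g (inr (k, l)) (inr (k, l, j', d)))
      (fun rho c' => g (inl false) (inl (inr (rho, c')))) j c.
Proof.
rewrite [RHS]pair_bigA/=; under [RHS]eq_bigr do rewrite mulr_sumr.
rewrite [RHS]pair_bigA/=.
rewrite -(pair_bigA _ (fun (p : Jm * C * Sm) (t : Tm) => (\prod_k a k (t k) (p.2 k)) *
   \prod_w g w (pk (p, t) w)))/=.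
apply: eq_bigr => -[[j c] rho] _ /=.
rewrite (bigA_distr_bigA (fun k (t : {ffun 'I_n -> D}) => a k t (rho k) *
   \prod_i g (inr (k, i)) (inr (k, i, j k i, t i))))/=.
rewrite mulr_suml mulr_sumr; apply: eq_bigr => t _.
rewrite big_split/= pair_bigA/= big_sumType/= big_bool/=.
have -> : \prod_(kl : 'I_m * 'I_n) g (inr kl) (inr (kl, j kl.1 kl.2, t kl.1 kl.2)) =
    \prod_(kl : 'I_m * 'I_n)
      g (inr (kl.1, kl.2)) (inr (kl.1, kl.2, j kl.1 kl.2, t kl.1 kl.2)).
  by apply: eq_bigr => -[k l].
by ring.
Qed.


Variables (a : 'I_m -> {ffun 'I_n -> D} -> S -> R) (x : 'I_m -> 'I_n -> J -> D -> R).
Variables (tau : Sm -> C -> R) (ka th p : R) (low : bool).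
Hypotheses (n0 : (0 < n)%N) (a1 : forall k, unit_form (a k)).
Hypotheses (ka0 : 0 <= ka) (nka : n%:R * ka <= 1) (th0 : 0 <= th) (th1 : th <= 1).
Hypotheses (p1 : 1 <= p) (pE : p^-1 = if low then 1 - th / 2 else th / 2).
Let u := 2 / (1 + ka).
Let t := 2 / (1 + th * ka).
Hypotheses (x1 : forall k i d, \sum_j `|x k i j d| `^ u <= 1).
Hypotheses (tau1 : forall rho, \sum_c `|tau rho c| `^ p <= 1).

(* The endpoints: [inl i] has the functions of index [i] in [l_1(J)] and the
   others in [l_2(J)]; at [inr true] all of them are in [l_2(J)]; in both cases
   [tau] takes its values in [l_2(C)].  At [inr false] the values of [tau] are
   in [l_1(C)] or in [l_oo(C)]. *)
Let E := ('I_n + bool)%type.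
Let lam (e : E) : R := match e with
  | inl _ => th * ka | inr true => th * (1 - n%:R * ka) | inr false => 1 - th end.
Let al_tau (e : E) : R := match e with
  | inl _ | inr true => p / 2 | inr false => if low then p else 0 end.
Let al_x (i : 'I_n) (e : E) : R := match e with
  | inl i' => if i' == i then u else u / 2 | inr true => u / 2 | inr false => 1 end.

Let ka1 : 0 < 1 + ka. Proof. by rewrite ltr_pwDl. Qed.
Let p0 : 0 < p. Proof. exact: lt_le_trans p1. Qed.
Let u0 : 0 < u. Proof. by rewrite divr_gt0. Qed.

Let lam_ge0 e : 0 <= lam e.
Proof.
case: e => [i|[]] /=; rewrite ?mulr_ge0 ?subr_ge0//.
Qed.

Let sumE (F : E -> R) : \sum_e F e = \sum_i F (inl i) + (F (inr true) + F (inr false)).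
Proof. by rewrite big_sumType/= big_bool. Qed.

Let prodE (F : E -> R) : \prod_e F e = \prod_i F (inl i) * (F (inr true) * F (inr false)).
Proof. by rewrite big_sumType/= big_bool. Qed.

Let lam_sum : \sum_e lam e = 1.
Proof. by rewrite sumE/= sumr_const card_ord -[_ *+ n]mulr_natr; ring. Qed.

Let tau_sum : \sum_e al_tau e * lam e = 1.
Proof.
rewrite sumE/= sumr_const card_ord -[_ *+ n]mulr_natr.
have pp : p * p^-1 = 1 by rewrite divff// gt_eqF.
rewrite -[RHS]pp pE; by case: low; field.
Qed.

Let x_sum i : \sum_e al_x i e * lam e = 1.
Proof.
rewrite sumE/= (bigD1 i)//= eqxx.
rewrite (eq_bigr (fun=> u / 2 * (th * ka))) => [|i' /negPf ->//].
rewrite sumr_const (eq_card (B := predC1 i))// cardC1 card_ord.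
rewrite -[_ *+ n.-1]mulr_natr -subn1 natrB// /u; field.
by rewrite gt_eqF.
Qed.

Let x_le1 k l d j : `|x k l j d| `^ u <= 1.
Proof.
apply: le_trans (x1 k l d); rewrite (bigD1 j)//= lerDl.
by apply: sumr_ge0 => j' _; exact: powR_ge0.
Qed.

Let M : R := (2 * 9 ^+ n) ^+ m.

Let M_l2 : (9 ^+ n) ^+ m <= M.
Proof.
rewrite /M; apply: lerXn2r; rewrite ?nnegrE ?mulr_ge0 ?exprn_ge0//.
by rewrite ler_peMl ?exprn_ge0// ler1n.
Qed.

(** At the endpoints, the coefficients of the functional are bounded by
    [(A i * q) ^ (1 / 2)] where [A i] is the product of the conditional
    probabilities [Q i'] with [i' != i], by [(P * q) ^ (1 / 2)], and by
    [P ^ (1 / 2)] or [P ^ (1 / 2) * q]; these satisfy the hypotheses of the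
    endpoint estimates because of the normalizations of [P], [q] and [Q].  Since
    the product of the [A i] is [P ^ (n - 1)], the geometric mean of the
    bounds is a product of powers of [P] and [q], with the exponents
    [1 - 1 / t] and [1 - 1 / p].  Where [P] or [q] vanishes, [b] is required to
    vanish as well, since the exponents may be 0 and [0 `^ 0] is 1. *)
Lemma functional_bound (P : Jm -> R) (q : Jm -> C -> R) (b : Jm -> C -> R) :
  (forall j, 0 <= P j) -> \sum_j P j <= 1 ->
  (forall j c, 0 <= q j c) -> (forall j, \sum_c q j c <= 1) ->
  (forall j c, `|b j c| <= P j `^ (1 - t^-1) * q j c `^ (1 - p^-1)) ->
  (forall j c, P j = 0 -> b j c = 0) -> (forall j c, q j c = 0 -> b j c = 0) ->
  `|\sum_j \sum_c b j c * comp_val a x tau j c| <= 2 ^+ #|{: W}| * M.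
Proof.
move=> P0 P1 q0 q1 bPq bP bq.
have [Q [Q0 QP Q1]] := chain_rule_transpose n0 P0 P1.
pose A i j := \prod_(i' | i' != i) Q i' j.
have A0 i j : 0 <= A i j by exact: prodr_ge0.
pose rho_b (e : E) (jc : Jm * C) : R := match e with
  | inl i => (A i jc.1 * q jc.1 jc.2) `^ 2^-1
  | inr true => (P jc.1 * q jc.1 jc.2) `^ 2^-1
  | inr false => P jc.1 `^ 2^-1 * (if low then 1 else q jc.1 jc.2) end.
pose rho (e : E) (v : V) : R := match v with
  | inl (inl jc) => rho_b e jc
  | inl (inr rc) => `|tau rc.1 rc.2| `^ al_tau e
  | inr kljd => `|x kljd.1.1.1 kljd.1.1.2 kljd.1.2 kljd.2| `^ al_x kljd.1.1.2 e end.
pose f (v : V) : R := match v with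
  | inl (inl jc) => b jc.1 jc.2
  | inl (inr rc) => tau rc.1 rc.2
  | inr kljd => x kljd.1.1.1 kljd.1.1.2 kljd.1.2 kljd.2 end.
have -> : \sum_j \sum_c b j c * comp_val a x tau j c =
    \sum_(i : I) (\prod_k a k (i.2 k) (i.1.2 k)) * \prod_w f (pk i w).
  by rewrite (comp_val_expand a (fun _ => f)).
apply: (@interpolation R V I W _ pk E lam rho M) => //.
- by rewrite /M exprn_gt0// mulr_gt0// exprn_gt0.
- move=> e [[jc|rc]|kljd] /=; rewrite ?powR_ge0//.
  by case: e => [i|[]]/=; rewrite ?powR_ge0// mulr_ge0 ?powR_ge0//; case: low.
- move=> e g hg; rewrite comp_val_expand.
  pose bg j c := g (inl true) (inl (inl (j, c))).
  pose taug rho c := g (inl false) (inl (inr (rho, c))).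
  pose xg k l j d := g (inr (k, l)) (inr (k, l, j, d)).
  have hb j c : `|bg j c| <= rho_b e (j, c) by exact: hg.
  have htau r c : `|taug r c| <= `|tau r c| `^ al_tau e by exact: hg.
  have hx k l j d : `|xg k l j d| <= `|x k l j d| `^ al_x l e by exact: hg.
  change (`|\sum_j \sum_c bg j c * comp_val a xg taug j c| <= M).
  clearbody bg taug xg => {g hg}.
  have tau2 r : al_tau e = p / 2 -> nrm2 predT (taug r) <= 1.
    move=> ep; rewrite nrm2_leP// expr1n; apply: le_trans (tau1 r).
    apply: ler_sum => c _; rewrite -(sqr_powR_half _ (normr_ge0 (tau r c))).
    by rewrite -(real_normK (num_real _)) lerXn2r ?nnegrE ?powR_ge0// -ep.
  have x2 k l d : al_x l e = u / 2 -> nrm2 predT (fun j => xg k l j d) <= 1.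
    move=> ep; rewrite nrm2_leP// expr1n; apply: le_trans (x1 k l d).
    apply: ler_sum => j _; rewrite -(sqr_powR_half _ (normr_ge0 (x k l j d))).
    by rewrite -(real_normK (num_real _)) lerXn2r ?nnegrE ?powR_ge0// -ep.
  have Pq1 j : \sum_c P j * q j c <= P j by rewrite -mulr_sumr ler_piMr.
  case: e hb htau hx tau2 x2 => [i|[]] hb htau hx tau2 x2.
  + apply: (endpoint_l1 (i0 := i)) => //.
    * move=> k l d; have [li|li] := eqVneq i l; last by apply: x2 => /=; rewrite (negPf li).
      rewrite nrm2_leP// expr1n; apply: le_trans (x1 k l d); apply: ler_sum => j _.
      have := hx k l j d; rewrite /= li eqxx => h.
      rewrite -(real_normK (num_real _)) expr2.
      by rewrite (le_trans (ler_pM _ _ h h))// ler_piMr ?powR_ge0.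
    * move=> k d; apply: le_trans (x1 k i d); apply: ler_sum => j _.
      by have := hx k i j d; rewrite /= eqxx.
    * by move=> r; exact: tau2.
    * move=> al; rewrite nrm2_leP// expr1n; apply: le_trans (Q1 i al).
      apply: ler_sum => j _; rewrite nrm2_sqr -/(A i j).
      apply: (@le_trans _ _ (\sum_c A i j * q j c)); last first.
        by rewrite -mulr_sumr ler_piMr.
      apply: ler_sum => c _; rewrite -(powR_half_sqr (y := A i j * q j c)) ?mulr_ge0//.
      by rewrite -(real_normK (num_real _)) lerXn2r ?nnegrE ?powR_ge0//; exact: hb.
  + apply: le_trans M_l2; apply: (endpoint_l2 (B := fun j => P j `^ 2^-1)) => //.
    * by move=> k l d; exact: x2.
    * move=> r j; apply: le_trans (ler_norm_sum _ _ _) _.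
      under eq_bigr do rewrite normrM.
      apply: le_trans (CauchySchwarz _ _ _) _; rewrite !nrm2_abs.
      rewrite -[leRHS]mulr1 ler_pM ?nrm2_ge0//; last exact: tau2.
      rewrite nrm2_leP ?powR_ge0// powR_half_sqr//; apply: le_trans (Pq1 j).
      apply: ler_sum => c _; rewrite -(powR_half_sqr (y := P j * q j c)) ?mulr_ge0//.
      by rewrite -(real_normK (num_real _)) lerXn2r ?nnegrE ?powR_ge0//; exact: hb.
    * rewrite nrm2_leP// expr1n; apply: le_trans P1.
      by apply: ler_sum => j _; rewrite powR_half_sqr.
  + apply: le_trans M_l2; apply: (endpoint_l2 (B := fun j => P j `^ 2^-1)) => //.
    * move=> k l d; rewrite nrm2_leP// expr1n; apply: le_trans (x1 k l d).
      apply: ler_sum => j _; rewrite -(real_normK (num_real _)).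
      have := hx k l j d; rewrite /= powRr1// => h.
      apply: (@le_trans _ _ (`|x k l j d| ^+ 2)).
        by rewrite lerXn2r ?nnegrE.
      have [->|xn] := eqVneq `|x k l j d| 0; first by rewrite expr0n powR_ge0.
      rewrite -powR_mulrn//; apply: ger_powR.
        rewrite lt_neqAle eq_sym xn normr_ge0/=.
        exact: (powR_le1 u0 (normr_ge0 _) (x_le1 _ _ _ _)).
      by rewrite /u ler_pdivrMr// ler_peMr// lerDl.
    * move=> r j; apply: le_trans (ler_norm_sum _ _ _) _.
      have h c : `|bg j c * taug r c| <= P j `^ 2^-1 *
          (if low then `|tau r c| `^ p else q j c).
        have := hb j c; have := htau r c; rewrite normrM /=; case: (low) => h1 h2.
          by rewrite ler_pM// (le_trans h2)// mulr1.
        by rewrite (le_trans (ler_pM _ _ h2 h1))// powRr0 mulr1.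
      apply: le_trans (ler_sum _ (fun c _ => h c)) _.
      by rewrite -mulr_sumr ler_piMr ?powR_ge0//; case: (low).
    * rewrite nrm2_leP// expr1n; apply: le_trans P1.
      by apply: ler_sum => j _; rewrite powR_half_sqr.
- case=> [[[j c]|rc]|kljd]; rewrite /f/rho/=; [|exact: mean_powR|exact: mean_powR].
  have rho_b0 e : 0 <= rho_b e (j, c).
    case: e => [i|[]]/=; rewrite ?powR_ge0// mulr_ge0 ?powR_ge0//; case: (low) => //.
  have [Pj|Pj] := eqVneq (P j) 0.
    by rewrite bP// normr0 prodr_ge0// => e _; exact: powR_ge0.
  have [qj|qj] := eqVneq (q j c) 0.
    by rewrite bq// normr0 prodr_ge0// => e _; exact: powR_ge0.
  apply: le_trans (bPq j c) _; apply/le_of_eq.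
  pose F y z := P j `^ y * q j c `^ z.
  have FM y z y' z' : F y z * F y' z' = F (y + y') (z + z').
    by rewrite /F !powRD ?Pj ?qj ?implybT//; ring.
  have FX y z s : F y z `^ s = F (y * s) (z * s).
    by rewrite /F powRM ?powR_ge0// !powRrM.
  have FA : \prod_i (A i j * q j c) = F (n%:R - 1) n%:R.
    have h : \prod_i A i j * P j = P j ^+ n.
      rewrite -[in LHS]QP -big_split/= -[in RHS](card_ord n) -prodr_const.
      by apply: eq_bigr => i _; rewrite mulrC -QP [RHS](bigD1 i).
    rewrite big_split/= prodr_const card_ord /F powRB ?Pj ?implybT// powRr1// !powR_mulrn//.
    by rewrite -h mulfK.
  rewrite prodE/= -/(F (1 - t^-1) (1 - p^-1)).
  under eq_bigr do rewrite -powRrM.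
  rewrite prod_powR => [|i]; last by rewrite mulr_ge0.
  rewrite FA FX.
  have -> : P j * q j c = F 1 1 by rewrite /F !powRr1.
  have -> : P j `^ 2^-1 * (if low then 1 else q j c) = F 2^-1 (if low then 0 else 1).
    by rewrite /F; case: (low); rewrite ?powRr0 ?powRr1.
  rewrite !FX !FM /t pE; congr F; last by case: (low); field.
  by rewrite invf_div; field.
Qed.

(** The functional that attains the mixed norm of the family has the
    coefficients [P ^ (1 - 1 / t) * q ^ (1 - 1 / p)] up to signs, where [P] is
    the normalized distribution of the [t]-th powers of the norms of the rows,
    and [q] that of the [p]-th powers of the entries of each row. *)
Theorem finite_summing :
  \sum_j (\sum_c `|comp_val a x tau j c| `^ p) `^ (t / p) <= (2 ^+ #|{: W}| * M) `^ t.
Proof.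
set K := 2 ^+ #|{: W}| * M.
have K0 : 0 <= K by rewrite mulr_ge0 ?exprn_ge0// mulr_ge0// exprn_ge0.
have t0 : 0 < t by rewrite divr_gt0// ltr_pwDl// mulr_ge0.
pose s j := \sum_c `|comp_val a x tau j c| `^ p.
have s0 j : 0 <= s j by apply: sumr_ge0 => c _; exact: powR_ge0.
pose Z := \sum_j s j `^ (t / p).
have Z0 : 0 <= Z by apply: sumr_ge0 => j _; exact: powR_ge0.
change (Z <= K `^ t).
have [->|Zn] := eqVneq Z 0; first exact: powR_ge0.
have Zp : 0 < Z by rewrite lt_neqAle eq_sym Zn.
pose P j := s j `^ (t / p) / Z.
pose q j c := `|comp_val a x tau j c| `^ p / s j.
have P0 j : 0 <= P j by rewrite divr_ge0// powR_ge0.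
have q0 j c : 0 <= q j c by rewrite divr_ge0// powR_ge0.
have sP : \sum_j P j = 1 by rewrite -mulr_suml divff.
have sq j : s j != 0 -> \sum_c q j c = 1.
  by move=> sj; rewrite -mulr_suml divff.
have sq1 j : \sum_c q j c <= 1.
  have [sj|/sq ->//] := eqVneq (s j) 0.
  by rewrite big1// => c _; rewrite /q sj invr0 mulr0.
pose b j c := Num.sg (comp_val a x tau j c) * (P j `^ (1 - t^-1) * q j c `^ (1 - p^-1)).
have sc0 j c : s j = 0 -> comp_val a x tau j c = 0.
  move=> /eqP; rewrite psumr_eq0 => [/allP/(_ c)|c' _]; last exact: powR_ge0.
  rewrite mem_index_enum powR_eq0 normr_eq0 => /(_ isT)/=/andP[/eqP].
  by [].
have bS j c : b j c * comp_val a x tau j c =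
    P j `^ (1 - t^-1) * (q j c `^ (1 - p^-1) * `|comp_val a x tau j c|).
  by rewrite /b normrEsg; ring.
have pn0 : p^-1 != 0 by rewrite invr_eq0 gt_eqF.
have tn0 : t^-1 != 0 by rewrite invr_eq0 gt_eqF.
have eqZ : \sum_j \sum_c b j c * comp_val a x tau j c = Z `^ t^-1.
  transitivity (\sum_j P j * Z `^ t^-1); last by rewrite -mulr_suml sP mul1r.
  apply: eq_bigr => j _.
  have [sj|sj] := eqVneq (s j) 0.
    rewrite big1 => [|c _]; last by rewrite sc0// mulr0.
    by rewrite /P sj powR0 ?mul0r// mulf_neq0 ?invr_eq0 ?gt_eqF.
  transitivity (\sum_c P j `^ (1 - t^-1) * s j `^ p^-1 * q j c).
    apply: eq_bigr => c _; rewrite bS -mulrA; congr (_ * _).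
    rewrite -[in RHS](powR_split (q0 j c) pn0) [RHS]mulrCA; congr (_ * _).
    by rewrite -powRM// /q mulrC divfK// -powRrM divff ?gt_eqF// powRr1.
  rewrite -mulr_sumr sq// mulr1 -[in RHS](powR_split (P0 j) tn0) -mulrA; congr (_ * _).
  rewrite -powRM// /P divfK// -powRrM; congr (_ `^ _).
  by rewrite mulrAC divff ?gt_eqF// mul1r.
have : `|\sum_j \sum_c b j c * comp_val a x tau j c| <= K.
  apply: (@functional_bound P q b) => //; first by rewrite sP.
  - move=> j c; rewrite /b normrM [X in _ * X <= _]ger0_norm ?mulr_ge0 ?powR_ge0//.
    by rewrite ler_piMl ?mulr_ge0 ?powR_ge0// normr_sg; case: eqP.
  - move=> j c Pj; rewrite /b sc0 ?sgr0 ?mul0r//.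
    move/eqP: Pj; rewrite mulf_eq0 invr_eq0 (negPf Zn) orbF powR_eq0.
    by move=> /andP[/eqP].
  - move=> j c /eqP; rewrite mulf_eq0 invr_eq0 => /orP[|/eqP sj]; last first.
      by rewrite /b sc0 ?sgr0 ?mul0r.
    by rewrite powR_eq0 normr_eq0 => /andP[/eqP e _]; rewrite /b e sgr0 mul0r.
rewrite eqZ ger0_norm ?powR_ge0// => ZK.
have -> : Z = (Z `^ t^-1) `^ t by rewrite -powRrM mulVf ?gt_eqF// powRr1.
by apply: ge0_ler_powR; rewrite ?nnegrE ?powR_ge0 ?(ltW t0).
Qed.

End FiniteInequality.

Section FiniteNorm.
Context {R : realType}.

Lemma powR_le (x y r : R) : 0 <= r -> 0 <= x -> x <= y -> x `^ r <= y `^ r.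
Proof.
by move=> r0 x0 xy; apply: ge0_ler_powR; rewrite ?nnegrE// (le_trans x0).
Qed.

Lemma powR_sum_ge0 (I : finType) (f : I -> R) r : 0 <= \sum_i `|f i| `^ r.
Proof. by apply: sumr_ge0 => i _; exact: powR_ge0. Qed.

Lemma exponentP (p : \bar R) : (1 <= p)%E ->
  (exists2 r : R, 1 <= r & p = r%:E) \/ p = +oo%E.
Proof.
case: p => [r r1||h]; [by left; exists r; rewrite ?lee_fin// -lee_fin|by right|].
by have := le_trans h (leNye 0); rewrite lee_fin ler10.
Qed.

Definition finnorm (p : \bar R) (C : finType) (f : C -> R) : R :=
  if p is r%:E then (\sum_c `|f c| `^ r) `^ r^-1 else \big[Num.max/0]_c `|f c|.

Implicit Types (p : \bar R) (C : finType).

Lemma finnorm_ge0 p C (f : C -> R) : 0 <= finnorm p f.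
Proof.
rewrite /finnorm; case: p => [r||]; first exact: powR_ge0.
all: exact: bigmax_ge_id.
Qed.

Lemma finnorm_mono p C (f g : C -> R) : (1 <= p)%E ->
  (forall c, `|f c| <= `|g c|) -> finnorm p f <= finnorm p g.
Proof.
rewrite /finnorm => /exponentP[[r r1 ->]|->] fg.
- have r0 : 0 < r by exact: lt_le_trans r1.
  apply: powR_le; rewrite ?invr_ge0 ?(ltW r0) ?powR_sum_ge0//.
  by apply: ler_sum => c _; apply: powR_le; rewrite ?(ltW r0).
- apply: bigmax_le; first exact: bigmax_ge_id.
  by move=> c _; apply: le_trans (fg c) _; exact: (le_bigmax _ (fun c => `|g c|)).
Qed.

Lemma finnormZ p C (f : C -> R) k : (1 <= p)%E ->
  finnorm p (fun c => k * f c) = `|k| * finnorm p f.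
Proof.
rewrite /finnorm => /exponentP[[r r1 ->]|->].
- have r0 : 0 < r by exact: lt_le_trans r1.
  under eq_bigr do rewrite normrM powRM//.
  rewrite -mulr_sumr powRM ?powR_ge0 ?powR_sum_ge0//.
  by rewrite -powRrM divff ?gt_eqF// powRr1.
- elim/big_rec2: _ => [|c x y _ ->]; first by rewrite mulr0.
  by rewrite normrM maxr_pMr.
Qed.

Lemma le_finnorm p C (f : C -> R) c : (1 <= p)%E -> `|f c| <= finnorm p f.
Proof.
rewrite /finnorm => /exponentP[[r r1 ->]|->].
- have r0 : 0 < r by exact: lt_le_trans r1.
  rewrite -[leLHS](powRr1 (normr_ge0 _)) -(divff (lt0r_neq0 r0)) powRrM.
  apply: powR_le; rewrite ?invr_ge0 ?(ltW r0) ?powR_ge0//.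
  by rewrite (bigD1 c)//= lerDl sumr_ge0// => c' _; exact: powR_ge0.
- exact: (le_bigmax _ (fun c => `|f c|)).
Qed.

Lemma sum_pair_bool (C : finType) (h : C * bool -> R) :
  \sum_cs h cs = \sum_c (h (c, true) + h (c, false)).
Proof.
rewrite (eq_bigr (fun cs => h (cs.1, cs.2))) => [|[c s] _//].
by rewrite -(pair_bigA _ (fun c s => h (c, s))); apply: eq_bigr => c _; rewrite big_bool.
Qed.

(** Going from scalar entries to pairs of real and imaginary parts, and back,
    costs a factor of at most 2; this is what allows all the estimates to be
    made for real numbers. *)
Lemma finnorm_pair_le p C (f : C -> R) (g : C * bool -> R) : (1 <= p)%E ->
  (forall c s, `|g (c, s)| <= `|f c|) -> finnorm p g <= 2 * finnorm p f.
Proof.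
move=> /exponentP[[r r1 ->]|->] gf; last first.
  apply: bigmax_le; first by rewrite mulr_ge0// finnorm_ge0.
  move=> [c s] _; apply: le_trans (gf c s) _.
  apply: le_trans (le_finnorm f c (leey _)) _.
  by rewrite ler_peMl ?finnorm_ge0// ler1n.
rewrite /finnorm; have r0 : 0 < r by exact: lt_le_trans r1.
have s0 := powR_sum_ge0 f r.
apply: (@le_trans _ _ ((2 * \sum_c `|f c| `^ r) `^ r^-1)).
  apply: powR_le; rewrite ?invr_ge0 ?(ltW r0) ?powR_sum_ge0//.
  rewrite sum_pair_bool mulr_sumr.
  apply: ler_sum => c _; rewrite mulr2n mulrDl mul1r.
  by apply: lerD; apply: powR_le; rewrite ?(ltW r0).
rewrite powRM// ler_wpM2r ?powR_ge0//.
by apply: ler1_powR; rewrite ?ler1n// invf_le1.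
Qed.

Lemma finnorm_le_pair p C (f : C -> R) (g : C * bool -> R) : (1 <= p)%E ->
  (forall c, `|f c| <= `|g (c, true)| + `|g (c, false)|) ->
  finnorm p f <= 2 * finnorm p g.
Proof.
move=> p1 fg; pose h c := Num.max `|g (c, true)| `|g (c, false)|.
have h0 c : 0 <= h c by rewrite /h le_max normr_ge0.
have fh c : `|f c| <= `|2 * h c|.
  rewrite [leRHS]ger0_norm ?mulr_ge0//; apply: le_trans (fg c) _.
  by rewrite mulr2n mulrDl mul1r lerD// /h le_max lexx ?orbT.
apply: le_trans (finnorm_mono p1 fh) _.
rewrite finnormZ// ger0_norm// ler_wpM2l//.
case: (exponentP p1) => [[r r1 ->]|->]; last first.
  apply: bigmax_le; first exact: finnorm_ge0.
  move=> c _; by rewrite ger0_norm// /h ge_max !le_finnorm// leey.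
rewrite /finnorm; have r0 : 0 < r by exact: lt_le_trans r1.
apply: powR_le; rewrite ?invr_ge0 ?(ltW r0) ?powR_sum_ge0//.
rewrite sum_pair_bool; apply: ler_sum => c _; rewrite ger0_norm// /h.
by case: (leP `|g (c, true)| `|g (c, false)|) => _; rewrite ?lerDl ?lerDr powR_ge0.
Qed.

(** The values of the interpolation parameters: [ka] places [u] between 2 and 1,
    [th] places [p] between 2 and 1 if [low] holds, between 2 and [+oo]
    otherwise. The exponent [p = +oo] is kept apart because it is an endpoint,
    with [th = 0]. *)
Definition admissible (n : nat) (p : \bar R) (u t : R) : Prop :=
  exists ka : R, [/\ 0 <= ka, n%:R * ka <= 1, u = 2 / (1 + ka) &
    if p is r%:E then exists (th : R) (low : bool),
      [/\ 0 <= th, th <= 1, 1 <= r, r^-1 = (if low then 1 - th / 2 else th / 2) &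
          t = 2 / (1 + th * ka)]
    else t = 2].

(** For [p = +oo] the values of the outer operator are bounded coordinate by
    coordinate, and [unit_form_l2] suffices, without interpolation. *)
Lemma finite_summing_infty m n (D S J C : finType)
    (a : 'I_m -> {ffun 'I_n -> D} -> S -> R)
    (x : 'I_m -> 'I_n -> J -> D -> R) (tau : {ffun 'I_m -> S} -> C -> R) :
  (forall k, unit_form (a k)) ->
  (forall k i d, nrm2 predT (fun j => x k i j d) <= 1) ->
  (forall rho, finnorm +oo (tau rho) <= 1) ->
  \sum_j finnorm +oo (comp_val a x tau j) ^+ 2 <= ((9 ^+ n) ^+ m) ^+ 2.
Proof.
move=> a1 x1 tau1.
pose Y k (j : {ffun 'I_n -> J}) := \sum_r `|form_val (a k) (x k) j r|.
have Y0 k j : 0 <= Y k j by exact: sumr_ge0.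
have Yn k : nrm2 predT (Y k) <= 9 ^+ n by exact: unit_form_l2.
apply: (@le_trans _ _ (nrm2 predT
    (fun j : {ffun 'I_m -> {ffun 'I_n -> J}} => \prod_k Y k (j k)) ^+ 2)).
  rewrite nrm2_sqr; apply: ler_sum => j _.
  rewrite lerXn2r ?nnegrE ?finnorm_ge0 ?prodr_ge0//.
  apply: bigmax_le => [|c _]; first exact: prodr_ge0.
  rewrite /Y (bigA_distr_bigA (fun k r => `|form_val (a k) (x k) (j k) r|))/=.
  apply: le_trans (ler_norm_sum _ _ _) _; apply: ler_sum => rho _.
  rewrite normrM normr_prod ler_piMr ?prodr_ge0//.
  exact: le_trans (le_finnorm _ _ (leey _)) (tau1 _).
rewrite lerXn2r ?nnegrE ?nrm2_ge0 ?exprn_ge0// nrm2_prod.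
rewrite -[in leRHS](card_ord m) -prodr_const; apply: ler_prod => k _.
by rewrite nrm2_ge0 Yn.
Qed.

(** The constant is uniform in the finite sets, so that the inequality survives
    the refinement of partitions and truncations. *)
Theorem finite_summing_admissible m n (p : \bar R) (u t : R) :
  (0 < n)%N -> (1 <= p)%E -> admissible n p u t ->
  exists2 K : R, 0 < K & forall (D S J C : finType)
    (a : 'I_m -> {ffun 'I_n -> D} -> S -> R)
    (x : 'I_m -> 'I_n -> J -> D -> R) (tau : {ffun 'I_m -> S} -> C -> R),
  (forall k, unit_form (a k)) ->
  (forall k i d, \sum_j `|x k i j d| `^ u <= 1) ->
  (forall rho, finnorm p (tau rho) <= 1) ->
  \sum_j finnorm p (comp_val a x tau j) `^ t <= K `^ t.
Proof.
move=> n0 p1 [ka [ka0 nka uE tE]].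
exists (2 ^+ (2 + m * n) * (2 * 9 ^+ n) ^+ m).
  by rewrite mulr_gt0 ?exprn_gt0// mulr_gt0// exprn_gt0.
move=> D S J C a x tau a1 x1 tau1.
case: (exponentP p1) tE tau1 => [[r r1 ->] [th [low [th0 th1 _ rE tE]]]|-> tE] tau1; last first.
  have x2 k i d : nrm2 predT (fun j => x k i j d) <= 1.
    rewrite nrm2_leP// expr1n; apply: le_trans (x1 k i d); apply: ler_sum => j _.
    have k1 : 0 < 1 + ka by rewrite ltr_pwDl.
    have u0 : 0 < u by rewrite uE divr_gt0.
    rewrite -(real_normK (num_real _)).
    have [->|xn] := eqVneq `|x k i j d| 0; first by rewrite expr0n powR_ge0.
    rewrite -powR_mulrn//; apply: ger_powR.
      rewrite lt_neqAle eq_sym xn normr_ge0/=; apply: (powR_le1 u0) => //.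
      apply: le_trans (x1 k i d); rewrite (bigD1 j)//= lerDl.
      by apply: sumr_ge0 => j' _; exact: powR_ge0.
    by rewrite uE ler_pdivrMr// ler_peMr// lerDl.
  rewrite tE; under eq_bigr do rewrite powR_mulrn ?finnorm_ge0//.
  apply: le_trans (finite_summing_infty a1 x2 tau1) _.
  have c9 : 0 <= (9 : R) ^+ n by exact: exprn_ge0.
  have c18 : 0 <= (2 : R) * 9 ^+ n by exact: mulr_ge0.
  have K1 : (9 ^+ n : R) ^+ m <= (2 * 9 ^+ n) ^+ m.
    by apply: lerXn2r => //; rewrite ler_peMl// ler1n.
  have K2 : (2 * 9 ^+ n : R) ^+ m <= 2 ^+ (2 + m * n) * (2 * 9 ^+ n) ^+ m.
    by rewrite ler_peMl ?exprn_ege1 ?ler1n//; exact: exprn_ge0.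
  have K3 := le_trans K1 K2; have K0 : 0 <= (9 ^+ n : R) ^+ m by exact: exprn_ge0.
  by rewrite powR_mulrn ?(le_trans K0 K3)//; apply: lerXn2r; rewrite ?nnegrE// (le_trans K0 K3).
have r0 : 0 < r by exact: lt_le_trans r1.
have tau1' rho : \sum_c `|tau rho c| `^ r <= 1.
  apply: (@powR_le1 _ _ r^-1); rewrite ?invr_gt0//; last exact: tau1.
  exact: powR_sum_ge0.
have := @finite_summing R m n D S J C a x tau ka th r low n0 a1 ka0 nka th0 th1 r1 rE.
rewrite -uE -tE => /(_ x1 tau1').
rewrite card_sum card_bool card_prod !card_ord.
apply: le_trans; apply: ler_sum => j _.
by rewrite /finnorm -powRrM mulrC.
Qed.

End FiniteNorm.

(** * Scalars and sequence spaces *)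

Section Scalars.
Context {R : realType} {b : base_field}.
Local Notation K := (scalars R b).

(** Real and imaginary parts, indexed by [false] and [true].  For real scalars
    the imaginary part is 0, so that both fields can be treated together. *)
Definition spart (s : bool) : K -> R :=
  match b return scalars R b -> R with
  | RealField => fun z => if s then 0 else z
  | ComplexField => cpart s
  end.

Definition sbasis (s : bool) : K :=
  match b return scalars R b with
  | RealField => if s then 0 else 1
  | ComplexField => cbasis s
  end.

Lemma spart_decomp (z : K) : \sum_s ofR b (spart s z) * sbasis s = z.
Proof.
rewrite /spart /sbasis; case: b z => z /=.
  by rewrite big_bool/= mul0r add0r mulr1.
by rewrite -[RHS]cpart_decomp; apply: eq_bigr => s _; rewrite mulrC.
Qed.

Lemma spartD s : {morph spart s : x y / x + y}.
Proof.
rewrite /spart; case: b => x y; first by case: s; rewrite // addr0.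
by case: s; rewrite /cpart ?raddfD.
Qed.

Lemma spart0 s : spart s 0 = 0.
Proof. by rewrite /spart; case: b => //; case: s. Qed.

Lemma spart_sum s (I : Type) (r : seq I) (F : I -> K) :
  spart s (\sum_(i <- r) F i) = \sum_(i <- r) spart s (F i).
Proof. exact: (big_morph _ (spartD s) (spart0 s)). Qed.

Lemma spart_ofRM s r z : spart s (ofR b r * z) = r * spart s z.
Proof.
rewrite /spart; case: b z => z; first by case: s; rewrite // mulr0.
by case: z => x y; case: s => /=; ring.
Qed.

Lemma norm_spart s z : `|spart s z| <= toR `|z|.
Proof.
rewrite -(@ofR_le _ b) toR_normK /spart; case: b z => z /=.
  by case: s; rewrite ?normr0.
exact: norm_cpart.
Qed.

Lemma norm_sbasis s : toR `|sbasis s| <= 1.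
Proof.
rewrite /sbasis; case: b; first by case: s; rewrite /= ?normr0 ?normr1.
by change (complex.Re `|cbasis s : R[i]| <= 1); rewrite norm_cbasis.
Qed.

Lemma toR_ofR_norm (r : R) : toR `|ofR b r| = `|r|.
Proof.
case: b => //.
by change (complex.Re `|r%:C%C| = `|r|); rewrite norm_real.
Qed.

Lemma toR_norm_parts z : toR `|z| <= `|spart true z| + `|spart false z|.
Proof.
rewrite -{1}(spart_decomp z) big_bool/=.
apply: le_trans (ler_toR_normD _ _) _.
by rewrite !toR_normM !toR_ofR_norm lerD// ler_piMr// norm_sbasis.
Qed.

End Scalars.

Section Normed.
Context {R : realType} {b : base_field}.
Local Notation K := (scalars R b).
Variable E : normedModType K.
Implicit Types x y : E.

Definition rnorm x : R := toR `|x|.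

Lemma ofR_rnorm x : ofR b (rnorm x) = `|x|.
Proof.
rewrite /rnorm; have := normr_ge0 x; move: `|x| => /=; case: b => //= z.
by case: z => u v; rewrite lecE/= => /andP[/eqP ->].
Qed.

Lemma rnorm_ge0 x : 0 <= rnorm x.
Proof. by rewrite -(@ofR_le _ b) ofR_rnorm ofR0. Qed.

Lemma rnormD x y : rnorm (x + y) <= rnorm x + rnorm y.
Proof. by rewrite -(@ofR_le _ b) ofRD !ofR_rnorm ler_normD. Qed.

Lemma rnormZ (k : K) x : rnorm (k *: x) = toR `|k| * rnorm x.
Proof.
rewrite -[LHS](@ofRK _ b) -[RHS](@ofRK _ b); congr toR.
by rewrite ofRM !ofR_rnorm toR_normK normrZ.
Qed.

Lemma rnorm0 : rnorm 0 = 0.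
Proof. by rewrite /rnorm normr0 -(@ofR0 R b) ofRK. Qed.

Lemma rnormB x y : rnorm (x - y) = rnorm (y - x).
Proof. by rewrite /rnorm distrC. Qed.

Lemma rnorm_sum (I : Type) (r : seq I) (F : I -> E) :
  rnorm (\sum_(i <- r) F i) <= \sum_(i <- r) rnorm (F i).
Proof.
elim: r => [|i r IH]; first by rewrite !big_nil rnorm0.
by rewrite !big_cons (le_trans (rnormD _ _))// lerD2l.
Qed.

End Normed.

Section EllLemmas.
Context {R : realType} {b : base_field}.
Local Notation K := (scalars R b).
Variables (p : \bar R) (p1 : (1 <= p)%E).
Local Notation lp := (ell b p1).
Implicit Types z : lp.

Lemma ellD z z' c : (z + z')%R c = z c + z' c.
Proof. by []. Qed.

Lemma ellZ (k : K) z c : (k *: z)%R c = k * z c.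
Proof. by []. Qed.

Lemma ellB z z' c : (z - z')%R c = z c - z' c.
Proof. by []. Qed.

Lemma ell_sumE (I : Type) (r : seq I) (F : I -> lp) c :
  (\sum_(i <- r) F i)%R c = \sum_(i <- r) F i c.
Proof. by elim: r => [|i r IH]; rewrite ?big_nil// !big_cons ellD IH. Qed.

End EllLemmas.

Section Truncation.
Context {R : realType} {b : base_field}.
Local Notation K := (scalars R b).
Variables (p : \bar R) (p1 : (1 <= p)%E).
Local Notation lp := (ell b p1).

Definition tnorm (M : nat) (f : nat -> K) : R :=
  finnorm p (fun c : 'I_M => toR `|f c|).

Lemma norm_toR (z : K) : `|toR `|z| | = toR `|z|.
Proof. by rewrite ger0_norm// toR_norm_ge0. Qed.

(** The norm of [l_p] is the supremum of the norms of the truncations: this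
    characterization treats finite exponents and [+oo] together, and it is the
    form in which the norm enters the approximation arguments. *)
Lemma tnorm_homo (f : nat -> K) M M' : (M <= M')%N -> tnorm M f <= tnorm M' f.
Proof.
move=> MM'; rewrite /tnorm; have [[r r1 pr]|po] := exponentP p1; last first.
  rewrite po; apply: bigmax_le => [|c _]; first exact: bigmax_ge_id.
  exact: (le_bigmax _ (fun c : 'I_M' => `|toR `|f c| |) (widen_ord MM' c)).
rewrite pr /finnorm; apply: powR_le; rewrite ?powR_sum_ge0//.
  by rewrite invr_ge0 (le_trans _ r1).
rewrite -(big_mkord xpredT (fun c => `|toR `|f c| | `^ r)).
rewrite -(big_mkord xpredT (fun c => `|toR `|f c| | `^ r)).
rewrite (@big_cat_nat _ _ _ M 0 M')//= lerDl.
by apply: sumr_ge0 => c _; exact: powR_ge0.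
Qed.

Lemma ell_norm_le (f : nat -> K) B : 0 <= B -> (forall M, tnorm M f <= B) ->
  (ell_norm p f <= B%:E)%E.
Proof.
move=> B0 fB; have [[r r1 pr]|po] := exponentP p1; last first.
  rewrite po ell_norm_inftyE; apply: ge_ereal_sup => _ [k _ <-]; rewrite lee_fin.
  apply: le_trans (fB k.+1); rewrite /tnorm -[leLHS]norm_toR.
  exact: (le_finnorm (fun c : 'I_k.+1 => toR `|f c|) ord_max).
have r0 : 0 < r by exact: lt_le_trans r1.
rewrite pr ell_norm_finE//.
have -> : B%:E = (((B `^ r)%:E) `^ r^-1)%E.
  by rewrite poweR_EFin -powRrM divff ?gt_eqF// powRr1.
have fn0 k : (0 <= ((toR `|f k|) `^ r)%:E)%E by rewrite lee_fin powR_ge0.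
apply: gt0_ler_poweR; rewrite ?invr_ge0 ?(ltW r0)// ?in_itv/= ?leey ?andbT.
- by apply: nneseries_ge0 => k _ _; exact: fn0.
- by rewrite lee_fin powR_ge0.
apply: lime_le; first by apply: is_cvg_nneseries => k _ _; exact: fn0.
apply: nearW => M; rewrite sumEFin lee_fin.
have := fB M; rewrite /tnorm pr /finnorm => h.
have -> : \sum_(0 <= k < M) toR `|f k| `^ r = \sum_(c < M) `|toR `|f c| | `^ r.
  by rewrite big_mkord; apply: eq_bigr => c _; rewrite norm_toR.
rewrite -[leLHS]powRr1 ?powR_sum_ge0// -(mulVf (lt0r_neq0 r0)) powRrM.
by apply: powR_le; rewrite ?(ltW r0) ?powR_ge0.
Qed.

Lemma rnorm_ell_norm (z : lp) : (rnorm z)%:E = ell_norm p z.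
Proof. exact: toR_ell_norm. Qed.

Lemma rnorm_le (z : lp) B : 0 <= B -> (forall M, tnorm M z <= B) -> rnorm z <= B.
Proof. by move=> B0 zB; rewrite -lee_fin rnorm_ell_norm ell_norm_le. Qed.

Lemma tnorm_le_ell_norm (f : nat -> K) B M : 0 <= B -> ell_norm p f = B%:E ->
  tnorm M f <= B.
Proof.
move=> B0 fB; have [[r r1 pr]|po] := exponentP p1; last first.
  move: fB; rewrite /tnorm po => fB; apply: bigmax_le => // c _.
  rewrite norm_toR -lee_fin -fB ell_norm_inftyE.
  by apply: ereal_sup_ubound; exists (c : nat).
have r0 : 0 < r by exact: lt_le_trans r1.
rewrite /tnorm -lee_fin -fB pr ell_norm_finE// /finnorm -poweR_EFin.
have fn0 k : (0 <= ((toR `|f k|) `^ r)%:E)%E by rewrite lee_fin powR_ge0.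
apply: gt0_ler_poweR; rewrite ?invr_ge0 ?(ltW r0)// ?in_itv/= ?leey ?andbT.
- by rewrite lee_fin powR_sum_ge0.
- by apply: nneseries_ge0 => k _ _; exact: fn0.
rewrite -sumEFin -(big_mkord xpredT (fun c => (`|toR `|f c| | `^ r)%:E)).
under eq_bigr do rewrite norm_toR.
by apply: nneseries_lim_ge => k _ _; exact: fn0.
Qed.

Lemma tnorm_le (z : lp) M : tnorm M z <= rnorm z.
Proof.
by apply: tnorm_le_ell_norm; [exact: rnorm_ge0|rewrite rnorm_ell_norm].
Qed.

Lemma tnorm_approx (z : lp) e : 0 < e -> exists M0, forall M, (M0 <= M)%N ->
  rnorm z <= tnorm M z + e.
Proof.
move=> e0; suff [M0 M0P] : exists M0, rnorm z <= tnorm M0 z + e.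
  by exists M0 => M MM; apply: le_trans M0P _; rewrite lerD2r tnorm_homo.
apply: contrapT => /forallNP h.
have le M : tnorm M z <= rnorm z - e.
  by have /negP := h M; rewrite -ltNge => /ltW; rewrite lerBrDr.
have := rnorm_le (le_trans (finnorm_ge0 _ _) (le 0%N)) le.
by rewrite lerBrDr gerDl leNgt e0.
Qed.

Lemma coord_le (z : lp) c : toR `|z c| <= rnorm z.
Proof.
apply: le_trans (tnorm_le z c.+1); rewrite /tnorm -[leLHS]norm_toR.
exact: (le_finnorm (fun i : 'I_c.+1 => toR `|z i|) ord_max).
Qed.

End Truncation.

Arguments tnorm {R b} p M f.

Section DeltaVectors.
Context {R : realType} {b : base_field}.
Local Notation K := (scalars R b).
Local Notation l1 := (ell1 R b).
Local Notation loo := (ell_infty R b).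

Lemma tnorm1E (f : nat -> K) M : tnorm 1%E M f = \sum_(c < M) toR `|f c|.
Proof.
rewrite /tnorm /finnorm invr1 powRr1 ?powR_sum_ge0//.
by apply: eq_bigr => c _; rewrite norm_toR powRr1// toR_norm_ge0.
Qed.

Lemma ell1_delta_mem (r : nat) : (fun k => (k == r)%:R : K) \in ell_mem (1%E : \bar R).
Proof.
rewrite inE/=; apply: (@le_lt_trans _ _ 1%:E); last exact: ltry.
apply: ell_norm_le => // M; rewrite tnorm1E.
rewrite -(big_mkord xpredT (fun c => toR `|(c == r)%:R : K|)).
have [rM|rM] := ltnP r M.
  rewrite (bigD1_seq r) ?mem_index_iota ?iota_uniq//= eqxx normr1 big1 ?addr0.
    by case: b.
  by move=> k /negPf ->; rewrite toR_norm0.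
rewrite big_nat big1// => k /andP[_ kM].
by rewrite ltn_eqF ?toR_norm0// (leq_trans kM).
Qed.

Definition delta1 (r : nat) : l1 := Ell (lexx _) (ell1_delta_mem r).

Lemma rnorm_delta1 r : rnorm (delta1 r) <= 1.
Proof.
apply: rnorm_le => // M; rewrite tnorm1E/=.
rewrite -(big_mkord xpredT (fun c => toR `|(c == r)%:R : K|)).
have [rM|rM] := ltnP r M.
  rewrite (bigD1_seq r) ?mem_index_iota ?iota_uniq//= eqxx normr1 big1 ?addr0.
    by case: b.
  by move=> k /negPf ->; rewrite toR_norm0.
rewrite big_nat big1// => k /andP[_ kM].
by rewrite ltn_eqF ?toR_norm0// (leq_trans kM).
Qed.

Definition truncl1 (M : nat) (y : l1) : l1 := \sum_(r < M) y r *: delta1 r.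

Lemma truncl1E M y c : truncl1 M y c = if (c < M)%N then y c else 0.
Proof.
rewrite /truncl1 ell_sumE; under eq_bigr do rewrite ellZ /=.
case: ltnP => cM.
  rewrite (bigD1 (Ordinal cM))//= eqxx mulr1 big1 ?addr0// => i.
  by rewrite -val_eqE/= eq_sym => /negPf ->; rewrite mulr0.
by rewrite big1// => i _; rewrite gtn_eqF ?mulr0// (leq_trans _ cM).
Qed.

Lemma truncl1_approx y e : 0 < e -> exists M0, forall M, (M0 <= M)%N ->
  rnorm (truncl1 M y - y) <= e.
Proof.
move=> e0; have [M0 M0P] := @tnorm_approx R b _ (lexx _) y e e0.
exists M0 => M MM; apply: rnorm_le => [|M']; first exact: ltW.
have [M'M|/ltnW MM'] := leqP M' M.
  rewrite tnorm1E big1 ?(ltW e0)// => c _.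
  by rewrite ellB truncl1E (leq_trans (ltn_ord c) M'M) subrr toR_norm0.
have := M0P M MM; rewrite -lerBlDl; apply: le_trans.
rewrite lerBrDr; apply: le_trans (tnorm_le y M').
rewrite !tnorm1E -(big_mkord xpredT (fun c => toR `|truncl1 M y c - y c|)).
rewrite -(big_mkord xpredT (fun c => toR `|y c|)).
rewrite -(big_mkord xpredT (fun c => toR `|y c|)).
rewrite (@big_cat_nat _ _ _ M 0 M')//= [leRHS](@big_cat_nat _ _ _ M 0 M')//=.
rewrite big_nat big1 => [|c /andP[_ cM]]; last first.
  by rewrite truncl1E cM subrr toR_norm0.
rewrite add0r addrC lerD2r big_nat [leRHS]big_nat; apply: ler_sum => c /andP[Mc _].
by rewrite truncl1E ltnNge Mc sub0r normrN.
Qed.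

Lemma ell_infty_mem (f : nat -> K) (B : R) : (forall k, toR `|f k| <= B) ->
  f \in ell_mem (+oo%E : \bar R).
Proof.
move=> fB; rewrite inE/=; apply: (@le_lt_trans _ _ B%:E); last exact: ltry.
have B0 : 0 <= B by exact: le_trans (toR_norm_ge0 _) (fB 0%N).
by apply: (ell_norm_le (leey _)) => // M; apply: bigmax_le => // c _; rewrite norm_toR.
Qed.

Definition bounded_seq (f : nat -> K) (B : R) (fB : forall k, toR `|f k| <= B) : loo :=
  Ell (leey _) (ell_infty_mem fB).

Lemma rnorm_infty_le (z : loo) B : 0 <= B -> (forall k, toR `|z k| <= B) -> rnorm z <= B.
Proof.
move=> B0 zB; apply: rnorm_le => // M.
by apply: bigmax_le => // c _; rewrite norm_toR.
Qed.

End DeltaVectors.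

(** * Multilinear maps *)

Section Multilinear.
Context {R : realType} {b : base_field}.
Local Notation K := (scalars R b).

(** The algebraic part of [bounded_multilinear]; it is needed for maps, such as
    the partial maps of a multilinear map, for which no bound is at hand. *)
Definition multilinear (N : nat) (E F : lmodType K) (S : ('I_N -> E) -> F) : Prop :=
  forall (i : 'I_N) (x : 'I_N -> E) (a : K) (y z : E),
    S [eta x with i |-> a *: y + z] =
    a *: S [eta x with i |-> y] + S [eta x with i |-> z].

Lemma multilinear_sum N (E F : lmodType K) (S : ('I_N -> E) -> F) (V : finType)
    (x : 'I_N -> E) i (c : V -> K) (e : V -> E) : multilinear S ->
  S [eta x with i |-> \sum_v c v *: e v] = \sum_v c v *: S [eta x with i |-> e v].
Proof.
move=> Sl; have S0 : S [eta x with i |-> 0] = 0.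
  have := Sl i x 1 0 0; rewrite scaler0 addr0 scale1r => /eqP.
  by rewrite -subr_eq0 opprD addNKr oppr_eq0 => /eqP.
elim: (index_enum V) => [|v r IH]; first by rewrite !big_nil.
by rewrite !big_cons Sl IH.
Qed.

(** Induction on the number of arguments, the first one being expanded. *)
Lemma multilinear_expand N (E F : lmodType K) (S : ('I_N -> E) -> F) (V : finType)
    (c : 'I_N -> V -> K) (e : 'I_N -> V -> E) : multilinear S ->
  S (fun k => \sum_v c k v *: e k v) =
  \sum_(f : {ffun 'I_N -> V}) (\prod_k c k (f k)) *: S (fun k => e k (f k)).
Proof.
elim: N => [|N IH] in S c e * => Sl.
  pose f0 : {ffun 'I_0 -> V} := [ffun i : 'I_0 => False_rect V (notF (ltn_ord i))].
  rewrite (big_pred1 f0) => [|f]; last by apply/esym/eqP; apply/ffunP => -[].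
  by rewrite big_ord0 scale1r; congr S; apply/funext => -[].
pose S' w (x : 'I_N -> E) := S (ins ord0 w x).
have insE w (x : 'I_N -> E) w' : ins ord0 w x = [eta ins ord0 w' x with ord0 |-> w].
  by apply/funext => k /=; case: (unliftP ord0 k) => [j|] ->; rewrite ?eqxx ?ins_eq ?ins_lift.
have S'l w : multilinear (S' w).
  move=> i x a y z; rewrite /S'.
  have insu (u : E) : ins ord0 w [eta x with i |-> u] =
      [eta ins ord0 w x with lift ord0 i |-> u].
    apply/funext => k /=; case: (unliftP ord0 k) => [j|] ->.
      by rewrite !ins_lift /= (inj_eq lift_inj).
    by rewrite !ins_eq.
  by rewrite !insu Sl.
have -> : (fun k => \sum_v c k v *: e k v) =
    [eta ins ord0 0 (fun k => \sum_v c (lift ord0 k) v *: e (lift ord0 k) v) with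
      ord0 |-> \sum_v c ord0 v *: e ord0 v].
  by apply/funext => k /=; case: (unliftP ord0 k) => [j|] ->; rewrite ?ins_eq ?ins_lift.
rewrite multilinear_sum// (sum_finins ord0); apply: eq_bigr => v _.
rewrite -insE -/(S' (e ord0 v) _) IH// scaler_sumr; apply: eq_bigr => f _.
rewrite scalerA big_ord_recl finins_eq; congr (_ * _ *: S _).
  by apply: eq_bigr => k _; rewrite finins_lift.
by apply/funext => k; case: (unliftP ord0 k) => [j|] ->; rewrite ?ins_eq ?ins_lift ?finins_eq ?finins_lift.
Qed.

Lemma bounded_multilinear_bound N (E F : normedModType K) (S : ('I_N -> E) -> F) :
  bounded_multilinear S ->
  exists2 C : R, 0 < C & forall x, rnorm (S x) <= C * \prod_i rnorm (x i).
Proof.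
move=> [_ [C CP]]; exists (`|C| + 1); first by rewrite ltr_wpDl.
move=> x; apply: le_trans (CP x) _; apply: ler_wpM2r.
  by apply: prodr_ge0 => i _; exact: rnorm_ge0.
by rewrite (le_trans (ler_norm C))// lerDl.
Qed.

(** Telescoping: the arguments [x] are replaced by [x'] one at a time, and each
    replacement changes one argument by at most [d]. *)
Lemma bounded_multilinear_continuous N (E F : normedModType K) (S : ('I_N -> E) -> F) x e :
  bounded_multilinear S -> 0 < e ->
  exists2 d, 0 < d & forall x', (forall k, rnorm (x' k - x k) <= d) ->
    rnorm (S x' - S x) <= e.
Proof.
move=> Sb e0; have [C C0 CP] := bounded_multilinear_bound Sb.
have Sl := Sb.1.
pose B := \prod_k (rnorm (x k) + 1).
have x1 k : 1 <= rnorm (x k) + 1 by rewrite lerDr rnorm_ge0.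
have B0 : 0 < B by apply: prodr_gt0 => k _; exact: lt_le_trans (x1 k).
have CB : 0 < N.+1%:R * (C * B) by rewrite mulr_gt0// mulr_gt0.
pose d := Num.min 1 (e / (N.+1%:R * (C * B))).
have d0 : 0 < d by rewrite lt_min ltr01 divr_gt0.
exists d => // x' xx'.
have d1 : d <= 1 by rewrite ge_min lexx.
pose hyb (l : nat) (k : 'I_N) := if (k < l)%N then x' k else x k.
have key l : (l <= N)%N -> rnorm (S (hyb l) - S x) <= l%:R * (C * B * d).
  elim: l => [_|l IH lN].
    have -> : hyb 0%N = x by apply/funext.
    by rewrite subrr rnorm0 mul0r.
  pose i := Ordinal lN.
  have e1 : hyb l.+1 = [eta hyb l with i |-> 1 *: (x' i - x i) + x i].
    apply/funext => k /=; rewrite /hyb ltnS leq_eqVlt -val_eqE/= scale1r subrK.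
    by case: eqP => //= kl; congr x'; apply: val_inj.
  have e2 : hyb l = [eta hyb l with i |-> x i].
    apply/funext => k /=; rewrite /hyb -val_eqE/=.
    by case: eqP => //= kl; rewrite kl ltnn; congr x; apply: val_inj.
  rewrite e1 Sl -e2 scale1r -addrA; apply: le_trans (rnormD _ _) _.
  rewrite -natr1 mulrDl mul1r [leLHS]addrC; apply: lerD; first exact: IH (ltnW lN).
  apply: le_trans (CP _) _; rewrite -mulrA; apply: ler_wpM2l; first exact: ltW.
  rewrite (bigD1 i)//= eqxx mulrC; apply: ler_pM; rewrite ?rnorm_ge0//.
    by apply: prodr_ge0 => k _; exact: rnorm_ge0.
  rewrite /B [leRHS](bigD1 i)//=; apply: (@le_trans _ _ (\prod_(k | k != i) (rnorm (x k) + 1))).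
    apply: ler_prod => k /negPf ki; rewrite ki rnorm_ge0/= /hyb.
    case: ifP => _; last by rewrite lerDl.
    rewrite -[x' k](subrK (x k)) addrC; apply: le_trans (rnormD _ _) _.
    by rewrite lerD2l (le_trans (xx' k)).
  rewrite ler_peMl//; apply: prodr_ge0 => k _.
  by rewrite addr_ge0// rnorm_ge0.
have -> : x' = hyb N by apply/funext => k; rewrite /hyb ltn_ord.
apply: le_trans (key N (leqnn N)) _.
apply: (@le_trans _ _ (N.+1%:R * (C * B) * d)).
  rewrite mulrA ler_wpM2r ?(ltW d0)// ler_wpM2r ?ler_nat//.
  by rewrite ltW// mulr_gt0.
by rewrite mulrC -ler_pdivlMr// ge_min lexx orbT.
Qed.

End Multilinear.

(** * Approximation *)

Section Approximation.
Context {R : realType}.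

(** The atoms are the sets on which the values of all the functions, rounded to
    multiples of [e], are constant.  Each atom [d] has a representative [rp d],
    so that the values of the discretized functions are values of the original
    ones and inherit their bounds. *)
Lemma finite_partition (O : finType) (h : O -> nat -> R) (e : R) : 0 < e ->
  (forall o tau, `|h o tau| <= 1) ->
  exists (D : finType) (pi : nat -> D) (rp : D -> nat),
    forall o tau, `|h o (rp (pi tau)) - h o tau| <= e.
Proof.
move=> e0 h1.
pose q o tau := Num.truncn ((h o tau + 1) / e).
pose B := Num.truncn (2 / e).
have hq o tau : 0 <= (h o tau + 1) / e.
  by rewrite divr_ge0 ?(ltW e0)//; have := h1 o tau; rewrite ler_norml => /andP[]; lra.
have qB o tau : (q o tau < B.+1)%N.
  rewrite ltnS /q /B le_truncn// ler_wpM2r ?invr_ge0 ?(ltW e0)//.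
  by have := h1 o tau; rewrite ler_norml => /andP[]; lra.
pose pi tau : {ffun O -> 'I_B.+1} := [ffun o => Ordinal (qB o tau)].
exists {ffun O -> 'I_B.+1}, pi, (fun d => xget 0%N [set tau | pi tau = d]).
move=> o tau; set tau' := xget _ _.
have : pi tau' = pi tau by rewrite /tau'; apply: (@xgetPex _ 0%N [set t | pi t = pi tau]); exists tau.
move=> /ffunP/(_ o); rewrite !ffunE => -[qq].
have /andP[l1 u1] := truncn_itv (hq o tau).
have /andP[l2 u2] := truncn_itv (hq o tau').
rewrite -/(q _ _) qq in l2 u2; rewrite -/(q _ _) in l1 u1.
move: l1 u1 l2 u2; rewrite -natr1 ler_pdivlMr// ltr_pdivrMr// ler_pdivlMr// ltr_pdivrMr//.
rewrite mulrDl mul1r; set Q := _ * e => *.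
by rewrite ler_norml; apply/andP; split; lra.
Qed.

Lemma powR_1Bn (e t : R) (k : nat) : 0 <= e -> e < 1 -> t <= k%:R ->
  1 - k%:R * e <= (1 - e) `^ t.
Proof.
move=> e0 e1 tk; have e1' : 0 < 1 - e by rewrite subr_gt0.
apply: (@le_trans _ _ ((1 - e) ^+ k)).
  elim: k {tk} => [|k IH]; first by rewrite mul0r subr0 expr0.
  rewrite exprS; apply: (@le_trans _ _ ((1 - e) * (1 - k%:R * e))).
    rewrite -natr1 -subr_ge0 [X in 0 <= X](_ : _ = k%:R * e ^+ 2); last by ring.
    by rewrite mulr_ge0// sqr_ge0.
  by rewrite ler_wpM2l// ltW.
rewrite -powR_mulrn ?(ltW e1')//; apply: ger_powR => //.
by rewrite e1'/= gerBl.
Qed.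

(** Finite sums of powers are continuous.  The additive errors are turned into
    relative errors, the entries that vanish being harmless, so that the
    homogeneity of the powers applies for any real exponent. *)
Lemma sum_powR_closed (X : finType) (a : X -> R) (t B : R) :
  (forall x, 0 <= a x) -> 0 < t ->
  (forall e, 0 < e -> exists b : X -> R,
     [/\ forall x, 0 <= b x, forall x, a x <= b x + e & \sum_x b x `^ t <= B]) ->
  \sum_x a x `^ t <= B.
Proof.
move=> a0 t0 approx.
have B0 : 0 <= B.
  by have [b [_ _ h]] := approx 1 ltr01; apply: le_trans h; apply: sumr_ge0 => x _; exact: powR_ge0.
set s := \sum_x _; have s0 : 0 <= s by apply: sumr_ge0 => x _; exact: powR_ge0.
pose k := (Num.truncn t).+1; have tk : t <= k%:R by exact/ltW/truncnS_gt.
(* [c] is a lower bound of the nonzero entries, so that the additive errors of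
   size [c * e] are relative errors of size [e]. *)
pose c := \big[Num.min/1]_(x | 0 < a x) a x.
have c0 : 0 < c by apply/bigmin_gtP.
have ca x : 0 < a x -> c <= a x by move=> ax; exact: bigmin_le_cond.
have main e : 0 < e -> e < 1 -> s * (1 - k%:R * e) <= B.
  move=> e0 e1; have [b [b0 ab bB]] := approx (c * e) (mulr_gt0 c0 e0).
  apply: le_trans bB.
  apply: (@le_trans _ _ (s * (1 - e) `^ t)).
    by apply: ler_wpM2l => //; apply: powR_1Bn => //; exact: ltW.
  rewrite mulr_suml; apply: ler_sum => x _.
  have e1' : 0 <= 1 - e by rewrite subr_ge0 ltW.
  rewrite -powRM//; apply: ge0_ler_powR; rewrite ?nnegrE ?mulr_ge0 ?(ltW t0)//.
  have [->|ax] := eqVneq (a x) 0; first by rewrite mul0r.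
  have ap : 0 < a x by rewrite lt_neqAle eq_sym ax a0.
  have := ab x; have : c * e <= a x * e by rewrite ler_wpM2r ?ca// ltW.
  by rewrite mulrBr mulr1; lra.
rewrite leNgt; apply/negP => Bs.
have sp : 0 < s by exact: le_lt_trans Bs.
have kp : 0 < k%:R :> R by rewrite ltr0n.
pose e := (s - B) / (2 * k%:R * s).
have den : 0 < 2 * k%:R * s by rewrite mulr_gt0// mulr_gt0.
have e0 : 0 < e by rewrite divr_gt0// subr_gt0.
have k1 : 1 <= k%:R :> R by rewrite ler1n.
have e1 : e < 1.
  rewrite ltr_pdivrMr// mul1r.
  by have : 1 * s <= k%:R * s by [rewrite ler_wpM2r]; lra.
have := main e e0 e1; have -> : s * (1 - k%:R * e) = s - (s - B) / 2.
  by rewrite /e; field; rewrite !gt_eqF.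
by lra.
Qed.

End Approximation.

(** * Discretization *)

Lemma exists2_choice (X Y : Type) (P Q : X -> Y -> Prop) :
  (forall x, exists2 y, P x y & Q x y) ->
  exists2 f : X -> Y, forall x, P x (f x) & forall x, Q x (f x).
Proof.
move=> PQ; have /choice[f fP] : forall x, exists y, P x y /\ Q x y.
  by move=> x; have [y] := PQ x; exists y.
by exists f => x; have [] := fP x.
Qed.

Section Discretization.
Context {R : realType} {b : base_field}.
Local Notation K := (scalars R b).
Local Notation l1 := (ell1 R b).
Local Notation loo := (ell_infty R b).

Lemma ofR_prod (I : finType) (F : I -> R) : \prod_i ofR b (F i) = ofR b (\prod_i F i).
Proof.
elim/big_rec2: _ => [|i x y _ ->]; last by rewrite ofRM.
by case: b.
Qed.

Lemma fin_min (X : finType) (P : X -> R -> Prop) :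
  (forall x, exists2 d, 0 < d & P x d) ->
  (forall x d d', d' <= d -> P x d -> P x d') ->
  exists2 d, 0 < d & forall x, P x d.
Proof.
move=> /exists2_choice [d d0 dP] Pm; exists (\big[Num.min/1]_x d x).
  by apply/bigmin_gtP; split.
by move=> x; apply: Pm (dP x); exact: bigmin_le.
Qed.

Lemma fin_max (X : finType) (P : X -> nat -> Prop) :
  (forall x, exists M0, forall M, (M0 <= M)%N -> P x M) -> exists M, forall x, P x M.
Proof.
move=> /choice[M0 M0P]; exists (\max_x M0 x)%N => x; apply: M0P.
exact: leq_bigmax.
Qed.

Section Partition.
Variables (D : finType) (pi : nat -> D).

Lemma ofR_norm_le (r : R) : `|r| <= 1 -> toR `|ofR b r| <= 1.
Proof. by rewrite toR_ofR_norm. Qed.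

Definition simple_fun (f : D -> R) (f1 : forall d, `|f d| <= 1) : loo :=
  bounded_seq (fun tau => ofR_norm_le (f1 (pi tau))).

Lemma norm_ind (d d' : D) : `|(d' == d)%:R : R| <= 1.
Proof. by case: eqP; rewrite ?normr1 ?normr0. Qed.

Definition ind (d : D) : loo := simple_fun (norm_ind d).

Lemma simple_funE (f : D -> R) (f1 : forall d, `|f d| <= 1) :
  simple_fun f1 = \sum_d ofR b (f d) *: ind d.
Proof.
apply: val_inj; apply/funext => tau.
have e d : (ofR b (f d) *: ind d) tau = ofR b (f d * (pi tau == d)%:R).
  by rewrite ellZ ofRM.
change (ofR b (f (pi tau)) = (\sum_d ofR b (f d) *: ind d) tau).
rewrite ell_sumE; under eq_bigr do rewrite e.
rewrite (bigD1 (pi tau))//= eqxx mulr1 big1 ?addr0// => d.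
by rewrite eq_sym => /negPf ->; rewrite mulr0 ofR0.
Qed.

Lemma rnorm_simple_fun (f : D -> R) (f1 : forall d, `|f d| <= 1) : rnorm (simple_fun f1) <= 1.
Proof. by apply: rnorm_infty_le => // k; exact: ofR_norm_le. Qed.

(** Expansion of the simple functions in the indicators of the atoms.  The
    factor [2] in the normalization pays for the separation of the real and
    imaginary parts of the coordinates in [l_1]. *)
Lemma tensor_form n (A : ('I_n -> loo) -> l1) (C : R) (M : nat) :
  multilinear A -> 0 < C -> (forall x, rnorm (A x) <= C * \prod_i rnorm (x i)) ->
  exists2 a : {ffun 'I_n -> D} -> 'I_M * bool -> R, unit_form a &
    forall (J : finType) (x : 'I_n -> J -> D -> R) (x1 : forall i j d, `|x i j d| <= 1)
      (j : {ffun 'I_n -> J}) (r : 'I_M) (s : bool),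
      spart s (A (fun i => simple_fun (x1 i (j i))) r) = 2 * C * form_val a x j (r, s).
Proof.
move=> Al C0 AC.
have C2 : 0 < 2 * C by rewrite mulr_gt0.
pose a (t : {ffun 'I_n -> D}) (rs : 'I_M * bool) : R :=
  (2 * C)^-1 * spart rs.2 (A (fun i => ind (t i)) rs.1).
have aE (f : 'I_n -> D -> R) (f1 : forall i d, `|f i d| <= 1) r s :
    \sum_t a t (r, s) * \prod_i f i (t i) =
    (2 * C)^-1 * spart s (A (fun i => simple_fun (f1 i)) r).
  have -> : (fun i => simple_fun (f1 i)) = (fun i => \sum_d ofR b (f i d) *: ind d).
    by apply/funext => i; exact: simple_funE.
  rewrite multilinear_expand// ell_sumE spart_sum mulr_sumr; apply: eq_bigr => t _.
  by rewrite ellZ ofR_prod spart_ofRM /a /=; ring.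
exists a.
  move=> psi psi1; rewrite sum_pair_bool; under eq_bigr do rewrite !(aE psi psi1).
  set y := A _.
  apply: (@le_trans _ _ (\sum_(r < M) C^-1 * toR `|y r|)).
    apply: ler_sum => r _; rewrite !normrM -mulrDr gtr0_norm ?invr_gt0//.
    rewrite invfM mulrAC mulrC ler_wpM2l ?invr_ge0 ?(ltW C0)//.
    rewrite mulrC ler_pdivrMr// mulrDr mulr1.
    by apply: lerD; exact: norm_spart.
  rewrite -mulr_sumr -tnorm1E ler_pdivrMl// mulr1.
  apply: le_trans (tnorm_le _ _) _; apply: le_trans (AC _) _.
  rewrite ler_piMr ?(ltW C0)//; apply: prodr_ile1 => i _.
  by rewrite rnorm_ge0 rnorm_simple_fun.
move=> J x x1 j r s; rewrite /form_val (aE (fun i => x i (j i)) (fun i => x1 i (j i))).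
by rewrite mulrA divff ?mul1r ?gt_eqF.
Qed.

End Partition.

Lemma truncl1_parts M (y : l1) : truncl1 M y =
  \sum_(rs : 'I_M * bool) ofR b (spart rs.2 (y rs.1)) *: (sbasis rs.2 *: delta1 rs.1).
Proof.
rewrite /truncl1 -(pair_bigA _ (fun (r : 'I_M) s =>
  ofR b (spart s (y r)) *: (sbasis s *: delta1 r)))/=.
apply: eq_bigr => r _; rewrite -{1}(spart_decomp (y r)) scaler_suml.
by apply: eq_bigr => s _; rewrite scalerA.
Qed.

(** Expansion of the truncated arguments in the vectors [delta1 r] and their
    multiples by the imaginary unit, so that the coefficients are real. *)
Lemma tensor_op m (p : \bar R) (p1 : (1 <= p)%E) (T : ('I_m -> l1) -> ell b p1) (C : R)
    (M Mc : nat) :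
  multilinear T -> 0 < C -> (forall y, rnorm (T y) <= C * \prod_k rnorm (y k)) ->
  exists2 tau : {ffun 'I_m -> 'I_M * bool} -> 'I_Mc * bool -> R,
    forall rho, finnorm p (tau rho) <= 1 &
    forall (y : 'I_m -> l1) (c : 'I_Mc) (s : bool),
      spart s (T (fun k => truncl1 M (y k)) c) = 2 * C *
        \sum_(rho : {ffun 'I_m -> 'I_M * bool})
          (\prod_k spart (rho k).2 (y k (rho k).1)) * tau rho (c, s).
Proof.
move=> Tl C0 TC; have C2 : 0 < 2 * C by rewrite mulr_gt0.
pose e (rs : 'I_M * bool) : l1 := sbasis rs.2 *: delta1 rs.1.
pose tau (rho : {ffun 'I_m -> 'I_M * bool}) (cs : 'I_Mc * bool) : R :=
  (2 * C)^-1 * spart cs.2 (T (fun k => e (rho k)) cs.1).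
exists tau.
  move=> rho; rewrite finnormZ// ger0_norm ?invr_ge0 ?(ltW C2)//.
  rewrite ler_pdivrMl// mulr1.
  apply: le_trans (finnorm_pair_le (f := fun c : 'I_Mc => toR `|T (fun k => e (rho k)) c|) p1 _) _.
    by move=> c s; rewrite norm_toR; exact: norm_spart.
  rewrite ler_wpM2l//; apply: le_trans (tnorm_le _ _) _; apply: le_trans (TC _) _.
  rewrite ler_piMr ?(ltW C0)//; apply: prodr_ile1 => k _; rewrite rnorm_ge0/= rnormZ.
  by rewrite mulr_ile1 ?toR_norm_ge0 ?rnorm_ge0 ?norm_sbasis ?rnorm_delta1.
move=> y c s.
have -> : (fun k => truncl1 M (y k)) = (fun k => \sum_(rs : 'I_M * bool) ofR b (spart rs.2 (y k rs.1)) *: e rs).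
  by apply/funext => k; exact: truncl1_parts.
rewrite multilinear_expand// ell_sumE spart_sum mulr_sumr; apply: eq_bigr => rho _.
rewrite ellZ ofR_prod spart_ofRM /tau /= mulrCA; congr (_ * _).
by rewrite mulrA divff ?mul1r ?gt_eqF.
Qed.

End Discretization.

Section RealFunctions.
Context {R : realType} {b : base_field}.
Local Notation l1 := (ell1 R b).
Local Notation loo := (ell_infty R b).

(** The sum is finite and the operators are continuous, so it suffices to
    approximate each of the finitely many values that occur.  The error [e] is
    split as follows: [d2] is how close the discretized functions have to be for
    the values of the [A k] to be within [d1 / 2], the truncation to [M]
    coordinates uses the other [d1 / 2], and [d1] makes the error on the values
    of [T] at most [e / 2]; the last [e / 2] is for the truncation to [Mc]
    coordinates in [l_p]. *)
Theorem real_summing m n (p : \bar R) (p1 : (1 <= p)%E) (u t : R)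
    (T : ('I_m -> l1) -> ell b p1) (A : 'I_m -> ('I_n -> loo) -> l1) :
  (0 < n)%N -> admissible n p u t -> 0 < u -> 0 < t ->
  bounded_multilinear T -> (forall k, bounded_multilinear (A k)) ->
  exists2 B : R, 0 < B & forall (J : finType) (h : 'I_m -> 'I_n -> J -> nat -> R)
    (X : 'I_m -> 'I_n -> J -> loo),
    (forall k i j tau, X k i j tau = ofR b (h k i j tau)) ->
    (forall k i tau, \sum_j `|h k i j tau| `^ u <= 1) ->
    \sum_(j : {ffun 'I_m -> {ffun 'I_n -> J}})
      rnorm (T (fun k => A k (fun i => X k i (j k i)))) `^ t <= B `^ t.
Proof.
move=> n0 adm u0 t0 Tb Ab.
have [K0 K00 core] := finite_summing_admissible m n0 p1 adm.
have [CT CT0 TC] := bounded_multilinear_bound Tb.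
have /exists2_choice[CA CA0 AC] : forall k, exists2 C, 0 < C &
    forall x, rnorm (A k x) <= C * \prod_i rnorm (x i).
  by move=> k; exact: bounded_multilinear_bound.
pose G := 2 * (2 * CT * \prod_k (2 * CA k)).
have G0 : 0 < G by rewrite !mulr_gt0// prodr_gt0// => k _; rewrite mulr_gt0.
exists (G * K0); first exact: mulr_gt0.
move=> J h X hX h1.
apply: sum_powR_closed => // [j|e e0]; first exact: rnorm_ge0.
have e2 : 0 < e / 2 by rewrite divr_gt0.
have hle1 k i j tau : `|h k i j tau| <= 1.
  apply: (powR_le1 u0) => //; apply: le_trans (h1 k i tau).
  by rewrite (bigD1 j)//= lerDl sumr_ge0// => j' _; exact: powR_ge0.
pose y k (g : {ffun 'I_n -> J}) := A k (fun i => X k i (g i)).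
have [d1 d10 d1P] : exists2 d, 0 < d & forall (j : {ffun 'I_m -> {ffun 'I_n -> J}}) y',
    (forall k, rnorm (y' k - y k (j k)) <= d) ->
    rnorm (T y' - T (fun k => y k (j k))) <= e / 2.
  apply: fin_min => [j|j d d' dd' H y' yP].
    exact: (bounded_multilinear_continuous (fun k => y k (j k)) Tb e2).
  by apply: H => k; exact: le_trans (yP k) dd'.
have d12 : 0 < d1 / 2 by rewrite divr_gt0.
have [d2 d20 d2P] : exists2 d, 0 < d & forall (kg : 'I_m * {ffun 'I_n -> J}) x',
    (forall i, rnorm (x' i - X kg.1 i (kg.2 i)) <= d) ->
    rnorm (A kg.1 x' - y kg.1 kg.2) <= d1 / 2.
  apply: fin_min => [kg|kg d d' dd' H x' xP].
    exact: (bounded_multilinear_continuous (fun i => X kg.1 i (kg.2 i)) (Ab kg.1) d12).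
  by apply: H => i; exact: le_trans (xP i) dd'.
have [D [pi [rp rpP]]] := finite_partition (h := fun o : 'I_m * 'I_n * J => h o.1.1 o.1.2 o.2)
  d20 (fun o tau => hle1 _ _ _ _).
pose x k i j d := h k i j (rp d).
have x1 k i j d : `|x k i j d| <= 1 by exact: hle1.
pose xs k (g : {ffun 'I_n -> J}) i : loo := simple_fun pi (x1 k i (g i)).
have [M MP] : exists M, forall kg : 'I_m * {ffun 'I_n -> J},
    rnorm (truncl1 M (A kg.1 (xs kg.1 kg.2)) - A kg.1 (xs kg.1 kg.2)) <= d1 / 2.
  by apply: fin_max => kg; exact: truncl1_approx.
pose z (j : {ffun 'I_m -> {ffun 'I_n -> J}}) := T (fun k => truncl1 M (A k (xs k (j k)))).
have zP j : rnorm (z j - T (fun k => y k (j k))) <= e / 2.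
  apply: d1P => k.
  rewrite -[X in X - _](subrK (A k (xs k (j k)))) -addrA.
  apply: le_trans (rnormD _ _) _; rewrite [leRHS]splitr; apply: lerD; first exact: (MP (k, j k)).
  apply: (d2P (k, j k)) => i /=; apply: rnorm_infty_le; first exact: ltW.
  move=> tau; rewrite ellB hX /=.
  rewrite (_ : ofR b _ - ofR b _ = ofR b (h k i (j k i) (rp (pi tau)) - h k i (j k i) tau)).
    by rewrite toR_ofR_norm; exact: (rpP (k, i, j k i)).
  by rewrite ofRD; congr (_ + _); case: (b) => //=; rewrite rmorphN.
have [Mc McP] : exists Mc, forall j, rnorm (z j) <= tnorm p Mc (z j) + e / 2.
  by apply: fin_max => j; exact: tnorm_approx.
have /exists2_choice[a a1 aE] : forall k, exists2 a : {ffun 'I_n -> D} -> 'I_M * bool -> R, unit_form a &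
    forall (j : {ffun 'I_n -> J}) (r : 'I_M) (s : bool),
      spart s (A k (xs k j) r) = 2 * CA k * form_val a (x k) j (r, s).
  move=> k; have [a a1 aE] := tensor_form pi M (Ab k).1 (CA0 k) (AC k).
  by exists a => // j r s; exact: aE.
have [tau tau1 tauE] := tensor_op M Mc Tb.1 CT0 TC.
exists (fun j => G * finnorm p (comp_val a x tau j)); split.
- by move=> j; rewrite mulr_ge0 ?finnorm_ge0// ltW.
- move=> j; rewrite -[X in rnorm X](subrK (z j)).
  apply: le_trans (rnormD _ _) _; rewrite rnormB.
  apply: le_trans (lerD (zP j) (McP j)) _.
  rewrite addrCA -splitr lerD2r.
  apply: le_trans (finnorm_le_pair (g := fun cs : 'I_Mc * bool => spart cs.2 (z j cs.1)) p1 _) _.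
    by move=> c; rewrite norm_toR; exact: toR_norm_parts.
  rewrite /G -mulrA ler_wpM2l//.
  have -> : (fun cs : 'I_Mc * bool => spart cs.2 (z j cs.1)) =
      (fun cs => (2 * CT * \prod_k (2 * CA k)) * comp_val a x tau j cs).
    apply/funext => -[c s] /=; rewrite tauE -[RHS]mulrA; congr (_ * _).
    rewrite /comp_val mulr_sumr; apply: eq_bigr => rho _.
    rewrite mulrA -big_split/=; congr (_ * _); apply: eq_bigr => k _.
    by rewrite aE -surjective_pairing.
  by rewrite finnormZ// ger0_norm// mulr_ge0 ?prodr_ge0 ?mulr_ge0 ?(ltW CT0)// => k _; rewrite mulr_ge0// ltW.
- have := core D _ J _ a x tau a1 (fun k i d => h1 k i (rp d)) tau1.
  under [X in _ -> X <= _]eq_bigr do rewrite powRM ?finnorm_ge0 ?(ltW G0)//.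
  by rewrite -mulr_sumr powRM ?(ltW G0) ?(ltW K00)// => hle; rewrite ler_wpM2l ?powR_ge0.
Qed.

End RealFunctions.

(** * The composition *)

Section Blocks.
Variables (m n : nat).

Lemma block_index_surj (l : 'I_(m * n)) :
  exists (k : 'I_m) (i : 'I_n), l = block_index k i.
Proof.
have n0 : (0 < n)%N by case: n l => // -[l]; rewrite muln0.
have kP : (l %/ n < m)%N by rewrite ltn_divLR.
exists (Ordinal kP), (Ordinal (ltn_pmod l n0)); apply: val_inj => /=.
exact: divn_eq.
Qed.

Lemma block_index_inj k k' i i' : @block_index m n k i = block_index k' i' ->
  k = k' /\ i = i'.
Proof.
move=> /(congr1 val)/= e; have n0 : (0 < n)%N by case: n i {i' e} => // -[].
have ei : i = i' :> nat.
  by have := congr1 (modn^~ n) e; rewrite /= !modnMDl !modn_small.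
split; apply: val_inj => //; move: e; rewrite ei => /addIn/eqP.
by rewrite eqn_pmul2r// => /eqP.
Qed.

Lemma block_index_bij : bijective (fun p : 'I_m * 'I_n => block_index p.1 p.2).
Proof.
apply: inj_card_bij; last by rewrite card_prod !card_ord.
by move=> [k i] [k' i'] /= /block_index_inj[-> ->].
Qed.

Lemma prod_block (R : comNzRingType) (F : 'I_(m * n) -> R) :
  \prod_l F l = \prod_k \prod_i F (block_index k i).
Proof.
by rewrite pair_bigA/= (reindex (fun p : 'I_m * 'I_n => block_index p.1 p.2))//=;
  exact/onW_bij/block_index_bij.
Qed.

Definition curry_ffun (J : finType) (j : {ffun 'I_(m * n) -> J}) :
  {ffun 'I_m -> {ffun 'I_n -> J}} := [ffun k => [ffun i => j (block_index k i)]].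

Lemma curry_ffun_bij (J : finType) : bijective (@curry_ffun J).
Proof.
apply: inj_card_bij => [j j' /ffunP jj'|]; last first.
  by rewrite !card_ffun !card_ord -expnM mulnC.
apply/ffunP => l; have [k [i ->]] := block_index_surj l.
by have /ffunP/(_ i) := jj' k; rewrite !ffunE.
Qed.

End Blocks.

Section Composition.
Context {R : realType} {b : base_field}.
Local Notation K := (scalars R b).

Lemma bounded_multilinear_comp m n (E F G : normedModType K)
    (T : ('I_m -> F) -> G) (A : 'I_m -> ('I_n -> E) -> F) :
  bounded_multilinear T -> (forall k, bounded_multilinear (A k)) ->
  bounded_multilinear (multicomp T A).
Proof.
move=> Tb Ab; split.
  move=> l x a y z; have [k [i ->]] := block_index_surj l.
  have upd w : multicomp T A [eta x with block_index k i |-> w] =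
      T [eta (fun k' => A k' (fun i' => x (block_index k' i'))) with
        k |-> A k [eta (fun i' => x (block_index k i')) with i |-> w]].
    congr T; apply/funext => k' /=; case: eqVneq => [->|kk'].
      congr A; apply/funext => i' /=; congr (if _ then _ else _).
      by apply/eqP/eqP => [/block_index_inj[]|->].
    congr A; apply/funext => i' /=; case: eqP => // /block_index_inj[e _].
    by rewrite e eqxx in kk'.
  by rewrite !upd (Ab k).1 Tb.1.
have [CT CT0 TC] := bounded_multilinear_bound Tb.
have /exists2_choice[CA CA0 AC] : forall k, exists2 C, 0 < C &
    forall x, rnorm (A k x) <= C * \prod_i rnorm (x i).
  by move=> k; exact: bounded_multilinear_bound.
exists (CT * \prod_k CA k) => x; rewrite -/(rnorm _); apply: le_trans (TC _) _.
rewrite -mulrA ler_wpM2l ?(ltW CT0)// (prod_block (fun l => toR `|x l|)) -big_split/=.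
by apply: ler_prod => k _; rewrite rnorm_ge0/=; exact: AC.
Qed.

Lemma sum_powR_le (X : finType) (f : X -> R) (t : R) : 0 < t -> (forall x, 0 <= f x) ->
  (\sum_x f x) `^ t <= #|X|%:R `^ t * \sum_x f x `^ t.
Proof.
move=> t0 f0.
have S0 : 0 <= \sum_x f x `^ t by apply: sumr_ge0 => x _; exact: powR_ge0.
have fS x : f x <= (\sum_x f x `^ t) `^ t^-1.
  rewrite -[leLHS](powRr1 (f0 x)) -(divff (lt0r_neq0 t0)) powRrM.
  apply: powR_le; rewrite ?invr_ge0 ?(ltW t0) ?powR_ge0//.
  by rewrite (bigD1 x)//= lerDl sumr_ge0// => y _; exact: powR_ge0.
apply: (@le_trans _ _ ((#|X|%:R * (\sum_x f x `^ t) `^ t^-1) `^ t)).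
  apply: powR_le; rewrite ?(ltW t0) ?sumr_ge0//.
  by rewrite mulr_natl -sumr_const; apply: ler_sum => x _; exact: fS.
by rewrite powRM ?powR_ge0// -powRrM mulVf ?gt_eqF// powRr1.
Qed.

Lemma sum_uniq_le (X : finType) (s : seq X) (f : X -> R) : uniq s ->
  (forall x, 0 <= f x) -> \sum_(x <- s) f x <= \sum_x f x.
Proof.
move=> us f0; rewrite big_uniq//= [leRHS](bigID (mem s))/= lerDl.
exact: sumr_ge0.
Qed.

End Composition.

Section Summing.
Context {R : realType} {b : base_field}.
Local Notation K := (scalars R b).
Local Notation l1 := (ell1 R b).
Local Notation loo := (ell_infty R b).

Definition coord (tau : nat) (x : loo) : K := x tau.

Lemma coord_linear tau : linear (coord tau : loo -> K^o).
Proof. by move=> a x y. Qed.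

HB.instance Definition _ tau :=
  GRing.isLinear.Build K loo K^o _ (coord tau) (coord_linear tau).

(** The coordinate functionals belong to the unit ball of the dual of [l_oo]. *)
Lemma weak_norm_coord (s : R) (x : nat -> loo) : 1 <= s ->
  (weak_norm s x < +oo)%E -> forall N tau,
  \sum_(j < N) toR `|x j tau| `^ s <= fine (weak_norm s x) `^ s.
Proof.
move=> s1 xw N tau; have s0 : 0 < s by exact: lt_le_trans s1.
have le_w : (ell_norm s%:E (fun j => x j tau) <= weak_norm s x)%E.
  rewrite ell_norm_finE//; apply: ereal_sup_ubound.
  exists (coord tau : {scalar loo}) => // y y1.
  rewrite -toR_normK (le_trans _ y1)// -ofR_rnorm ofR_le; exact: (coord_le y tau).
have e0 : (0 <= ell_norm s%:E (fun j => x j tau))%E by exact: Lnorm_ge0.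
have ef : ell_norm s%:E (fun j => x j tau) \is a fin_num.
  by rewrite ge0_fin_numE// (le_lt_trans le_w).
have wf : weak_norm s x \is a fin_num.
  by rewrite ge0_fin_numE// (le_trans e0).
have s1' : (1 <= s%:E)%E by rewrite lee_fin.
have := @tnorm_le_ell_norm R b _ s1' (fun j => x j tau) (fine (ell_norm s%:E (fun j => x j tau))) N.
rewrite fineK// => /(_ (fine_ge0 e0) erefl) h.
have h' : tnorm s%:E N (fun j => x j tau) <= fine (weak_norm s x).
  by apply: le_trans h _; apply: fine_le.
have := powR_le (ltW s0) (finnorm_ge0 _ _) h'; apply: le_trans.
rewrite /tnorm /finnorm -powRrM mulVf ?gt_eqF// powRr1 ?powR_sum_ge0//.
by under eq_bigr do rewrite -norm_toR.
Qed.

(** Each function splits into its real and imaginary parts.  Division by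
    [2 * w l] makes the functions of index [l] real and normalized: as the real
    and imaginary parts count twice in the sum of [u]-th powers, and [1 <= u],
    the factor [2] is enough.  The values of the normalized functions are then
    at most 1, so that [u] may be replaced by the larger exponent [u0]. *)
Theorem finite_family_summing m n (p : \bar R) (p1 : (1 <= p)%E) (u u0 t : R)
    (T : ('I_m -> l1) -> ell b p1) (A : 'I_m -> ('I_n -> loo) -> l1) :
  (0 < n)%N -> admissible n p u0 t -> 1 <= u -> u <= u0 -> 0 < t ->
  bounded_multilinear T -> (forall k, bounded_multilinear (A k)) ->
  exists2 C : R, 0 < C & forall (N : nat) (x : 'I_(m * n) -> nat -> loo) (w : 'I_(m * n) -> R),
    (forall l, 0 < w l) ->
    (forall l tau, \sum_(j < N) toR `|x l j tau| `^ u <= w l `^ u) ->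
    \sum_(j : {ffun 'I_(m * n) -> 'I_N})
      rnorm (multicomp T A (fun l => x l (j l))) `^ t <= (C * \prod_l w l) `^ t.
Proof.
move=> n0 adm u1 uu0 t0 Tb Ab.
have u00 : 0 < u0 by rewrite (lt_le_trans _ uu0)// (lt_le_trans _ u1).
have up : 0 < u by rewrite (lt_le_trans _ u1).
have [B B0 BP] := real_summing n0 adm u00 t0 Tb Ab.
have Sb := bounded_multilinear_comp Tb Ab.
have c0 : 0 < #|{ffun 'I_(m * n) -> bool}|%:R :> R.
  by rewrite ltr0n; apply/card_gt0P; exists [ffun=> true].
exists (2 ^+ (m * n) * (#|{ffun 'I_(m * n) -> bool}|%:R * B)).
  by rewrite mulr_gt0 ?exprn_gt0// mulr_gt0.
move=> N x w w0 xw.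
have w20 l : 0 < 2 * w l by rewrite mulr_gt0.
pose J := ('I_N * bool)%type.
pose h l (j : J) tau := (2 * w l)^-1 * spart j.2 (x l j.1 tau).
have hu l tau : \sum_j `|h l j tau| `^ u <= 1.
  rewrite sum_pair_bool.
  apply: (@le_trans _ _ (\sum_(j < N) 2 * ((2 * w l)^-1 `^ u * toR `|x l j tau| `^ u))).
    apply: ler_sum => j _; rewrite mulr2n mulrDl mul1r /h/=.
    by apply: lerD; rewrite normrM gtr0_norm ?invr_gt0// powRM ?invr_ge0 ?(ltW (w20 l))//;
      rewrite ler_wpM2l ?powR_ge0// powR_le ?(ltW up)// norm_spart.
  rewrite -mulr_sumr -mulr_sumr.
  apply: (@le_trans _ _ (2 * ((2 * w l)^-1 `^ u * w l `^ u))).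
    by rewrite ler_wpM2l// ler_wpM2l ?powR_ge0.
  rewrite -powRM ?invr_ge0 ?(ltW (w20 l)) ?(ltW (w0 l))//.
  rewrite (_ : (2 * w l)^-1 * w l = 2^-1); last first.
    by rewrite invfM -mulrA mulVf ?mulr1// gt_eqF.
  rewrite -[2 in X in X * _]invrK ler_pdivrMl ?invr_gt0// mulr1.
  by rewrite -[leRHS]powRr1//; apply: ger_powR; rewrite ?invr_gt0 ?invf_le1 ?ler1n ?ltr0n.
have h1 l j tau : `|h l j tau| <= 1.
  apply: (powR_le1 up) => //; apply: le_trans (hu l tau).
  by rewrite (bigD1 j)//= lerDl sumr_ge0// => j' _; exact: powR_ge0.
have hu0 l tau : \sum_j `|h l j tau| `^ u0 <= 1.
  apply: le_trans (hu l tau); apply: ler_sum => j _.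
  have [->|hn] := eqVneq `|h l j tau| 0; first by rewrite !powR0// gt_eqF.
  by apply: ger_powR => //; rewrite lt_neqAle eq_sym hn normr_ge0 h1.
pose X l (j : J) : loo := bounded_seq (fun tau => ofR_norm_le (h1 l j tau)).
have xE l (j : 'I_N) : x l j = \sum_s (ofR b (2 * w l) * sbasis s) *: X l (j, s).
  apply: val_inj; apply/funext => tau.
  change (x l j tau = (\sum_s (ofR b (2 * w l) * sbasis s) *: X l (j, s)) tau).
  rewrite ell_sumE -[LHS]spart_decomp; apply: eq_bigr => s _; rewrite ellZ.
  change (ofR b (spart s (x l j tau)) * sbasis s =
    ofR b (2 * w l) * sbasis s * ofR b (h l (j, s) tau)).
  rewrite mulrAC; congr (_ * _); rewrite -ofRM /h mulrA divff ?mul1r// gt_eqF//.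
have bound (j : {ffun 'I_(m * n) -> 'I_N}) :
    rnorm (multicomp T A (fun l => x l (j l))) <= (\prod_l (2 * w l)) *
     \sum_(s : {ffun 'I_(m * n) -> bool}) rnorm (multicomp T A (fun l => X l (j l, s l))).
  have -> : (fun l => x l (j l)) =
      (fun l => \sum_s (ofR b (2 * w l) * sbasis s) *: X l (j l, s)).
    by apply/funext => l; exact: xE.
  rewrite (multilinear_expand _ _ Sb.1) mulr_sumr.
  apply: le_trans (rnorm_sum _ _) _; apply: ler_sum => s _.
  rewrite rnormZ ler_wpM2r ?rnorm_ge0//.
  elim/big_rec2: _ => [|l y z _ yz]; first by rewrite -(ofR_rnorm (1 : K^o)) ?ofRK /rnorm normr1; case: (b).
  rewrite !toR_normM toR_ofR_norm gtr0_norm// -mulrA ler_wpM2l ?(ltW (w20 l))//.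
  by rewrite -[leRHS]mul1r ler_pM ?toR_norm_ge0// norm_sbasis.
have W0 : 0 <= \prod_l w l by apply: prodr_ge0 => l _; exact: ltW.
apply: (@le_trans _ _ (\sum_(j : {ffun 'I_(m * n) -> 'I_N}) (\prod_l (2 * w l)) `^ t *
   (#|{ffun 'I_(m * n) -> bool}|%:R `^ t *
    \sum_(s : {ffun 'I_(m * n) -> bool}) rnorm (multicomp T A (fun l => X l (j l, s l))) `^ t))).
  apply: ler_sum => j _.
  have s0 : 0 <= \sum_(s : {ffun 'I_(m * n) -> bool}) rnorm (multicomp T A (fun l => X l (j l, s l))).
    by apply: sumr_ge0 => s _; exact: rnorm_ge0.
  apply: le_trans (powR_le (ltW t0) (rnorm_ge0 _) (bound j)) _.
  rewrite powRM//; last by apply: prodr_ge0 => l _; exact: ltW.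
  by rewrite ler_wpM2l ?powR_ge0// sum_powR_le// => s; exact: rnorm_ge0.
rewrite -!mulr_sumr big_split/= prodr_const card_ord.
set cS := #|_|%:R.
have -> : \sum_(j : {ffun 'I_(m * n) -> 'I_N}) \sum_(s : {ffun 'I_(m * n) -> bool})
      rnorm (multicomp T A (fun l => X l (j l, s l))) `^ t =
    \sum_(j : {ffun 'I_m -> {ffun 'I_n -> J}})
      rnorm (T (fun k => A k (fun i => X (block_index k i) (j k i)))) `^ t.
  rewrite pair_bigA/= (reindex (@curry_ffun m n J))/=; last exact/onW_bij/curry_ffun_bij.
  rewrite (reindex (fun j : {ffun 'I_(m * n) -> J} =>
    ([ffun l => (j l).1] : {ffun 'I_(m * n) -> 'I_N},
     [ffun l => (j l).2] : {ffun 'I_(m * n) -> bool})))/=; last first.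
    exists (fun js : {ffun 'I_(m * n) -> 'I_N} * {ffun 'I_(m * n) -> bool} =>
      [ffun l => (js.1 l, js.2 l)] : {ffun 'I_(m * n) -> J}) => [j _|[j s] _] /=.
      by apply/ffunP => l; rewrite !ffunE -surjective_pairing.
    by congr pair; apply/ffunP => l; rewrite !ffunE.
  apply: eq_bigr => j _; rewrite /multicomp.
  suff -> : (fun k => A k (fun i => X (block_index k i)
        ([ffun l => (j l).1] (block_index k i), [ffun l => (j l).2] (block_index k i)))) =
      (fun k => A k (fun i => X (block_index k i) (curry_ffun j k i))) by [].
  apply/funext => k; congr A; apply/funext => i.
  by rewrite !ffunE -surjective_pairing.
have hB := BP J (fun k i j tau => h (block_index k i) j tau)
  (fun k i j => X (block_index k i) j) (fun _ _ _ _ => erefl) (fun k i tau => hu0 _ tau).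
have p20 : 0 <= (2 : R) ^+ (m * n) by rewrite exprn_ge0.
rewrite [leRHS](_ : _ = (2 ^+ (m * n) * \prod_l w l) `^ t * (cS `^ t * B `^ t)).
  by rewrite ler_wpM2l ?powR_ge0// ler_wpM2l ?powR_ge0.
rewrite -!powRM ?mulr_ge0 ?(ltW B0) ?(ltW c0)//; congr (_ `^ t).
by ring.
Qed.

(** The passage from finite to infinite families is the definition of the sum of
    a family of nonnegative numbers.  The finite inequality was normalized by
    positive weak norms; if one of them is 0, all the functions of that index
    vanish. *)
Lemma multiple_summing_le m n (p : \bar R) (p1 : (1 <= p)%E) (u u0 t : R)
    (T : ('I_m -> l1) -> ell b p1) (A : 'I_m -> ('I_n -> loo) -> l1) :
  (0 < n)%N -> admissible n p u0 t -> 1 <= u -> u <= u0 -> u <= t ->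
  bounded_multilinear T -> (forall k, bounded_multilinear (A k)) ->
  multiple_summing t u (multicomp T A).
Proof.
move=> n0 adm u1 uu0 ut Tb Ab.
have u00 : 0 < u by rewrite (lt_le_trans _ u1).
have t0 : 0 < t by rewrite (lt_le_trans _ ut).
have Sb := bounded_multilinear_comp Tb Ab.
have [C C0 CP] := finite_family_summing n0 adm u1 uu0 t0 Tb Ab.
split=> //; exists C => // x xw.
pose w l := fine (weak_norm u (x l)).
have xw_le l N tau : \sum_(j < N) toR `|x l j tau| `^ u <= w l `^ u.
  exact: weak_norm_coord.
have w0 l : 0 <= w l.
  apply: fine_ge0; apply: (@le_trans _ _ (ell_norm u%:E (fun j => x l j 0%N))).
    exact: Lnorm_ge0.
  rewrite ell_norm_finE//; apply: ereal_sup_ubound.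
  exists (coord 0 : {scalar loo}) => // y y1.
  rewrite -toR_normK (le_trans _ y1)// -ofR_rnorm ofR_le; exact: (coord_le y 0%N).
pose a (j : 'I_(m * n) -> nat) := rnorm (multicomp T A (fun l => x l (j l))) `^ t.
have a0 j : 0 <= a j by exact: powR_ge0.
have W0 : 0 <= \prod_l w l by exact: prodr_ge0.
have CW0 : 0 <= C * \prod_l w l by rewrite mulr_ge0// ltW.
have fin_le N : \sum_(j : {ffun 'I_(m * n) -> 'I_N}) a (fun l => j l) <= (C * \prod_l w l) `^ t.
  have [/forallP wp|] := boolP [forall l, 0 < w l]; first exact: CP.
  rewrite negb_forall => /existsP[l]; rewrite -leNgt => wl.
  have wl0 : w l = 0 by apply/eqP; rewrite eq_le wl w0.
  rewrite big1 ?powR_ge0// => j _; rewrite /a.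
  have xl0 : rnorm (x l (j l)) = 0.
    apply/eqP; rewrite eq_le rnorm_ge0 andbT; apply: rnorm_infty_le => // tau.
    have := xw_le l (j l).+1 tau; rewrite wl0 powR0 ?gt_eqF// => h.
    have {}h : toR `|x l (j l) tau| `^ u <= 0.
      apply: le_trans h; rewrite big_ord_recr/= lerDr.
      by apply: sumr_ge0 => i _; exact: powR_ge0.
    by apply: contraTT h; rewrite -!ltNge; exact: powR_gt0.
  have [C' _ SC] := bounded_multilinear_bound Sb.
  have := SC (fun l => x l (j l)); rewrite (bigD1 l)//= xl0 mul0r mulr0 => S0.
  have -> : rnorm (multicomp T A (fun l => x l (j l))) = 0.
    by apply/eqP; rewrite eq_le S0 rnorm_ge0.
  by rewrite powR0// gt_eqF.
have esum_le : (\esum_(j in [set: {ffun 'I_(m * n) -> nat}]) (a j)%:E <=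
    ((C * \prod_l w l) `^ t)%:E)%E.
  apply: ge_ereal_sup => _ [F [Ffin _] <-].
  rewrite fsbig_finite//= sumEFin lee_fin.
  set s := fset_set F; pose N := (\max_(j <- s) \max_l j l).+1.
  have jN j : j \in (s : seq _) -> forall l, (j l < N)%N.
    move=> js l; rewrite ltnS; apply: leq_trans (leq_bigmax_seq _ js isT).
    exact: (leq_bigmax l).
  pose phi (j : {ffun 'I_(m * n) -> nat}) : {ffun 'I_(m * n) -> 'I_N} := [ffun l => inord (j l)].
  have phiE j : j \in (s : seq _) -> forall l, phi j l = j l :> nat.
    by move=> js l; rewrite ffunE inordK// jN.
  apply: le_trans (fin_le N).
  rewrite (eq_big_seq (fun j => a (fun l => phi j l))) => [|j js]; last first.
    by congr a; apply/funext => l; rewrite phiE.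
  rewrite -(big_map phi xpredT (fun j : {ffun 'I_(m * n) -> 'I_N} => a (fun l => j l))).
  apply: (sum_uniq_le (f := fun j : {ffun 'I_(m * n) -> 'I_N} => a (fun l => j l))) => //.
  rewrite map_inj_in_uniq ?fset_uniq// => j j' js js' e.
  by apply/ffunP => l; rewrite -phiE// -(phiE j')// e.
have -> : (C * \prod_l w l)%:E = (((C * \prod_l w l) `^ t)%:E `^ t^-1)%E.
  by rewrite poweR_EFin -powRrM divff ?gt_eqF// powRr1.
apply: gt0_ler_poweR; rewrite ?invr_ge0 ?(ltW t0)// ?in_itv/= ?leey ?andbT.
- by apply: esum_ge0 => j _; rewrite lee_fin powR_ge0.
by rewrite lee_fin powR_ge0.
Qed.

Lemma admissible_le n (p : \bar R) (u t : R) : admissible n p u t -> u <= t.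
Proof.
move=> [ka [ka0 nka -> ]].
have k1 : 0 < 1 + ka by rewrite ltr_pwDl.
case: p => [r [th [low [th0 th1 _ _ ->]]]|->|->].
- have k2 : 0 < 1 + th * ka by rewrite ltr_pwDl// mulr_ge0.
  by rewrite ler_pM2l// lef_pV2 ?posrE// lerD2l ler_piMl.
- by rewrite ler_pdivrMr// ler_peMr// lerDl.
- by rewrite ler_pdivrMr// ler_peMr// lerDl.
Qed.

End Summing.

(* In (ii) and (iv), the value 2 for p = +oo is the limit of the formula. *)
Theorem theorem5p1 (R : realType) (b : base_field) (m n : nat)
    (p : \bar R) (p1 : (1 <= p)%E)
    (T : ('I_m -> ell1 R b) -> ell b p1)
    (A : 'I_m -> ('I_n -> ell_infty R b) -> ell1 R b) :
  (0 < m)%N -> (0 < n)%N ->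
  bounded_multilinear T -> (forall k : 'I_m, bounded_multilinear (A k)) ->
  forall u : R,
  [/\ (p <= 2%:E)%E -> 2 * n%:R / (n%:R + 1) <= u <= 2 ->
      let q := fine p in
      multiple_summing (2 * q * u / (4 * q + 2 * u - q * u - 4)) u
        (multicomp T A),
      (2%:E <= p)%E -> 2 * n%:R / (n%:R + 1) <= u <= 2 ->
      multiple_summing
        (if p is q%:E then 2 * q * u / (q * u - 2 * u + 4) else 2) u
        (multicomp T A),
      (p <= 2%:E)%E -> 1 <= u <= 2 * n%:R / (n%:R + 1) ->
      let q := fine p in
      multiple_summing (2 * n%:R * q / (2 * q + n%:R * q - 2)) u
        (multicomp T A) &
      (2%:E <= p)%E -> 1 <= u <= 2 * n%:R / (n%:R + 1) ->
      multiple_summing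
        (if p is q%:E then 2 * n%:R * q / (n%:R * q + 2) else 2) u
        (multicomp T A)].
Proof.
move=> m0 n0 Tb Ab u.
have n1 : 1 <= n%:R :> R by rewrite ler1n.
have np : 0 < n%:R :> R by rewrite ltr0n.
set v := 2 * n%:R / (n%:R + 1).
have nq : 0 < n%:R + 1 :> R by lra.
have v1 : 1 <= v by rewrite /v ler_pdivlMr//; lra.
have vE : v = 2 / (1 + n%:R^-1) by rewrite /v; field; rewrite !gt_eqF//; lra.
(* The parameters of the exponents of the two ranges of [u]. *)
have large : v <= u <= 2 -> [/\ 0 < u, 0 <= 2 / u - 1, n%:R * (2 / u - 1) <= 1 &
    u = 2 / (1 + (2 / u - 1))].
  move=> /andP[vu u2]; have u0 : 0 < u by rewrite (lt_le_trans _ vu)// (lt_le_trans _ v1).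
  split=> //.
  - by rewrite subr_ge0 ler_pdivlMr// mul1r.
  - move: vu; rewrite /v ler_pdivrMr// -(ler_pM2r u0 (n%:R * _)) -mulrA.
    have -> : (2 / u - 1) * u = 2 - u by field; rewrite gt_eqF.
    by lra.
  - by field; rewrite !gt_eqF//; lra.
have [s0 s1] : 0 <= n%:R^-1 :> R /\ n%:R * n%:R^-1 <= 1 :> R.
  by rewrite invr_ge0 ler0n divff ?gt_eqF.
have summing u0 t : admissible n p u0 t -> 1 <= u -> u <= u0 ->
    multiple_summing t u (multicomp T A).
  move=> adm u1 uu0; apply: (multiple_summing_le n0 adm u1 uu0 _ Tb Ab).
  exact: le_trans (admissible_le adm).
have low_p : (p <= 2%:E)%E -> exists2 q : R, p = q%:E & 1 <= q <= 2.
  case: (exponentP p1) => [[q q1 ->]|->//].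
  by rewrite lee_fin => q2; exists q; rewrite ?q1.
have low_th (q : R) : 1 <= q <= 2 -> [/\ 0 <= 2 - 2 / q, 2 - 2 / q <= 1, 1 <= q &
    q^-1 = 1 - (2 - 2 / q) / 2].
  move=> /andP[q1 q2]; have q0 : 0 < q by rewrite (lt_le_trans _ q1).
  split=> //.
  - by rewrite subr_ge0 ler_pdivrMr// ler_peMr.
  - have h : 1 <= 2 / q by rewrite ler_pdivlMr// mul1r.
    by rewrite lerBlDr -[leLHS]/(1 + 1) lerD2l.
  - by field; rewrite gt_eqF.
have high_th (q : R) : 2 <= q -> [/\ 0 <= 2 / q, 2 / q <= 1, 1 <= q & q^-1 = (2 / q) / 2].
  move=> q2; have q0 : 0 < q by rewrite (lt_le_trans _ q2).
  split; [by rewrite divr_ge0// ltW|by rewrite ler_pdivrMr// mul1r| |by field; rewrite gt_eqF].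
  by rewrite (le_trans _ q2)// ler1n.
split.
- move=> /low_p[q pq q12] uv q' /=; have -> : q' = q by rewrite /q' pq.
  have [u0 ka0 ka1 uE] := large uv; have [th0 th1 q1 qE] := low_th q q12.
  have q0 : 0 < q by rewrite (lt_le_trans _ q1).
  apply: (summing u) => //; last by case/andP: uv => /(le_trans v1).
  exists (2 / u - 1); split=> //; rewrite pq; exists (2 - 2 / q), true; split=> //.
  have den : 0 < 1 + (2 - 2 / q) * (2 / u - 1) by rewrite ltr_pwDl// mulr_ge0.
  have den' : 4 * q + 2 * u - q * u - 4 = (q * u) * (1 + (2 - 2 / q) * (2 / u - 1)).
    by field; rewrite !gt_eqF//.
  by rewrite den'; move: den; set X := 1 + _ => X0; field; rewrite !gt_eqF//.
- move=> p2 uv; have [u0 ka0 ka1 uE] := large uv.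
  apply: (summing u) => //; last by case/andP: uv => /(le_trans v1).
  exists (2 / u - 1); split=> //.
  case: (exponentP p1) p2 => [[q q1 ->]|->//]; rewrite lee_fin => q2.
  have [th0 th1 _ qE] := high_th q q2; have q0 : 0 < q by rewrite (lt_le_trans _ q2).
  exists (2 / q), false; split=> //.
  have den : 0 < 1 + 2 / q * (2 / u - 1) by rewrite ltr_pwDl// mulr_ge0.
  have den' : q * u - 2 * u + 4 = (q * u) * (1 + 2 / q * (2 / u - 1)).
    by field; rewrite !gt_eqF//.
  by rewrite den'; move: den; set X := 1 + _ => X0; field; rewrite !gt_eqF//.
- move=> /low_p[q pq q12] /andP[u1 uv] q' /=; have -> : q' = q by rewrite /q' pq.
  have [th0 th1 q1 qE] := low_th q q12; have q0 : 0 < q by rewrite (lt_le_trans _ q1).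
  apply: (summing v) => //; exists n%:R^-1; split=> //; rewrite pq.
  exists (2 - 2 / q), true; split=> //.
  have den : 0 < 1 + (2 - 2 / q) * n%:R^-1 by rewrite ltr_pwDl// mulr_ge0.
  have den' : 2 * q + n%:R * q - 2 = (n%:R * q) * (1 + (2 - 2 / q) * n%:R^-1).
    by field; rewrite !gt_eqF//.
  by rewrite den'; move: den; set X := 1 + _ => X0; field; rewrite !gt_eqF//.
- move=> p2 /andP[u1 uv].
  apply: (summing v) => //; exists n%:R^-1; split=> //.
  case: (exponentP p1) p2 => [[q q1 ->]|->//]; rewrite lee_fin => q2.
  have [th0 th1 _ qE] := high_th q q2; have q0 : 0 < q by rewrite (lt_le_trans _ q2).
  exists (2 / q), false; split=> //.
  have den : 0 < 1 + 2 / q * n%:R^-1 by rewrite ltr_pwDl// mulr_ge0// invr_ge0.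
  have den' : n%:R * q + 2 = (n%:R * q) * (1 + 2 / q * n%:R^-1).
    by field; rewrite !gt_eqF//.
  by rewrite den'; move: den; set X := 1 + _ => X0; field; rewrite !gt_eqF//.
Qed.
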